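(* In the Bayesian probit linear mixed model described in the context, suppose that for each $j=1,\dots,r$ either ($a_j<0$ and $b_j=0$) or $b_j>0$, and suppose: (A1) $\bm W=(\bm X,\bm Z)$ has full column rank $p+q$; (A2) there exists a vector $\bm e\in\mathbb{R}^n$ with all entries strictly positive such that $\bm e^T\bm W^*=\bm 0$; (A3) $2a_j+q_j>0$ for $j=1,\dots,r$. Then the Markov chain $\{(\bm\eta^{(m)},\bm v^{(m)},\bm\tau^{(m)})\}_{m\ge0}$ of the two-block Gibbs sampler (equivalently its $\bm\eta$-marginal chain) is geometrically ergodic with respect to the (proper) posterior.
   Context: Model: $y_i\in\{0,1\}$, $\bm x_i\in\mathbb{R}^p$, $\bm z_i\in\mathbb{R}^q$ known, $\bm X$ ($n\times p$) has rows $\bm x_i^T$, $\bm Z$ ($n\times q$) has rows $\bm z_i^T$, $\bm W=(\bm X,\bm Z)$ with $i$th row $\bm w_i^T$. $\bm\beta\in\mathbb{R}^p$, $\bm u=(\bm u_1^T,\dots,\bm u_r^T)^T$, $\bm u_j\in\mathbb{R}^{q_j}$, $q_j>0$, $q=\sum q_j$, $\bm\eta=(\bm\beta^T,\bm u^T)^T$. $Y_i\mid\bm\beta,\bm u\overset{ind}{\sim}\mathrm{Bern}(\Phi(\bm x_i^T\bm\beta+\bm z_i^T\bm u))$ with $\Phi$ the standard normal cdf, $\bm u_j\overset{ind}{\sim}N(\bm0,\tau_j^{-1}\bm I_{q_j})$. Priors: $\pi(\bm\beta)\propto1$, $\pi(\tau_j)\propto e^{-b_j\tau_j}\tau_j^{a_j-1}$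 independently on $(0,\infty)$. $c_i=1-2y_i$; $\bm W^*$ has $i$th row $c_i\bm w_i^T$. $\bm D(\bm\tau)=\oplus_{j=1}^r\tau_j\bm I_{q_j}$ and $\bm\Sigma=\bm\Sigma(\bm\tau)=\begin{pmatrix}\bm X^T\bm X&\bm X^T\bm Z\\ \bm Z^T\bm X&\bm Z^T\bm Z+\bm D(\bm\tau)\end{pmatrix}$. Two-block Gibbs sampler: given $\bm\eta^{(m)}=(\bm\beta^{(m)},\bm u^{(m)})$, (1) draw independently $\tau_j^{(m+1)}\sim\mathrm{Gamma}(a_j+q_j/2,\ b_j+\bm u_j^{(m)T}\bm u_j^{(m)}/2)$ (shape, rate), $j=1,\dots,r$, and $v_i^{(m+1)}\sim\mathrm{TN}(\bm w_i^T\bm\eta^{(m)},1,y_i)$, $i=1,\dots,n$, where $\mathrm{TN}(\mu,1,1)$ (resp. $\mathrm{TN}(\mu,1,0)$) is the $N(\mu,1)$ distribution truncated to $(0,\infty)$ (resp. $(-\infty,0]$); (2) draw $\bm\eta^{(m+1)}\sim N_{p+q}(\bm\Sigma^{-1}\bm W^T\bm v^{(m+1)},\bm\Sigma^{-1})$ with $\bm\Sigma$ evaluated at $\bm\tau^{(m+1)}$. (On the null set where some $\bm u_j=\bm 0$ with $b_j=0$, the $\tau$-update may be defined arbitrarily, e.g. as Gamma(1,1).) A Markov chain with transition kernel $K$ and stationary distribution $\Pi$ is geometrically ergodic if there are $t\in(0,1)$ and $J:\text{state space}\to(0,\infty)$ with $\sup_O|K^m(x,O)-\Pi(O)|\le J(x)t^m$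 for all states $x$ and all $m$. *)

(* Defs.v *)
From HB Require Import structures.
From mathcomp Require Import all_boot all_order all_algebra.
From mathcomp Require Import all_classical all_reals all_analysis.
Set Implicit Arguments.
Unset Strict Implicit.
Unset Printing Implicit Defensive.
Import Order.TTheory GRing.Theory Num.Theory.
Import numFieldNormedType.Exports.
Local Open Scope classical_set_scope.
Local Open Scope ring_scope.

Section ProbitGibbs.
Variable R : realType.

(* lebint k f = \int_{R^k} f d(Lebesgue), written as an iterated one-dimensional
   Lebesgue integral (Tonelli; only used for nonnegative integrands). *)
Fixpoint lebint (k : nat) : (k.-tuple R -> \bar R) -> \bar R :=
  match k with
  | 0 => fun f => f [tuple]
  | k'.+1 => fun f =>
      (\int[@lebesgue_measure R]_x lebint (fun t : k'.-tuple R => f (cons_tuple x t)))%E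
  end.

Definition tcol (k : nat) (t : k.-tuple R) : 'cV[R]_k := \col_(i < k) tnth t i.

Definition phi (x : R) : R := expR (- (x ^+ 2) / 2) / Num.sqrt (2 * pi).
Definition Phi (x : R) : R :=
  fine (\int[@lebesgue_measure R]_(t in `]-oo, x]) (phi t)%:E)%E.

Definition gamma_un (al be x : R) : R :=
  if 0 < x then x `^ (al - 1) * expR (- (be * x)) else 0.
Definition gamma_pdf (al be x : R) : R :=
  gamma_un al be x / fine (\int[@lebesgue_measure R]_t (gamma_un al be t)%:E)%E.

Definition tn_set (y : bool) (t : R) : bool := if y then 0 < t else t <= 0.
Definition tn_pdf (mu : R) (y : bool) (x : R) : R :=
  (tn_set y x)%:R * phi (x - mu) /
  fine (\int[@lebesgue_measure R]_t ((tn_set y t)%:R * phi (t - mu))%:E)%E.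

(* N_k(m, S^{-1}) density, parametrized by the precision matrix S *)
Definition mvn_pdf (k : nat) (S : 'M[R]_k) (m x : 'cV[R]_k) : R :=
  Num.sqrt (\det S) / Num.sqrt (2 * pi) ^+ k *
  expR (- (((x - m)^T *m S *m (x - m)) 0 0) / 2).

Variables (n p r : nat) (qj : 'I_r -> nat).
Definition qsum : nat := (\sum_(j < r) qj j)%N.
Local Notation q := qsum.
Local Notation d := (p + q)%N.
Variables (X : 'M[R]_(n, p)) (Z : 'M[R]_(n, q)) (y : 'I_n -> bool) (a b : 'I_r -> R).

Definition W : 'M[R]_(n, d) := row_mx X Z.
Definition cc (i : 'I_n) : R := 1 - 2 * (y i)%:R.
Definition Wstar : 'M[R]_(n, d) := \matrix_(i, k) (cc i * W i k).

Definition inblk (j : 'I_r) (k : 'I_q) : bool :=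
  ((\sum_(l < r | (l < j)%N) qj l)%N <= k < (\sum_(l < r | (l <= j)%N) qj l)%N)%N.

Definition ucoord (eta : d.-tuple R) (k : 'I_q) : R := tnth eta (rshift p k).
Definition usq (eta : d.-tuple R) (j : 'I_r) : R :=
  \sum_(k < q | inblk j k) ucoord eta k ^+ 2.

(* D(tau) = oplus_j tau_j I_{q_j} and Sigma(tau) *)
Definition Dmx (tau : r.-tuple R) : 'M[R]_q :=
  \matrix_(k, l) ((k == l)%:R * \sum_(j < r | inblk j k) tnth tau j).
Definition Sigma (tau : r.-tuple R) : 'M[R]_d :=
  W^T *m W + block_mx (0 : 'M[R]_(p, p)) 0 0 (Dmx tau).

Definition lin (eta : d.-tuple R) (i : 'I_n) : R := (W *m tcol eta) i 0.

(* step (1): density of tau^{(m+1)} given eta^{(m)}; rate 0 (u_j = 0, b_j = 0) is a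
   null set on which Gamma(1,1) is used *)
Definition tau_cond (eta : d.-tuple R) (tau : r.-tuple R) : R :=
  \prod_(j < r)
    (let rate := b j + usq eta j / 2 in
     if 0 < rate then gamma_pdf (a j + (qj j)%:R / 2) rate (tnth tau j)
     else gamma_pdf 1 1 (tnth tau j)).
Definition v_cond (eta : d.-tuple R) (v : n.-tuple R) : R :=
  \prod_(i < n) tn_pdf (lin eta i) (y i) (tnth v i).
Definition kden (eta eta' : d.-tuple R) : \bar R :=
  lebint (fun tau : r.-tuple R => lebint (fun v : n.-tuple R =>
    (tau_cond eta tau * v_cond eta v *
     mvn_pdf (Sigma tau) (invmx (Sigma tau) *m (W^T *m tcol v)) (tcol eta'))%:E)).

Fixpoint Kpow (m : nat) (eta : d.-tuple R) (O : set (d.-tuple R)) : \bar R :=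
  match m with
  | 0 => (\1_O eta)%:E
  | m'.+1 => lebint (fun eta' : d.-tuple R => (kden eta eta' * Kpow m' eta' O)%E)
  end.

Definition lik (eta : d.-tuple R) : R :=
  \prod_(i < n) (if y i then Phi (lin eta i) else 1 - Phi (lin eta i)).
(* prior pi(tau_j) propto e^{-b_j tau_j} tau_j^{a_j - 1} on (0,oo), times the
   N(0, tau_j^{-1} I_{q_j}) density of u_j; flat prior on beta *)
Definition prior_u_tau (eta : d.-tuple R) (tau : r.-tuple R) : R :=
  \prod_(j < r)
    (let t := tnth tau j in
     if 0 < t then
       expR (- (b j * t)) * t `^ (a j - 1) *
       ((t / (2 * pi)) `^ ((qj j)%:R / 2) * expR (- (t * usq eta j) / 2))
     else 0).
Definition post_un (eta : d.-tuple R) (tau : r.-tuple R) : R :=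
  lik eta * prior_u_tau eta tau.
Definition post_norm : \bar R :=
  lebint (fun eta : d.-tuple R => lebint (fun tau : r.-tuple R => (post_un eta tau)%:E)).
Definition posterior (O : set (d.-tuple R)) : \bar R :=
  (lebint (fun eta : d.-tuple R =>
     ((\1_O eta)%:E * lebint (fun tau : r.-tuple R => (post_un eta tau)%:E)))
   * ((fine post_norm)^-1)%:E)%E.

End ProbitGibbs.

(* Main.v *)
Require Import Defs.
From HB Require Import structures.
From mathcomp Require Import all_boot all_order all_algebra.
From mathcomp Require Import all_classical all_reals all_analysis.
From mathcomp Require Import measurable_realfun normal_distribution ring lra zify.
Set Implicit Arguments.
Unset Strict Implicit.
Unset Printing Implicit Defensive.
Import Order.TTheory GRing.Theory Num.Theory.
Import numFieldNormedType.Exports.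
Local Open Scope classical_set_scope.
Local Open Scope ring_scope.

(** The function V(eta) = |W eta|^2 + sum_(b_j = 0) |u_j|^(a_j) is a Lyapunov function of the eta-chain.

    Quadratic term: the mean m of the normal update satisfies |W m| <= |v|, and v_i has second moment at most
    (1 + e) mu_i^2 + C when mu_i = (W eta)_i has the sign prescribed by y_i and at most C otherwise. By (A2) the
    well-signed mu_i carry at most a fixed fraction < 1 of |W eta|^2.

    Negative powers: with c = - a_j / 2, s = a_j + q_j / 2 and h = q_j / 2, a Gaussian computation gives
    E(|u_j|^(-2c) | tau) <= (lam + tau_j)^c 2^(-c) Gamma(h - c) / Gamma(h), and averaging over tau_j the coefficient
    of the old |u_j|^(-2c) becomes Gamma(h - c) Gamma(s + c) / (Gamma(h) Gamma(s)). Since h - c = s + c is the midpoint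
    of s < h, it is < 1 by strict log-convexity of Gamma.

    On a sublevel set of V the transition density is bounded below on the unit cube. It is reversible with respect to
    the marginal posterior density of eta, under which V is integrable because (A2) gives the likelihood Gaussian
    tails, so Harris' theorem applies. *)

(** * Lebesgue measure on tuples *)

Section TupleMeasure.
Variable R : realType.
Notation leb := (@lebesgue_measure R).

Definition consf k (z : measurableTypeR R * k.-tuple R) : k.+1.-tuple R :=
  cons_tuple z.1 z.2.
Definition unconsf k (t : k.+1.-tuple R) : measurableTypeR R * k.-tuple R :=
  (thead t, behead_tuple t).

Lemma consfK k : cancel (@consf k) (@unconsf k).
Proof. by case=> x t; rewrite /consf /unconsf theadE; congr (_, _); apply/val_inj. Qed.

Lemma measurable_consf k : measurable_fun setT (@consf k).
Proof.
have := @measurable_cons _ _ (measurableTypeR R * k.-tuple R)%type R fst k snd.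
by apply.
Qed.

Lemma measurable_unconsf k : measurable_fun setT (@unconsf k).
Proof.
apply: measurable_fun_pair => /=; first exact: measurable_tnth.
exact: measurable_behead.
Qed.

Section cons_measure.
Variables (l : {sigma_finite_measure set (measurableTypeR R) -> \bar R})
  (k : nat) (m : {sigma_finite_measure set (k.-tuple R) -> \bar R}).

Definition consm : set (k.+1.-tuple R) -> \bar R :=
  pushforward (l \x m)%E (@consf k).

HB.instance Definition _ := Measure.copy consm
  (measure_function_pushforward__canonical__measure_function_Measure
     (l \x m)%E (measurable_consf (k := k))).

Lemma consm_sigma_finite : sigma_finite setT consm.
Proof.
have /sigma_finiteP[F [FT ndF Foo]] := sigma_finiteT l.
have /sigma_finiteP[G [GT ndG Goo]] := sigma_finiteT m.
exists (fun i => @unconsf k @^-1` (F i `*` G i)).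
  rewrite -preimage_bigcup; apply/esym; rewrite -subTset => t _ /=.
  have [i _ Fi] : (\bigcup_i F i) (unconsf t).1 by rewrite -FT.
  have [j _ Gj] : (\bigcup_i G i) (unconsf t).2 by rewrite -GT.
  exists (maxn i j) => //; split.
    by move: Fi; exact/subsetPset/ndF/leq_maxl.
  by move: Gj; exact/subsetPset/ndG/leq_maxr.
move=> i; have [mFi Fi] := Foo i; have [mGi Gi] := Goo i; split.
  rewrite -[X in measurable X]setTI; apply: measurable_unconsf => //.
  exact: measurableX.
rewrite /consm /pushforward -comp_preimage.
rewrite (_ : unconsf (k:=k) \o consf (k:=k) = id); last first.
  by apply/funext=> z; exact: consfK.
by rewrite preimage_id product_measure1E// lte_mul_pinfty// ge0_fin_numE.
Qed.

HB.instance Definition _ := Measure_isSigmaFinite.Build _ _ _ consm consm_sigma_finite.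

Lemma integral_consm (f : k.+1.-tuple R -> \bar R) : measurable_fun setT f ->
  (forall t, 0 <= f t)%E ->
  (\int[consm]_t f t = \int[l]_x \int[m]_t f (cons_tuple x t))%E.
Proof.
move=> mf f0.
rewrite ge0_integral_pushforward//; last exact: measurable_consf.
rewrite preimage_setT fubini_tonelli1//; last by move=> z; exact: f0.
by apply: (measurableT_comp mf); exact: measurable_consf.
Qed.

End cons_measure.

(* The iterated integral [lebint] as integration against a genuine sigma-finite measure, so that Tonelli applies. *)
Fixpoint lebK k : {sigma_finite_measure set (k.-tuple R) -> \bar R} :=
  if k is k'.+1 then consm leb (lebK k') else dirac [tuple].

Lemma lebintE k (f : k.-tuple R -> \bar R) : measurable_fun setT f ->
  (forall t, 0 <= f t)%E -> lebint f = (\int[lebK k]_t f t)%E.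
Proof.
elim: k f => [|k IH] f mf f0 /=.
  by rewrite integral_dirac// diracT mul1e.
rewrite integral_consm//; apply: eq_integral => x _; rewrite IH//.
apply: (measurableT_comp mf).
exact: measurable_cons.
Qed.

Lemma emeasurable_prod d (T : measurableType d) I (s : seq I) (h : I -> T -> \bar R) :
  (forall i, measurable_fun setT (h i)) ->
  measurable_fun setT (fun x => \prod_(i <- s) h i x)%E.
Proof.
move=> mh; elim: s => [|i s IH].
  by under eq_fun do rewrite big_nil; exact: measurable_cst.
by under eq_fun do rewrite big_cons; exact: emeasurable_funM.
Qed.

Lemma lebK_prod k (f : 'I_k -> R -> \bar R) :
  (forall i, measurable_fun setT (f i)) -> (forall i x, 0 <= f i x)%E ->
  (\int[lebK k]_t (\prod_(i < k) f i (tnth t i)) = \prod_(i < k) \int[leb]_x f i x)%E.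
Proof.
elim: k f => [|k IH] f mf f0 /=.
  under eq_integral do rewrite big_ord0.
  by rewrite big_ord0 integral_cst//= mul1e diracT.
have mF i : measurable_fun setT (fun t : k.+1.-tuple R => f i (tnth t i)).
  by apply: measurableT_comp (mf i) (measurable_tnth i).
rewrite integral_consm//; last 2 first.
- by apply: emeasurable_prod.
- by move=> t; apply: prode_ge0.
have E x (t : k.-tuple R) : (\prod_(i < k.+1) f i (tnth (cons_tuple x t) i) =
    f ord0 x * \prod_(i < k) f (lift ord0 i) (tnth t i))%E.
  by rewrite big_ord_recl; congr (_ * _)%E; apply: eq_bigr => i _; rewrite tnthS.
have mG : measurable_fun setT (fun t : k.-tuple R => \prod_(i < k) f (lift ord0 i) (tnth t i))%E.
  apply: emeasurable_prod => i.
  by apply: measurableT_comp (mf _) (measurable_tnth i).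
rewrite [RHS]big_ord_recl -IH// -ge0_integralZr//.
apply: eq_integral => x _; rewrite -ge0_integralZl//.
- by apply: eq_integral => t _; exact: E.
- by move=> t _; apply: prode_ge0.
- exact: mf.
- by apply: integral_ge0 => t _; apply: prode_ge0.
Qed.
End TupleMeasure.

Section Wrappers.
Context d (T : measurableType d) (R : realType) (mu : {measure set T -> \bar R}).
Implicit Types f g : T -> \bar R.
Local Open Scope ereal_scope.

Lemma int_ge0 f : (forall x, 0 <= f x) -> 0 <= \int[mu]_x f x.
Proof. by move=> f0; exact: integral_ge0. Qed.

Lemma intZl (c : \bar R) f : 0 <= c -> measurable_fun setT f -> (forall x, 0 <= f x) ->
  \int[mu]_x (c * f x) = c * \int[mu]_x f x.
Proof. by move=> c0 mf f0; rewrite ge0_integralZl. Qed.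

Lemma intZr (c : \bar R) f : 0 <= c -> measurable_fun setT f -> (forall x, 0 <= f x) ->
  \int[mu]_x (f x * c) = (\int[mu]_x f x) * c.
Proof. by move=> c0 mf f0; rewrite ge0_integralZr. Qed.

Lemma intD f g : measurable_fun setT f -> measurable_fun setT g ->
  (forall x, 0 <= f x) -> (forall x, 0 <= g x) ->
  \int[mu]_x (f x + g x) = \int[mu]_x f x + \int[mu]_x g x.
Proof. by move=> mf mg f0 g0; rewrite ge0_integralD. Qed.

Lemma int_le f g : measurable_fun setT f -> measurable_fun setT g ->
  (forall x, 0 <= f x) -> (forall x, f x <= g x) ->
  \int[mu]_x f x <= \int[mu]_x g x.
Proof.
move=> mf mg f0 fg; apply: ge0_le_integral => //.
Qed.

End Wrappers.

Section MeasurableComp.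
Context d (T : measurableType d) (R : realType).
Implicit Types f g : T -> R.

Lemma mfunN f : measurable_fun setT f -> measurable_fun setT (fun x => - f x).
Proof. by move=> mf; apply: (measurableT_comp _ mf). Qed.

Lemma mfun_expR f : measurable_fun setT f -> measurable_fun setT (fun x => expR (f x)).
Proof. by move=> mf; apply: (measurableT_comp _ mf). Qed.

Lemma mfun_powR p f : measurable_fun setT f -> measurable_fun setT (fun x => f x `^ p).
Proof. by move=> mf; apply: (measurableT_comp (measurable_powR p) mf). Qed.

Lemma mfun_norm f : measurable_fun setT f -> measurable_fun setT (fun x => `|f x|).
Proof. by move=> mf; apply: (measurableT_comp _ mf). Qed.

End MeasurableComp.

Ltac meas := lazymatch goal with
 | |- measurable_fun _ (fun x => (@?F x)%:E) => first [assumption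
   | match goal with H : forall _, measurable_fun _ _ |- _ => exact: H
       | H : forall _ _, measurable_fun _ _ |- _ => exact: H end
   | apply/measurable_EFinP; meas]
 | |- measurable_fun _ (fun _ => ?c) => exact: measurable_cst
 | |- measurable_fun _ (fun x => x) => exact: measurable_id
 | |- measurable_fun _ (fun x => (@?F x * @?G x)%R) => apply: measurable_funM; meas
 | |- measurable_fun _ (fun x => (@?F x + - @?G x)%R) => apply: measurable_funB; meas
 | |- measurable_fun _ (fun x => (@?F x + @?G x)%R) => first [apply: measurable_funD|apply: emeasurable_funD]; meas
 | |- measurable_fun _ (fun x => (- @?F x)%R) => apply: mfunN; meas
 | |- measurable_fun _ (fun x => expR (@?F x)) => apply: mfun_expR; meas
 | |- measurable_fun _ (fun x => (@?F x `^ ?c)%R) => apply: mfun_powR; meas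
 | |- measurable_fun _ (fun x => (@?F x ^+ ?c)%R) => apply: measurable_funX; meas
 | |- measurable_fun _ (fun x => `|@?F x|%R) => apply: mfun_norm; meas
 | |- measurable_fun _ (fun x => (@?F x < @?G x)%R) => apply: measurable_fun_ltr; meas
 | |- measurable_fun _ (fun x => (@?F x <= @?G x)%R) => apply: measurable_fun_ler; meas
 | |- measurable_fun _ (fun x => (@?F x && @?G x)) => apply: measurable_and; meas
 | |- measurable_fun _ (fun x => (@?F x * @?G x)%E) => apply: emeasurable_funM; meas
 | |- measurable_fun _ (fun x => @?F x) => first [assumption
   | match goal with H : forall _, measurable_fun _ _ |- _ => exact: H
       | H : forall _ _, measurable_fun _ _ |- _ => exact: H end
   | (apply: measurable_fun_ifT; meas)
   | (apply: measurable_sum => ?; meas)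
   | (apply: measurable_prod => ? _; meas) | idtac]
 | |- measurable_fun _ (Order.lt ?a) => apply: (@measurable_fun_ltr _ _ _ _ (cst a) id); meas
 | |- measurable_fun _ (Order.le ?a) => apply: (@measurable_fun_ler _ _ _ _ (cst a) id); meas
 | |- measurable_fun _ (cst _) => exact: measurable_cst
 | |- measurable_fun _ id => exact: measurable_id
 | |- measurable_fun _ Num.norm => apply: mfun_norm; meas
 | |- measurable_fun _ (GRing.mul ?c) => apply: measurable_funM; meas
 | |- measurable_fun _ (GRing.add ?c) => apply: measurable_funD; meas
 | |- measurable_fun _ GRing.opp => apply: mfunN; meas
 | |- measurable_fun _ EFin => apply/measurable_EFinP; exact: measurable_id
 | |- measurable_fun _ expR => exact: measurable_expR
 | |- _ => try first [assumption | match goal with H : forall _, measurable_fun _ _ |- _ => exact: H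
       | H : forall _ _, measurable_fun _ _ |- _ => exact: H end]
 end.

(* From here on [//] also discharges measurability side conditions, using the hypotheses of the context. *)
#[global] Hint Extern 0 (measurable_fun _ _) => solve [meas] : core.

(** * Gaussian, Gamma and Beta integrals *)

Section OneDim.
Variable R : realType.
Notation leb := (@lebesgue_measure R).

Lemma leb_affine (a b : R) (f : R -> \bar R) : 0 < a -> measurable_fun setT f ->
  (forall x, 0 <= f x)%E ->
  (\int[leb]_x f x = a%:E * \int[leb]_x f (a * x + b)%R)%E.
Proof.
move=> a0 mf f0.
have mg : measurable_fun setT ((fun x => a * x + b) : measurableTypeR R -> measurableTypeR R).
  by apply: measurable_funD => //; exact: measurable_funM.
pose nu := measure_function_pushforward__canonical__measure_function_Measure leb mg.
rewrite -[X in (_ * X)%E](_ : \int[nu]_x f x = _)%E; last first.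
  by rewrite ge0_integral_pushforward.
pose a' := NngNum (ltW a0).
rewrite -[a in RHS]/(a'%:num) -ge0_integral_mscale//.
apply: eq_measure_integral => /= A mA _.
apply: (@lebesgue_measure_unique R (mscale a' nu)) => // _ [[u v]] _ <-.
rewrite /= /mscale/= /nu/= /pushforward/=.
rewrite (_ : _ @^-1` _ = `](u - b) / a, (v - b) / a]%classic); last first.
  apply/seteqP; split=> x /=; rewrite !in_itv/= => /andP[h1 h2]; apply/andP; split.
  - by rewrite ltr_pdivrMr// ltrBlDr mulrC.
  - by rewrite ler_pdivlMr// lerBrDr mulrC.
  - by move: h1; rewrite ltr_pdivrMr// ltrBlDr mulrC.
  - by move: h2; rewrite ler_pdivlMr// lerBrDr mulrC.
rewrite !lebesgue_measure_itv/= !lte_fin ltr_pM2r ?invr_gt0// ltrD2r.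
case: ifP => _; last by rewrite mule0.
by rewrite -!EFinB -EFinM; congr (_%:E); field; rewrite gt_eqF.
Qed.

Lemma leb_opp (f : R -> \bar R) : measurable_fun setT f ->
  (forall x, 0 <= f x)%E ->
  (\int[leb]_x f x = \int[leb]_x f (- x)%R)%E.
Proof.
move=> mf f0.
have mg : measurable_fun setT (-%R : measurableTypeR R -> measurableTypeR R) by [].
pose nu := measure_function_pushforward__canonical__measure_function_Measure leb mg.
rewrite -[RHS](_ : \int[nu]_x f x = _)%E; last first.
  by rewrite ge0_integral_pushforward.
by apply: eq_measure_integral => /= A mA _; rewrite /nu/= lebesgue_measureN.
Qed.

Lemma gauss1 (c m : R) : 0 < c ->
  (\int[leb]_x (expR (- (c * (x - m) ^+ 2) / 2))%:E = (Num.sqrt (2 * pi) / Num.sqrt c)%:E)%E.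
Proof.
move=> c0; set s := (Num.sqrt c)^-1.
have sc : Num.sqrt c != 0 by rewrite gt_eqF// sqrtr_gt0.
have s0 : s != 0 by rewrite invr_eq0.
have s2 : s ^+ 2 = c^-1 by rewrite exprVn sqr_sqrtr// ltW.
have P0 := normal_peak_gt0 s0.
have := @integral_normal_pdf R m s.
rewrite normal_pdfE// => I1.
rewrite -[RHS]mule1 -{}I1 -ge0_integralZl//; last 3 first.
- apply/measurable_EFinP; rewrite -normal_pdfE//; exact: measurable_normal_pdf.
- by move=> x _; rewrite lee_fin mulr_ge0 ?expR_ge0 ?ltW.
- by rewrite lee_fin divr_ge0 ?sqrtr_ge0.
apply: eq_integral => x _; rewrite -EFinM; congr (_%:E).
rewrite [RHS]mulrA (_ : _ * normal_peak s = 1); last first.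
  rewrite /normal_peak s2 (_ : c^-1 * pi *+ 2 = c^-1 * (2 * pi)); last by ring.
  rewrite [Num.sqrt (c^-1 * _)]sqrtrM ?invr_ge0 ?(ltW c0)// sqrtrV ?(ltW c0)//.
  have p0 : Num.sqrt (2 * pi) != 0 :> R by rewrite gt_eqF// sqrtr_gt0 mulr_gt0 ?pi_gt0.
  by rewrite /s; field; rewrite sc p0.
rewrite mul1r /normal_fun s2; congr expR.
by rewrite -mulr_natl; field; rewrite gt_eqF.
Qed.

Lemma powR01_int (al : R) : 0 < al ->
  (\int[leb]_x (if 0 < x <= 1 then x `^ (al - 1) else 0)%:E < +oo)%E.
Proof.
move=> al0.
pose F n : set R := `[n.+1%:R^-1, 1]%classic.
have -> : (\int[leb]_x (if 0 < x <= 1 then x `^ (al - 1) else 0)%:E =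
    \int[leb]_(x in \bigcup_n F n) (x `^ (al - 1))%:E)%E.
  rewrite [RHS]integral_mkcond; apply: eq_integral => x _ /=.
  rewrite patchE; case: ifPn => [/andP[x0 x1]|x01].
    rewrite ifT// inE; exists (Num.truncn x^-1) => //.
    rewrite /F/= in_itv/= x1 andbT -[leRHS]invrK lef_pV2 ?posrE ?invr_gt0//.
    by apply/ltW; rewrite truncnS_gt.
  rewrite ifF//; apply/negbTE; apply: contra x01; rewrite inE => -[n _].
  rewrite /F/= in_itv/= => /andP[h ->]; rewrite andbT.
  by apply: lt_le_trans h; rewrite invr_gt0.
have mf : measurable_fun setT (fun x : R => (x `^ (al - 1))%:E).
  by apply/measurable_EFinP.
have cv : (\int[leb]_(x in F i) (x `^ (al - 1))%:E @[i --> \oo] -->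
    \int[leb]_(x in \bigcup_i F i) (x `^ (al - 1))%:E)%E.
  apply: ge0_nondecreasing_set_cvg_integral.
  - move=> i j ij; rewrite subsetEset => x; rewrite /F/= !in_itv/= => /andP[h ->].
    by rewrite andbT (le_trans _ h)// lef_pV2 ?posrE// ler_nat.
  - by move=> i; exact: measurable_itv.
  - by move=> i; exact: measurable_funS mf.
  - by move=> i x _; rewrite lee_fin powR_ge0.
rewrite -(cvg_lim _ cv)//.
apply: (@le_lt_trans _ _ (al^-1)%:E); last by rewrite ltry.
apply: lime_le; first by apply/cvg_ex; eexists; exact: cv.
near=> n.
pose e : R := n.+1%:R^-1.
have e0 : 0 < e by rewrite invr_gt0.
have e1 : e < 1.
  rewrite invf_lt1// ltr1n ltnS; near: n; exists 1%N => //.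
rewrite /F (@continuous_FTC2 _ _ (fun x => al^-1 * x `^ al))//.
- rewrite powR1 mulr1 -EFinB lee_fin lerBlDr lerDl.
  by rewrite mulr_ge0 ?powR_ge0// invr_ge0 ltW.
- have cR x : 0 < x -> {for x, continuous (fun x : R => x `^ (al - 1))}.
    move=> x0; apply: differentiable_continuous; apply/derivable1_diffP.
    by have [] := is_derive1_powR (al - 1) x0.
  apply: continuous_in_subspaceT => x; rewrite inE/= in_itv/= => /andP[h _].
  by apply: cR; exact: lt_le_trans h.
- have dF x : 0 < x -> derivable (fun x : R => al^-1 * x `^ al) x 1.
    by move=> x0; apply: derivableM => //; have [] := is_derive1_powR al x0.
  have cF x : 0 < x -> {for x, continuous (fun x : R => al^-1 * x `^ al)}.
    by move=> x0; apply: differentiable_continuous; apply/derivable1_diffP; exact: dF.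
  split.
  + by move=> x; rewrite in_itv/= => /andP[h _]; apply: dF; exact: lt_trans h.
  + by apply: cvg_at_right_filter; exact: cF.
  + by apply: cvg_at_left_filter; exact: cF.
- move=> x; rewrite in_itv/= => /andP[h _].
  have x0 : 0 < x by exact: lt_trans h.
  have [d1 d2] := is_derive1_powR al x0.
  rewrite derive1E deriveZ//= d2 /GRing.scale/= mulrA mulVf ?mul1r// gt_eqF//.
Unshelve. all: by end_near. Qed.

Lemma measurable_gamma_un (al be : R) : measurable_fun setT (gamma_un al be).
Proof.
by rewrite /gamma_un; meas.
Qed.

Lemma gamma_un_ge0 (al be x : R) : 0 <= gamma_un al be x.
Proof. by rewrite /gamma_un; case: ifP => // _; rewrite mulr_ge0 ?powR_ge0 ?expR_ge0. Qed.

Lemma powR_le_expR (y K x : R) : 0 < x -> 0 < K -> 0 <= y -> y <= K -> x `^ y <= K `^ y * expR x.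
Proof.
move=> x0 K0 y0 yK; rewrite /powR !gt_eqF// -expRD ler_expR.
have h : ln (x / K) <= x / K - 1.
  have := expR_ge1Dx (ln (x / K)); rewrite lnK ?posrE ?divr_gt0// => h.
  by rewrite lerBrDl.
rewrite ln_div ?posrE// in h.
have {h}h : ln x <= x / K + ln K by lra.
apply: (@le_trans _ _ (y * (x / K + ln K))); first exact: ler_wpM2l.
rewrite mulrDr addrC lerD2l mulrCA ler_piMr ?(ltW x0)//.
by rewrite ler_pdivrMr// mul1r.
Qed.

Definition Gam (al : R) : R := fine (\int[leb]_x (gamma_un al 1 x)%:E)%E.

Lemma gamma_un_fin (al : R) : 0 < al -> (\int[leb]_x (gamma_un al 1 x)%:E < +oo)%E.
Proof.
move=> al0.
pose y : R := `|al - 1|.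
pose K : R := 2 * (y + 1).
pose C := K `^ y * 2 `^ y.
have y0 : 0 <= y by rewrite normr_ge0.
have K0 : 0 < K by rewrite /K; lra.
have yK : y <= K by rewrite /K; lra.
have C0 : 0 <= C by rewrite mulr_ge0 ?powR_ge0.
have key x : gamma_un al 1 x <= (if 0 < x <= 1 then x `^ (al - 1) else 0)
     + 2 * C * exponential_pdf 2^-1 x.
  have E0 : 0 <= 2 * C * exponential_pdf 2^-1 x.
    by apply: mulr_ge0; [exact: mulr_ge0|rewrite exponential_pdf_ge0// invr_ge0].
  rewrite /gamma_un mul1r; have [x0|x0] /= := ltP 0 x; last by rewrite add0r.
  have [x1|x1] := leP x 1 => /=.
    apply: (@le_trans _ _ (x `^ (al - 1))); last by rewrite lerDl.
    by rewrite ler_piMr ?powR_ge0// -[leRHS]expR0 ler_expR oppr_le0 ltW.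
  rewrite add0r exponential_pdfE ?(ltW x0)//.
  apply: (@le_trans _ _ (x `^ y * expR (- x))).
    by rewrite ler_wpM2r ?expR_ge0// ler_powR ?(ltW x1)// ler_norm.
  have x2 : 0 < x / 2 by lra.
  have -> : x `^ y = (x / 2) `^ y * 2 `^ y.
    by rewrite -powRM ?(ltW x2)// divfK.
  apply: (@le_trans _ _ (K `^ y * expR (x / 2) * 2 `^ y * expR (- x))).
    by rewrite !ler_wpM2r ?expR_ge0 ?powR_ge0// powR_le_expR.
  have -> : - x = - (x / 2) + - 2^-1 * x by lra.
  rewrite expRD /C expRN le_eqVlt; apply/orP; left; apply/eqP; field.
  by rewrite gt_eqF// expR_gt0.
apply: (@le_lt_trans _ _ (\int[leb]_x ((if 0 < x <= 1 then x `^ (al - 1) else 0)%:E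
     + (2 * C)%:E * (exponential_pdf 2^-1 x)%:E))%E).
  apply: int_le => //.
  - by apply/measurable_EFinP; exact: measurable_gamma_un.
  - by meas; exact: measurable_exponential_pdf.
  - by move=> x; rewrite lee_fin gamma_un_ge0.
have mE : measurable_fun setT (fun x : R => (exponential_pdf 2^-1 x)%:E).
  by apply/measurable_EFinP; exact: measurable_exponential_pdf.
have e0 x : (0 <= (exponential_pdf (2^-1 : R) x)%:E)%E.
  by rewrite lee_fin exponential_pdf_ge0// invr_ge0.
rewrite intD//; last 2 first.
- by move=> x; rewrite lee_fin; case: ifP => // _; exact: powR_ge0.
- by move=> x; apply: mule_ge0 => //; rewrite lee_fin mulr_ge0.
rewrite intZl//; last by rewrite lee_fin mulr_ge0.
rewrite integral_exponential_pdf ?invr_gt0// mule1.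
by apply: lte_add_pinfty; [exact: powR01_int|rewrite ltry].
Qed.

Lemma int_gt0 (f : R -> R) : measurable_fun setT f -> (forall x, 0 <= f x) ->
  (forall x, 0 < x < 1 -> 0 < f x) -> (0 < \int[leb]_x (f x)%:E)%E.
Proof.
move=> mf f0 f1; rewrite lt_neqAle int_ge0 ?andbT; last by move=> x; rewrite lee_fin.
apply/eqP => /esym I0.
have mE : measurable_fun setT (EFin \o f) by apply/measurable_EFinP.
have : (\int[leb]_x `|(f x)%:E| = 0)%E.
  by under eq_integral do rewrite gee0_abs ?lee_fin//.
move=> /(ae_eq_integral_abs leb measurableT mE)[N [mN N0 sub]].
have : (leb `]0%R, 1%R[%classic <= leb N)%E.
  apply: le_measure; rewrite ?inE//.
  move=> x /=; rewrite in_itv/= => /f1 fx; apply: sub => /= /(_ I) [] h.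
  by rewrite h ltxx in fx.
by rewrite N0 lebesgue_measure_itv/= lte_fin ltr01 oppr0 adde0 lee_fin ler10.
Qed.

Lemma gamma_int (al be : R) : 0 < al -> 0 < be ->
  (\int[leb]_x (gamma_un al be x)%:E = (Gam al * be `^ (- al))%:E)%E.
Proof.
move=> al0 be0.
have mg b : measurable_fun setT (fun x => (gamma_un al b x)%:E).
  by apply/measurable_EFinP; exact: measurable_gamma_un.
rewrite (@leb_affine be^-1 0)//; last 2 first.
- by rewrite invr_gt0.
- by move=> x; rewrite lee_fin gamma_un_ge0.
have E x : ((gamma_un al be (be^-1 * x + 0))%:E = (be `^ (1 - al))%:E * (gamma_un al 1 x)%:E)%E.
  rewrite -EFinM; congr _%:E; rewrite /gamma_un addr0 pmulr_rgt0 ?invr_gt0//.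
  case: ifP => x0; last by rewrite mulr0.
  rewrite mul1r mulrA mulfV ?mul1r ?gt_eqF// mulrA; congr (_ * _).
  rewrite powRM ?invr_ge0 ?(ltW be0) ?(ltW x0)//; congr (_ * _).
  by rewrite -[be^-1]powR_inv1 ?(ltW be0)// -powRrM; congr (_ `^ _); ring.
under eq_integral do rewrite E.
have g0 x : (0 <= (gamma_un al 1 x)%:E)%E by rewrite lee_fin gamma_un_ge0.
rewrite intZl// ?lee_fin ?powR_ge0//.
rewrite muleA -EFinM -[X in (_ * X)%E]fineK; last first.
  rewrite ge0_fin_numE ?gamma_un_fin//.
  by apply: int_ge0 => x; rewrite lee_fin gamma_un_ge0.
rewrite -EFinM mulrC; congr (_ * _)%:E.
rewrite -[be^-1]powR_inv1 ?(ltW be0)// -powRD; first by congr (_ `^ _); ring.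
by rewrite (gt_eqF be0) implybT.
Qed.

Lemma Gam_gt0 (al : R) : 0 < al -> 0 < Gam al.
Proof.
move=> al0; apply: fine_gt0; rewrite gamma_un_fin// andbT.
apply: int_gt0; first exact: measurable_gamma_un.
- by move=> x; rewrite gamma_un_ge0.
- by move=> x /andP[x0 _]; rewrite /gamma_un x0 mulr_gt0 ?powR_gt0 ?expR_gt0.
Qed.

End OneDim.

Section OneDim2.
Variable R : realType.
Notation leb := (@lebesgue_measure R).

Lemma int_gt0_itv (a b : R) (f : R -> R) : a < b -> measurable_fun setT f -> (forall x, 0 <= f x) ->
  (forall x, a < x < b -> 0 < f x) -> (0 < \int[leb]_x (f x)%:E)%E.
Proof.
move=> ab mf f0 f1; rewrite (@leb_affine _ (b - a) a) ?subr_gt0//.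
rewrite mule_gt0// ?lte_fin ?subr_gt0//.
apply: (@int_gt0 R (fun x => f ((b - a) * x + a))) => //.
- by apply: (measurableT_comp mf); meas.
- move=> x /andP[x0 x1]; apply: f1; rewrite ltrDr mulr_gt0 ?subr_gt0//=.
  by rewrite -ltrBrDr -[ltRHS]mulr1 ltr_pM2l ?subr_gt0.
Qed.

Lemma gamma_intE (al : R) : 0 < al -> (\int[leb]_x (gamma_un al 1 x)%:E = (Gam al)%:E)%E.
Proof. by move=> a0; rewrite gamma_int// powR1 mulr1. Qed.

Lemma gamma_mid (s t A B M : R) : s < t -> 0 < A -> 0 < B -> 0 < M ->
  (\int[leb]_x (gamma_un s 1 x)%:E = A%:E)%E -> (\int[leb]_x (gamma_un t 1 x)%:E = B%:E)%E ->
  (\int[leb]_x (gamma_un ((s + t) / 2) 1 x)%:E = M%:E)%E -> M ^+ 2 < A * B.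
Proof.
move=> st A0 B0 M0 IA IB IM; set m : R := (s + t) / 2 in IM.
pose a : R := Num.sqrt A; pose b : R := Num.sqrt B.
have a0 : 0 < a by rewrite sqrtr_gt0.
have b0 : 0 < b by rewrite sqrtr_gt0.
have aA : a ^+ 2 = A by rewrite sqr_sqrtr// ltW.
have bB : b ^+ 2 = B by rewrite sqr_sqrtr// ltW.
(* Strict Cauchy-Schwarz: [F] is a square times a positive weight, and [sqrt A], [sqrt B] make its cross term [2 sqrt(A B) M]. *)
pose F x := A * gamma_un t 1 x + B * gamma_un s 1 x - 2 * a * b * gamma_un m 1 x.
have FE x : F x = if 0 < x then (a * x `^ ((t - s) / 2) - b) ^+ 2 * x `^ (s - 1) * expR (- x) else 0.
  rewrite /F /gamma_un; case: ifP => x0; last by ring.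
  have xn : x != 0 by rewrite gt_eqF.
  have -> : t - 1 = (t - s) / 2 + (t - s) / 2 + (s - 1) by field.
  have -> : m - 1 = (t - s) / 2 + (s - 1) by rewrite /m; field.
  rewrite !powRD ?xn ?implybT//; rewrite mul1r -aA -bB; ring.
have F0 x : 0 <= F x.
  by rewrite FE; case: ifP => // _; rewrite mulr_ge0 ?expR_ge0// mulr_ge0 ?powR_ge0// sqr_ge0.
have mg al : measurable_fun setT (@gamma_un R al 1) by exact: measurable_gamma_un.
have mF : measurable_fun setT F by rewrite /F; meas; exact: mg.
have ts : 0 < (t - s) / 2 by lra.
pose x0 := (b / a) `^ ((t - s) / 2)^-1.
have x00 : 0 < x0 by rewrite powR_gt0// divr_gt0.
have IF : (0 < \int[leb]_x (F x)%:E)%E.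
  apply: (@int_gt0_itv x0 (x0 + 1)) => //; first by lra.
  move=> x /andP[xx _]; have xp : 0 < x by lra.
  rewrite FE xp mulr_gt0 ?expR_gt0// mulr_gt0 ?powR_gt0// exprn_even_gt0//= subr_eq0.
  rewrite gt_eqF// -ltr_pdivrMl// mulrC.
  have -> : b / a = x0 `^ ((t - s) / 2).
    by rewrite /x0 -powRrM mulVf ?gt_eqF// powRr1// divr_ge0// ltW.
  by apply: gt0_ltr_powR => //; rewrite nnegrE ltW.
have E : (\int[leb]_x (F x)%:E + (2 * a * b * M)%:E = (2 * A * B)%:E)%E.
{
  have g0 al x : (0 <= (gamma_un al 1 x : R)%:E)%E by rewrite lee_fin gamma_un_ge0.
  have mE al : measurable_fun setT (fun x : R => (gamma_un al 1 x)%:E) by meas; exact: mg.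
  have c0 : (0 <= (2 * a * b)%:E)%E by rewrite lee_fin mulr_ge0 ?mulr_ge0// ltW.
  rewrite EFinM -IM -intZl//.
  rewrite -intD//; last first.
    by move=> x; rewrite mule_ge0.
  under eq_integral => x _ do rewrite -EFinM -EFinD /F subrK EFinD !EFinM.
  rewrite intD//; last 2 first.
  - by move=> x; rewrite mule_ge0// lee_fin ltW.
  - by move=> x; rewrite mule_ge0// lee_fin ltW.
  rewrite !intZl ?lee_fin ?(ltW A0) ?(ltW B0)// ?IA ?IB//.
  by rewrite -!EFinM -EFinD; congr _%:E; ring.
}
have : ((2 * a * b * M)%:E < (2 * A * B)%:E)%E.
  by rewrite lte_fin; move: IF E; case: (\int[leb]_x _)%E => [u| |]//=; rewrite lte_fin => u0 [<-]; rewrite ltrDr.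
rewrite lte_fin => h; have {h}h : M < a * b.
  have h2 : 2 * (a * b) * M < 2 * (a * b) * (a * b).
    by move: h; rewrite -aA -bB; congr (_ < _); ring.
  by move: h2; rewrite ltr_pM2l// !mulr_gt0.
rewrite -aA -bB -exprMn; apply: ltrXn2r => //; exact: ltW.
Qed.

Lemma Gam_mid (s t : R) : 0 < s -> s < t -> Gam ((s + t) / 2) ^+ 2 < Gam s * Gam t.
Proof.
move=> s0 st; have t0 : 0 < t by lra.
have m0 : 0 < (s + t) / 2 by lra.
by apply: (@gamma_mid s t) => //; rewrite ?Gam_gt0 ?gamma_intE.
Qed.

(* Write [(1 + t / L) ^ -h] as a Gamma mixture of exponentials in [t] and exchange the integrals. *)
Lemma beta_int (c h L : R) : 0 < c -> c < h -> 0 < L ->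
  (\int[leb]_t (if (0 < t)%R then t `^ (c - 1) * (1 + t / L) `^ (- h) else 0)%:E =
    (L `^ c * (Gam c * Gam (h - c) / Gam h))%:E)%E.
Proof.
move=> c0 ch L0.
have h0 : 0 < h by lra.
have hc0 : 0 < h - c by lra.
have Gh := Gam_gt0 h0.
have mg b al : measurable_fun setT (fun x : R => (gamma_un al b x)%:E).
  by apply/measurable_EFinP; exact: measurable_gamma_un.
have g0 b al x : (0 <= (gamma_un al b x : R)%:E)%E by rewrite lee_fin gamma_un_ge0.
pose f (z : R * R) : \bar R := if 0 < z.1 then
   ((z.1 `^ (c - 1))%:E * (gamma_un h (L + z.1) z.2)%:E)%E else 0%E.
have m1 : measurable_fun setT (fun z : R * R => z.1) by exact: measurable_fst.
have m2 : measurable_fun setT (fun z : R * R => z.2) by exact: measurable_snd.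
have mf : measurable_fun setT f by rewrite /f /gamma_un; meas.
have f0 z : (0 <= f z)%E.
  rewrite /f; case: ifP => // _.
  by rewrite mule_ge0// lee_fin// ?powR_ge0// gamma_un_ge0.
have K0 : 0 <= L `^ h / Gam h by rewrite divr_ge0 ?powR_ge0// ltW.
have E1 t : ((if 0 < t then t `^ (c - 1) * (1 + t / L) `^ (- h) else 0)%:E =
    (L `^ h / Gam h)%:E * \int[leb]_x f (t, x))%E.
  rewrite /f/=; have [t0|t0] := ltP 0 t; last by rewrite integral0 mule0.
  rewrite intZl ?lee_fin ?powR_ge0//.
  rewrite gamma_int// ?addr_gt0// -!EFinM; congr _%:E.
  have -> : 1 + t / L = (L + t) * L^-1 by field; rewrite gt_eqF.
  rewrite powRM ?invr_ge0 ?addr_ge0 ?ltW// -[L^-1]powR_inv1 ?(ltW L0)// -powRrM mulN1r opprK.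
  by field; rewrite gt_eqF.
under eq_integral => t _ do rewrite E1.
have mF : measurable_fun setT (fun t => (\int[leb]_x f (t, x))%E).
  exact: (@measurable_fun_fubini_tonelli_F _ _ (measurableTypeR R) (measurableTypeR R) R leb f).
rewrite intZl ?lee_fin//; last by move=> t; exact: int_ge0.
rewrite (@fubini_tonelli _ _ (measurableTypeR R) (measurableTypeR R) R leb leb f)//.
have E2 x : (\int[leb]_t f (t, x) = (Gam c)%:E * (gamma_un (h - c) L x)%:E)%E.
  rewrite /f/= /gamma_un; have [x0|x0] := ltP 0 x; last first.
    rewrite mule0; under eq_integral => t _ do rewrite mule0 if_same.
    by rewrite integral0.
  have xn : x != 0 by rewrite gt_eqF.
  transitivity (\int[leb]_t ((x `^ (h - 1) * expR (- (L * x)))%:E * (gamma_un c x t)%:E))%E.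
    apply: eq_integral => t _; rewrite /gamma_un; case: ifP => t0; last by rewrite mule0.
    rewrite -!EFinM mulrDl opprD expRD [x * t]mulrC; congr _%:E; ring.
  rewrite intZl ?lee_fin ?mulr_ge0 ?powR_ge0 ?expR_ge0// gamma_int// -!EFinM; congr _%:E.
  have -> : h - c - 1 = (h - 1) + (- c) by ring.
  by rewrite [x `^ (h - 1 + - c)]powRD ?xn ?implybT//; ring.
under eq_integral => x _ do rewrite E2.
rewrite intZl ?lee_fin ?(ltW (Gam_gt0 _))// gamma_int// -!EFinM; congr _%:E.
have -> : - (h - c) = c - h by ring.
have Ln : L != 0 by rewrite gt_eqF.
rewrite powRB ?Ln ?implybT//.
have Lh : L `^ h != 0 by rewrite gt_eqF// powR_gt0.
move: (Gam c) (Gam (h - c)) (Gam h) Gh (L `^ h) Lh (L `^ c) => ga gb gc Gh Lh Lh0 Lc.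
by field; rewrite Lh0 gt_eqF.
Qed.

Lemma abs_gauss_int (th de : R) : 0 <= th -> th < 1 -> 0 < de ->
  (\int[leb]_x (`|x| `^ (- th) * expR (- (de * x ^+ 2)))%:E < +oo)%E.
Proof.
move=> t0 t1 d0.
pose P (x : R) : R := if 0 < x <= 1 then x `^ (1 - th - 1) else 0.
have mP : measurable_fun setT P by rewrite /P; meas.
have mPN : measurable_fun setT (fun x : R => (P (- x))%:E).
  by apply/measurable_EFinP; apply: (measurableT_comp mP).
have P0 x : 0 <= P x by rewrite /P; case: ifP => // _; exact: powR_ge0.
have IP : (\int[leb]_x (P x)%:E < +oo)%E by apply: powR01_int; lra.
have d2 : 0 < 2 * de by lra.
have IG := gauss1 0 d2.
apply: (@le_lt_trans _ _ (\int[leb]_x ((P x)%:E + ((P (- x))%:E + (expR (- (2 * de * (x - 0) ^+ 2) / 2))%:E)))%E).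
  apply: int_le => //.
  move=> x; rewrite -!EFinD lee_fin subr0.
  have -> : - (2 * de * x ^+ 2) / 2 = - (de * x ^+ 2) by field.
  have e1 : expR (- (de * x ^+ 2)) <= 1 by rewrite expR_le1 oppr_le0 mulr_ge0 ?sqr_ge0// ltW.
  have e0 := expR_gt0 (- (de * x ^+ 2)).
  have [->|x0] := eqVneq x 0.
    rewrite normr0; apply: (@le_trans _ _ (expR (- (de * 0 ^+ 2)))).
      rewrite ler_piMl ?expR_ge0//; have [->|tn] := eqVneq th 0.
        by rewrite oppr0 powRr0.
      by rewrite powR0 ?oppr_eq0// ltr01.
    by rewrite addrA lerDr addr_ge0.
  have [x1|x1] := leP `|x| 1.
    apply: (@le_trans _ _ (`|x| `^ (- th))); first by rewrite ler_piMr ?powR_ge0.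
    have E : `|x| `^ (- th) = P x + P (- x).
      rewrite /P; have -> : 1 - th - 1 = - th by ring.
      have [xp|xp] := ltP 0 x.
        by rewrite oppr_gt0 ltNge (ltW xp)/= addr0 -(gtr0_norm xp) x1 normr_id.
      have xn : 0 < - x by rewrite oppr_gt0 lt_neqAle x0.
      by rewrite add0r -(ler0_norm xp) x1 normr_gt0 x0.
    by rewrite addrA -E lerDl ltW.
  apply: (@le_trans _ _ (expR (- (de * x ^+ 2)))).
    rewrite ler_piMl ?expR_ge0// -[leRHS](powRr0 `|x|) ler_powR ?(ltW x1)// oppr_le0 //.
  by rewrite addrA lerDr addr_ge0.
rewrite intD ?intD//; last first.
- by move=> x; rewrite adde_ge0 ?lee_fin ?P0 ?expR_ge0.
- by move=> x; rewrite lee_fin P0.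
rewrite IG -(@leb_opp _ (fun x => (P x)%:E))//.
by rewrite lte_add_pinfty// lte_add_pinfty// ltry.
Qed.

Lemma eq_int_off0 (f g : R -> \bar R) : measurable_fun setT f -> measurable_fun setT g ->
  (forall x, 0 <= f x)%E -> (forall x, 0 <= g x)%E -> (forall x, x != 0 -> f x = g x) ->
  (\int[leb]_x f x = \int[leb]_x g x)%E.
Proof.
move=> mf mg f0 g0 fg; apply: ge0_ae_eq_integral => //.
exists [set 0]; split => //; first exact: lebesgue_measure_set1.
move=> x /= h; apply/eqP; apply: contra_notT h => x0 _; exact: fg.
Qed.
End OneDim2.

(** * Truncated normal distribution *)

Section TruncNormal.
Variable R : realType.
Notation leb := (@lebesgue_measure R).

Lemma phi_gt0 (x : R) : 0 < phi x.
Proof. by rewrite divr_gt0 ?expR_gt0// sqrtr_gt0 mulr_gt0 ?pi_gt0. Qed.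

Lemma phi_ge0 (x : R) : 0 <= phi x. Proof. exact/ltW/phi_gt0. Qed.

Lemma measurable_phi : measurable_fun setT (@phi R).
Proof. by rewrite /phi; meas. Qed.

Lemma phiN (x : R) : phi (- x) = phi x.
Proof. by rewrite /phi sqrrN. Qed.

Lemma mphi d (T : measurableType d) (f : T -> R) : measurable_fun setT f ->
  measurable_fun setT (fun x => phi (f x)).
Proof. by move=> mf; apply: (measurableT_comp measurable_phi). Qed.

Lemma phi_int (mu : R) : (\int[leb]_t (phi (t - mu))%:E = 1)%E.
Proof.
have p0 : 0 < Num.sqrt (2 * pi) :> R by rewrite sqrtr_gt0 mulr_gt0 ?pi_gt0.
rewrite /phi; under eq_integral => t _ do rewrite mulrC EFinM -[(t - mu) ^+ 2]mul1r.
by rewrite intZl ?lee_fin ?invr_ge0 ?(ltW p0)// gauss1// sqrtr1 divr1 -EFinM mulVf// gt_eqF.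
Qed.

Definition tnI (y : bool) (t : R) : R := (tn_set y t)%:R.

Lemma measurable_tnI y : measurable_fun setT (tnI y).
Proof.
rewrite (_ : tnI y = fun t => if y then (if 0 < t then 1 else 0) else (if t <= 0 then 1 else 0)).
  by case: y; meas.
by apply/funext => t; rewrite /tnI /tn_set; case: y; case: ifP.
Qed.

Lemma tnI_ge0 y t : 0 <= tnI y t. Proof. exact: ler0n. Qed.

Lemma tnI_le1 y t : tnI y t <= 1. Proof. by rewrite /tnI; case: tn_set. Qed.

Definition ZT (y : bool) (mu : R) : R := fine (\int[leb]_t (tnI y t * phi (t - mu))%:E)%E.

Lemma tphi_meas y (mu : R) : measurable_fun setT (fun t : R => (tnI y t * phi (t - mu))%:E).
Proof.
apply/measurable_EFinP; apply: measurable_funM; first exact: measurable_tnI.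
by apply: mphi.
Qed.

Lemma tphi_ge0 y (mu t : R) : 0 <= tnI y t * phi (t - mu).
Proof. by rewrite mulr_ge0 ?tnI_ge0 ?phi_ge0. Qed.

Lemma phis_meas (mu : R) : measurable_fun setT (fun t : R => (phi (t - mu))%:E).
Proof. by apply/measurable_EFinP; exact: mphi. Qed.

Lemma ZTE y mu : (\int[leb]_t (tnI y t * phi (t - mu))%:E = (ZT y mu)%:E)%E.
Proof.
rewrite /ZT fineK// ge0_fin_numE; last by apply: int_ge0 => t; rewrite lee_fin tphi_ge0.
apply: (@le_lt_trans _ _ (\int[leb]_t (phi (t - mu))%:E)%E); last by rewrite phi_int ltry.
apply: int_le; [exact: tphi_meas|exact: phis_meas|by move=> t; rewrite lee_fin tphi_ge0|].
by move=> t; rewrite lee_fin ler_piMl ?phi_ge0// tnI_le1.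
Qed.

Lemma ZT_ge0 y mu : 0 <= ZT y mu.
Proof. by rewrite -lee_fin -ZTE; apply: int_ge0 => t; rewrite lee_fin tphi_ge0. Qed.

Lemma ZT_sum mu : ZT true mu + ZT false mu = 1.
Proof.
apply: EFin_inj; rewrite EFinD -!ZTE -intD; last 4 first.
- exact: tphi_meas.
- exact: tphi_meas.
- by move=> t; rewrite lee_fin tphi_ge0.
- by move=> t; rewrite lee_fin tphi_ge0.
rewrite -(phi_int mu); apply: eq_integral => t _.
by rewrite -EFinD -mulrDl /tnI /tn_set; case: ltP => _; rewrite ?addr0 ?add0r mul1r.
Qed.

Lemma ZT_le1 y mu : ZT y mu <= 1.
Proof.
have := ZT_sum mu; have := ZT_ge0 true mu; have := ZT_ge0 false mu.
by case: y; lra.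
Qed.

Lemma ZT_gt0 y mu : 0 < ZT y mu.
Proof.
rewrite -lte_fin -ZTE; set a : R := if y then 0 else -1.
apply: (@int_gt0_itv _ a (a + 1)).
- by rewrite ltrDl.
- by apply/measurable_EFinP; exact: tphi_meas.
- by move=> t; rewrite tphi_ge0.
- move=> t; rewrite /a /tnI /tn_set; case: y {a} => /andP[t0 t1].
    by rewrite t0 mul1r phi_gt0.
  by rewrite (_ : t <= 0) ?mul1r ?phi_gt0//; lra.
Qed.

Lemma Phi_ZT mu : Phi mu = ZT true mu.
Proof.
rewrite /Phi /ZT; congr fine.
have mp : measurable_fun setT (fun t : R => (phi t)%:E) by apply/measurable_EFinP; exact: measurable_phi.
rewrite integral_mkcond/=.
pose f (t : R) : \bar R := (if t <= mu then phi t else 0)%:E.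
have mf : measurable_fun setT f.
  by rewrite /f; have mph := measurable_phi; meas.
have f0 t : (0 <= f t)%E by rewrite lee_fin; case: ifP => // _; exact: phi_ge0.
transitivity (\int[leb]_t f t)%E.
  apply: eq_integral => t _; rewrite patchE /f mem_setE in_itv/=.
  by case: ifP.
rewrite leb_opp// (@leb_affine _ 1 (- mu))//; last first.
  apply: (measurableT_comp mf) => //.
rewrite mul1e; apply: eq_int_off0.
- by apply: (measurableT_comp mf).
- exact: tphi_meas.
- by move=> t; exact: f0.
- by move=> t; rewrite lee_fin tphi_ge0.
move=> t t0; rewrite /f mul1r /tnI /tn_set lerNl lerDr lt_neqAle eq_sym t0/=.
by case: ifP => _; rewrite ?mul0r// phiN mul1r.
Qed.

Lemma ZT_right y mu : (if y then 0 <= mu else mu <= 0) -> phi 1 <= ZT y mu.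
Proof.
move=> hy; set a : R := if y then 0 else -1.
pose f (t : R) : \bar R := (if a < t - mu < a + 1 then phi 1 else 0)%:E.
have mf : measurable_fun setT f by rewrite /f; meas.
rewrite -lee_fin -ZTE; apply: (@le_trans _ _ (\int[leb]_t f t)%E); last first.
  apply: int_le => //.
  - exact: tphi_meas.
  - by move=> t; rewrite /f lee_fin; case: ifP => // _; exact: phi_ge0.
  move=> t; rewrite /f lee_fin; case: ifP => [/andP[t0 t1]|_]; last exact: tphi_ge0.
  have -> : tnI y t = 1.
    rewrite /tnI /tn_set; move: hy t0 t1; rewrite /a; case: (y) => h t0 t1.
      by rewrite (_ : 0 < t)//; lra.
    by rewrite (_ : t <= 0)//; lra.
  rewrite mul1r /phi ler_pM2r ?invr_gt0 ?sqrtr_gt0 ?mulr_gt0 ?pi_gt0//.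
  rewrite ler_expR !mulNr lerN2 ler_pM2r ?invr_gt0//.
  by move: t0 t1; rewrite /a; case: (y) => h1 h2; nra.
have -> : (\int[leb]_t f t = \int[leb]_(t in `](mu + a)%R, (mu + a + 1)%R[) (phi 1)%:E)%E.
  rewrite [RHS]integral_mkcond; apply: eq_integral => t _ /=.
  rewrite patchE /f mem_setE in_itv/= !ltrBlDr ?ltrBrDr.
  by rewrite [a + mu]addrC [a + 1 + mu]addrC addrA; case: ifP.
rewrite integral_cst//= lebesgue_measure_itv/= lte_fin ltrDl ltr01 -EFinB -EFinM lee_fin.
by rewrite [_ + 1]addrC addrK mulr1.
Qed.

Lemma ZT_wrong y mu : (if y then mu <= 0 else 0 <= mu) -> ZT y mu <= expR (- (mu ^+ 2 / 2)).
Proof.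
move=> hy; rewrite -lee_fin -ZTE.
apply: (@le_trans _ _ (\int[leb]_t ((expR (- (mu ^+ 2 / 2)))%:E * (phi (t - 0))%:E))%E).
  apply: int_le.
  - exact: tphi_meas.
  - by apply: emeasurable_funM => //; exact: phis_meas.
  - by move=> t; rewrite lee_fin tphi_ge0.
  move=> t; rewrite -EFinM lee_fin /tnI /tn_set.
  have p0 : 0 < Num.sqrt (2 * pi) :> R by rewrite sqrtr_gt0 mulr_gt0 ?pi_gt0.
  have H : t * mu <= 0 -> phi (t - mu) <= expR (- (mu ^+ 2 / 2)) * phi (t - 0).
    move=> tm; rewrite /phi mulrA ler_pM2r ?invr_gt0// -expRD ler_expR subr0; lra.
  have H0 : 0 <= expR (- (mu ^+ 2 / 2)) * phi (t - 0) by rewrite mulr_ge0 ?expR_ge0 ?phi_ge0.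
  case: (y) hy => hy.
    by case: (ltP 0 t) => t0; rewrite ?mul0r ?mul1r//; apply: H; nra.
  by case: (leP t 0) => t0; rewrite ?mul0r ?mul1r//; apply: H; nra.
by rewrite intZl ?lee_fin ?expR_ge0// ?phi_int ?mule1//; [exact: phis_meas|move=> t; rewrite lee_fin phi_ge0].
Qed.

Lemma tn_pdfE mu y x : tn_pdf mu y x = tnI y x * phi (x - mu) / ZT y mu.
Proof. by []. Qed.

Lemma tn_pdf_ge0 mu y x : 0 <= tn_pdf mu y x :> R.
Proof. by rewrite tn_pdfE divr_ge0 ?tphi_ge0// ZT_ge0. Qed.

Lemma tn_mass mu y : (\int[leb]_x (tn_pdf mu y x)%:E = 1)%E.
Proof.
under eq_integral => x _ do rewrite tn_pdfE EFinM.
rewrite intZr ?lee_fin ?invr_ge0 ?ZT_ge0//.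
- by rewrite ZTE -EFinM mulfV// gt_eqF// ZT_gt0.
- exact: tphi_meas.
- by move=> x; rewrite lee_fin tphi_ge0.
Qed.

Lemma measurable_tn_pdf mu y : measurable_fun setT (fun x : R => tn_pdf mu y x).
Proof.
have m : measurable_fun setT (fun x : R => tnI y x * phi (x - mu) / ZT y mu).
  have mph : measurable_fun setT (fun x : R => phi (x - mu)) by exact: mphi.
  have mI : measurable_fun setT (tnI y) by exact: measurable_tnI.
  by meas.
exact: m.
Qed.

Lemma phi_sq_int : exists M : R, 0 <= M /\
  forall mu, (\int[leb]_x ((x - mu) ^+ 2 * phi (x - mu))%:E <= M%:E)%E.
Proof.
have p0 : 0 < Num.sqrt (2 * pi) :> R by rewrite sqrtr_gt0 mulr_gt0 ?pi_gt0.
have h0 : 0 < 2^-1 :> R by rewrite invr_gt0.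
exists (4 / Num.sqrt (2 * pi) * (Num.sqrt (2 * pi) / Num.sqrt 2^-1)); split.
  by rewrite mulr_ge0// divr_ge0// ?sqrtr_ge0.
have c0 : (0 <= (4 / Num.sqrt (2 * pi) : R)%:E)%E by rewrite lee_fin divr_ge0// sqrtr_ge0.
move=> mu; rewrite EFinM -(gauss1 mu h0) -intZl//.
apply: int_le => //.
- by apply/measurable_EFinP; apply: measurable_funM; [meas|apply: mphi].
- by move=> x; rewrite lee_fin mulr_ge0 ?sqr_ge0 ?phi_ge0.
move=> x; rewrite -EFinM lee_fin /phi; set u := (x - mu) ^+ 2.
have -> : - u / 2 = - (2^-1 * u) / 2 - 4^-1 * u by field.
have k : u * expR (- (4^-1 * u)) <= 4.
  have := expR_ge1Dx (4^-1 * u); rewrite expRN -ler_pdivlMr ?invr_gt0 ?expR_gt0// invrK; lra.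
rewrite expRD.
have -> : u * (expR (- (2^-1 * u) / 2) * expR (- (4^-1 * u)) / Num.sqrt (2 * pi)) =
  u * expR (- (4^-1 * u)) * (expR (- (2^-1 * u) / 2) / Num.sqrt (2 * pi)) by ring.
rewrite [leRHS]mulrAC -[leRHS]mulrA ler_wpM2r// divr_ge0 ?expR_ge0// sqrtr_ge0.
Qed.

Definition right_sign (y : bool) (mu : R) : bool := if y then 0 <= mu else mu <= 0.

Lemma tn_second (e : R) : 0 < e -> exists C : R, 0 <= C /\ forall y mu,
  (\int[leb]_x (x ^+ 2 * tn_pdf mu y x)%:E <=
     ((1 + e) * (if right_sign y mu then mu ^+ 2 else 0) + C)%:E)%E.
Proof.
move=> e0; have [M [M0 HM]] := phi_sq_int; have P0 := phi_gt0 1.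
set P := phi 1 in P0; have MP : 0 <= M / P by rewrite divr_ge0// ltW.
have e1 : 0 <= 1 + e^-1 by rewrite addr_ge0// invr_ge0 ltW.
exists ((1 + e^-1) * (M / P) + M / P); split; first by rewrite addr_ge0// mulr_ge0.
have mph (mu : R) : measurable_fun setT (fun x : R => phi (x - mu)) by exact: mphi.
have mI y : measurable_fun setT (tnI y) by exact: measurable_tnI.
have mtn y (mu : R) : measurable_fun setT (fun x : R => tn_pdf mu y x).
  exact: measurable_tn_pdf.
move=> y mu; have Z0 := ZT_gt0 y mu; rewrite /right_sign; case: ifPn => hy.
  have ZP := ZT_right hy; rewrite -/P in ZP.
  have s0 : 0 <= (1 + e) * mu ^+ 2 by rewrite mulr_ge0 ?sqr_ge0// addr_ge0// ltW.
  apply: (@le_trans _ _ ((1 + e) * mu ^+ 2 + (1 + e^-1) * (M / P))%:E); last first.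
    by rewrite lee_fin addrA lerDl.
  rewrite EFinD -[X in (X%:E + _)%E]mulr1 [X in (X + _)%E]EFinM -(tn_mass mu y).
  apply: (@le_trans _ _ (((1 + e) * mu ^+ 2)%:E * (\int[leb]_x (tn_pdf mu y x)%:E) +
     ((1 + e^-1) / P)%:E * \int[leb]_x ((x - mu) ^+ 2 * phi (x - mu))%:E)%E); last first.
    rewrite leeD2l//; have -> : (1 + e^-1) * (M / P) = (1 + e^-1) / P * M by ring.
    rewrite [leRHS]EFinM; apply: lee_wpmul2l; last exact: HM.
    by rewrite lee_fin divr_ge0 ?(ltW P0).
  have g1 x : (0 <= (tn_pdf mu y x : R)%:E)%E by rewrite lee_fin tn_pdf_ge0.
  have g2 x : (0 <= ((x - mu) ^+ 2 * phi (x - mu))%:E)%E.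
    by rewrite lee_fin mulr_ge0 ?sqr_ge0 ?phi_ge0.
  have g3 x : (0 <= ((1 + e) * mu ^+ 2)%:E * (tn_pdf mu y x)%:E)%E by exact: mule_ge0.
  have g4 x : (0 <= ((1 + e^-1) / P)%:E * ((x - mu) ^+ 2 * phi (x - mu))%:E)%E.
    by apply: mule_ge0 => //; rewrite lee_fin divr_ge0 ?(ltW P0).
  rewrite -!intZl ?lee_fin ?divr_ge0 ?(ltW P0)//.
  rewrite -intD//.
  apply: int_le => //; first by move=> x; rewrite lee_fin mulr_ge0 ?sqr_ge0 ?tn_pdf_ge0.
  move=> x; rewrite -!EFinM -EFinD lee_fin.
  have h1 : tn_pdf mu y x <= phi (x - mu) / P.
    rewrite tn_pdfE; apply: ler_pM; rewrite ?tphi_ge0 ?invr_ge0 ?ZT_ge0//.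
      by rewrite ler_piMl ?phi_ge0// tnI_le1.
    by rewrite lef_pV2.
  have h2 : x ^+ 2 <= (1 + e) * mu ^+ 2 + (1 + e^-1) * (x - mu) ^+ 2.
    rewrite -subr_ge0.
    have -> : (1 + e) * mu ^+ 2 + (1 + e^-1) * (x - mu) ^+ 2 - x ^+ 2 =
       e^-1 * (e * mu - (x - mu)) ^+ 2 by field; rewrite gt_eqF.
    by rewrite mulr_ge0 ?sqr_ge0// invr_ge0 ltW.
  apply: (@le_trans _ _ (((1 + e) * mu ^+ 2 + (1 + e^-1) * (x - mu) ^+ 2) * tn_pdf mu y x)).
    by rewrite ler_wpM2r// tn_pdf_ge0.
  rewrite mulrDl lerD2l -mulrA.
  have -> : (1 + e^-1) / P * ((x - mu) ^+ 2 * phi (x - mu)) =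
    (1 + e^-1) * ((x - mu) ^+ 2 * (phi (x - mu) / P)) by ring.
  rewrite ler_wpM2l//.
  by rewrite ler_wpM2l// sqr_ge0.
have hw : if y then mu <= 0 else 0 <= mu by case: (y) hy; rewrite -ltNge => /ltW.
(* Wrong sign: on the support [x mu = - |mu| |x|], so the density is [e^(-|mu| |x|)] times the one for [mu = 0]
   and [(x^2 - Cw) (e^(-|mu| |x|) - e^(-|mu| sqrt Cw)) <= 0] compares the two second moments. *)
set Cw := M / P in MP *.
pose K := expR (- (`|mu| * Num.sqrt Cw)) * expR (- (mu ^+ 2 / 2)).
have K0 : 0 <= K by rewrite mulr_ge0 ?expR_ge0.
have CK : 0 <= Cw * K by apply: mulr_ge0.
have f0 x : 0 <= x ^+ 2 * (tnI y x * phi (x - mu)) by rewrite mulr_ge0 ?sqr_ge0 ?tphi_ge0.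
have main : (\int[leb]_x (x ^+ 2 * (tnI y x * phi (x - mu)))%:E <= (Cw * ZT y mu)%:E)%E.
  rewrite -(@leeD2rE _ (K * M)%:E)//.
  apply: (@le_trans _ _ (\int[leb]_x (x ^+ 2 * (tnI y x * phi (x - mu)))%:E +
     (Cw * K)%:E * \int[leb]_x (tnI y x * phi (x - 0))%:E)%E).
    rewrite leeD2l// ZTE -EFinM lee_fin.
    have -> : M = Cw * P by rewrite /Cw divfK ?gt_eqF.
    rewrite mulrA [K * Cw]mulrC ler_wpM2l//.
    by apply: ZT_right; case: (y).
  apply: (@le_trans _ _ (Cw%:E * \int[leb]_x (tnI y x * phi (x - mu))%:E +
     K%:E * \int[leb]_x ((x - 0) ^+ 2 * phi (x - 0))%:E)%E); last first.
    rewrite ZTE -EFinM leeD2l// [leRHS]EFinM; apply: lee_wpmul2l; last exact: HM.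
    by rewrite lee_fin.
  have t0 m x : (0 <= (tnI y x * phi (x - m))%:E)%E by rewrite lee_fin tphi_ge0.
  have q0 x : (0 <= ((x - 0) ^+ 2 * phi (x - 0) : R)%:E)%E.
    by rewrite lee_fin mulr_ge0 ?sqr_ge0 ?phi_ge0.
  rewrite -!intZl ?lee_fin//.
  rewrite -!intD//; try by (move=> x; rewrite mule_ge0).
  apply: int_le => //.
    by move=> x; apply: adde_ge0; [rewrite lee_fin|exact: mule_ge0].
  move=> x; rewrite -!EFinM -!EFinD lee_fin subr0.
  rewrite /tnI; case hx: (tn_set y x); rewrite ?mul0r ?mulr0 ?addr0 ?add0r; last first.
    by rewrite mulr_ge0// mulr_ge0 ?sqr_ge0 ?phi_ge0.
  rewrite !mul1r.
  have -> : phi (x - mu) = expR (- (`|mu| * `|x|)) * expR (- (mu ^+ 2 / 2)) * phi x.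
    rewrite /phi mulrA -!expRD; congr (expR _ / _).
    have -> : - (`|mu| * `|x|) = mu * x.
      rewrite -normrM; move: hx hw; rewrite /tn_set; case: (y) => h1 h2.
        by rewrite ler0_norm ?opprK//; nra.
      by rewrite ler0_norm ?opprK//; nra.
    by field.
  rewrite /K.
  set E1 := expR (- (`|mu| * `|x|)); set E2 := expR (- (`|mu| * _)).
  set G := expR (- (mu ^+ 2 / 2)); set p := phi x.
  have Gp : 0 <= G * p by rewrite mulr_ge0 ?expR_ge0 ?phi_ge0.
  rewrite -subr_ge0.
  have -> : Cw * (E1 * G * p) + E2 * G * (x ^+ 2 * p) - (x ^+ 2 * (E1 * G * p) + Cw * (E2 * G) * p)
    = (G * p) * ((Cw - x ^+ 2) * (E1 - E2)) by ring.
  rewrite mulr_ge0//.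
  have sC : Num.sqrt Cw ^+ 2 = Cw by rewrite sqr_sqrtr.
  have sC0 := sqrtr_ge0 Cw.
  rewrite -sC -[x ^+ 2]real_normK ?num_real//; set z := `|x|; have z0 : 0 <= z by exact: normr_ge0.
  have [h|h] := leP z (Num.sqrt Cw).
    apply: mulr_ge0; first by rewrite subr_ge0 lerXn2r.
    by rewrite subr_ge0 ler_expR lerN2 ler_wpM2l.
  apply: mulr_le0; first by rewrite subr_le0 lerXn2r// ltW.
  by rewrite subr_le0 ler_expR lerN2 ler_wpM2l// ltW.
rewrite mulr0 add0r.
apply: (@le_trans _ _ Cw%:E); last by rewrite lee_fin lerDr mulr_ge0.
under eq_integral => x _ do rewrite tn_pdfE mulrA EFinM.
rewrite intZr ?lee_fin ?invr_ge0 ?ZT_ge0//.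
by rewrite lee_pdivrMr// -EFinM.
Qed.
End TruncNormal.

(** * Multivariate normal distribution *)

Section PosDef.
Variable R : realType.

Definition qf k (S : 'M[R]_k) (x : 'cV[R]_k) : R := (x^T *m S *m x) 0 0.

Definition posdef k (S : 'M[R]_k) : Prop :=
  S^T = S /\ forall x : 'cV[R]_k, x != 0 -> 0 < qf S x.

Lemma qfE k (S : 'M[R]_k) (x : 'cV[R]_k) : qf S x = \sum_i \sum_j x i 0 * S i j * x j 0.
Proof.
rewrite /qf mxE exchange_big; apply: eq_bigr => j _; rewrite mxE mulr_suml.
by apply: eq_bigr => i _; rewrite !mxE.
Qed.

Lemma posdef_ge0 k (S : 'M[R]_k) x : posdef S -> 0 <= qf S x.
Proof.
move=> [_ S0]; have [->|/S0/ltW//] := eqVneq x 0.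
by rewrite /qf mulmx0 mxE.
Qed.

Lemma mx11_00 (A B : 'M[R]_1) : A 0 0 = B 0 0 -> A = B.
Proof. by move=> h; apply/matrixP => i j; rewrite !ord1. Qed.

Lemma tr11 (A : 'M[R]_1) : A^T = A.
Proof. by apply: mx11_00; rewrite mxE. Qed.

Lemma schur k (S : 'M[R]_(1 + k)) : S^T = S -> drsubmx S \in unitmx ->
  let b := dlsubmx S in let S' := drsubmx S in let h := invmx S' *m b in
  let g := (ulsubmx S - b^T *m h) 0 0 in
  (forall (y : R) (z : 'cV[R]_k), qf S (col_mx y%:M z) = g * y ^+ 2 + qf S' (z + y *: h)) /\
  \det S = g * \det S'.
Proof.
move=> symS uS b S' h g.
have trS' : S'^T = S' by rewrite /S' trmx_drsub symS.
have urE : ursubmx S = b^T by rewrite /b trmx_dlsub symS.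
have ulE : ulsubmx S = g%:M + b^T *m h.
  by apply: mx11_00; rewrite /g !mxE eqxx mulr1n subrK.
have SE : S = block_mx (g%:M + b^T *m h) b^T b S' by rewrite -ulE -urE submxK.
have S'h : S' *m h = b by rewrite /h mulKVmx.
have hS' : h^T *m S' = b^T by rewrite -{1}trS' -trmx_mul S'h.
split=> [y z|].
  rewrite {1}/qf {1}SE tr_col_mx mul_row_block mul_row_col tr_scalar_mx.
  rewrite !mulmxDl !mulmxDr !mulmxDl !mul_scalar_mx !mul_mx_scalar -!scalemxAl.
  rewrite /qf (_ : (z + y *: h)^T = z^T + y *: h^T); last by apply/matrixP => i j; rewrite !mxE.
  rewrite !mulmxDl !mulmxDr -!scalemxAl -!scalemxAr.
  rewrite hS' -[z^T *m S' *m h]mulmxA S'h.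
  move: (b^T *m h) (z^T *m b) (b^T *m z) (z^T *m S' *m z) => P Q U V.
  by rewrite !mxE eqxx mulr1n; ring.
have -> : S = block_mx 1%:M h^T 0 1%:M *m block_mx g%:M 0 b S'.
  rewrite {1}SE mulmx_block !mul1mx !mul0mx !add0r hS'.
  by congr block_mx; congr (_ + _); rewrite -[LHS]tr11 trmx_mul trmxK.
by rewrite det_mulmx det_ublock det_lblock !det1 !mul1r det_scalar1.
Qed.

Lemma posdef_dr k (S : 'M[R]_(1 + k)) : posdef S -> posdef (drsubmx S).
Proof.
move=> [symS S0]; split; first by rewrite trmx_drsub symS.
move=> z z0; have := S0 (col_mx 0 z).
have -> : qf S (col_mx 0 z) = qf (drsubmx S) z.
  rewrite /qf -{1}[S]submxK tr_col_mx mul_row_block mul_row_col.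
  by rewrite trmx0 !mul0mx !add0r mulmx0 add0r.
apply; apply: contra z0 => /eqP h.
by rewrite -(col_mxKd (0 : 'M[R]_(1,1)) z) h linear0.
Qed.

Lemma posdef_det k (S : 'M[R]_k) : posdef S -> 0 < \det S.
Proof.
elim: k S => [|k IH] S pS; first by rewrite det_mx00.
have pS' := posdef_dr pS; have d0 := IH _ pS'.
have uS : drsubmx (S : 'M[R]_(1 + k)) \in unitmx by rewrite unitmxE unitfE gt_eqF.
have [/= qE ->] := @schur k S pS.1 uS.
apply: mulr_gt0; last exact: d0.
have := qE 1 (- (invmx (drsubmx (S : 'M[R]_(1 + k))) *m dlsubmx (S : 'M[R]_(1 + k)))).
rewrite scale1r addNr expr1n mulr1.
have -> : qf (drsubmx (S : 'M[R]_(1 + k))) 0 = 0 by rewrite /qf mulmx0 mxE.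
rewrite addr0 => <-; apply: pS.2.
apply/eqP => h; have := congr1 (@usubmx R 1 k 1) h; rewrite col_mxKu linear0 => /matrixP/(_ 0 0).
by rewrite !mxE => /eqP; rewrite oner_eq0.
Qed.

Lemma posdef_unit k (S : 'M[R]_k) : posdef S -> S \in unitmx.
Proof. by move=> /posdef_det h; rewrite unitmxE unitfE gt_eqF. Qed.

Lemma tcol_cons k x (t : k.-tuple R) : tcol (cons_tuple x t) = col_mx x%:M (tcol t) :> 'cV[R]_(1 + k).
Proof.
apply/matrixP => i j; rewrite [RHS]mxE mxE.
case: splitP => i' ii'.
  rewrite mxE !ord1 mulr1n; have -> : i = ord0 by apply: val_inj; rewrite /= ii' ord1.
  by [].
rewrite mxE (_ : i = lift ord0 i') ?tnthS//; apply: val_inj; rewrite /= ii'//.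
Qed.

Lemma trmxD m n (A B : 'M[R]_(m, n)) : (A + B)^T = A^T + B^T.
Proof. by apply/matrixP => i j; rewrite !mxE. Qed.

Lemma qf_sym k (A : 'M[R]_k) (v1 v2 : 'cV[R]_k) : A^T = A ->
  (v1^T *m A *m v2) 0 0 = (v2^T *m A *m v1) 0 0.
Proof. by move=> sA; rewrite -[v2^T *m A *m v1]tr11 !trmx_mul trmxK sA mulmxA. Qed.

Lemma qfD k (A : 'M[R]_k) (v1 v2 : 'cV[R]_k) : A^T = A ->
  qf A (v1 + v2) = qf A v1 + qf A v2 + 2 * (v1^T *m A *m v2) 0 0.
Proof.
move=> sA; rewrite /qf trmxD !mulmxDl !mulmxDr.
have := qf_sym v1 v2 sA.
move: (v1^T *m A *m v2) (v2^T *m A *m v1) (v1^T *m A *m v1) (v2^T *m A *m v2) => P Q U V e.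
by rewrite !mxE -e; ring.
Qed.

Lemma qfZ k (A : 'M[R]_k) c (v : 'cV[R]_k) : qf A (c *: v) = c ^+ 2 * qf A v.
Proof.
rewrite /qf (_ : (c *: v)^T = c *: v^T); last by apply/matrixP => i j; rewrite !mxE.
by rewrite -!scalemxAl -scalemxAr scalerA mxE expr2.
Qed.

Lemma qf_complete k (S E : 'M[R]_k) (m x : 'cV[R]_k) : S^T = S -> E^T = E -> S + E \in unitmx ->
  let m' := invmx (S + E) *m (S *m m) in
  qf S (x - m) + qf E x = qf (S + E) (x - m') + (qf S (m' - m) + qf E m').
Proof.
move=> sS sE u m'.
suff main z : qf S (z + m' - m) + qf E (z + m') = qf (S + E) z + (qf S (m' - m) + qf E m').
  by have := main (x - m'); rewrite subrK.
have H : S *m (m' - m) + E *m m' = 0.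
  by rewrite mulmxBr addrAC -mulmxDl /m' mulKVmx// subrr.
have H2 : (z + m' - m) = z + (m' - m) by rewrite addrA.
rewrite H2; move: (m' - m) H => w H; clear H2.
have Hz : (z^T *m S *m w) 0 0 + (z^T *m E *m m') 0 0 = 0.
  by rewrite -!mulmxA; move/(congr1 (fun A => (z^T *m A) 0 0)): H; rewrite mulmx0 mulmxDr !mxE.
rewrite !qfD//.
have -> : qf (S + E) z = qf S z + qf E z by rewrite /qf mulmxDr mulmxDl mxE.
have -> : (z^T *m S *m w) 0 0 = - (z^T *m E *m m') 0 0 by apply/eqP; rewrite -addr_eq0 Hz.
ring.
Qed.

Lemma measurable_tcol k i j : measurable_fun setT (fun t : k.-tuple R => tcol t i j).
Proof. by under eq_fun do rewrite mxE; exact: measurable_tnth. Qed.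

Lemma measurable_qf d (T : measurableType d) k (S : 'M[R]_k) (x : T -> 'cV[R]_k) :
  (forall i, measurable_fun setT (fun t => x t i 0)) ->
  measurable_fun setT (fun t => qf S (x t)).
Proof.
move=> mx; rewrite (_ : (fun t => _) = fun t => \sum_i \sum_j x t i 0 * S i j * x t j 0).
  by apply: measurable_sum => i; apply: measurable_sum => j; meas.
by apply/funext => t; exact: qfE.
Qed.

Lemma measurable_qf_tcol k (S : 'M[R]_k) (m : 'cV[R]_k) :
  measurable_fun setT (fun t : k.-tuple R => qf S (tcol t - m)).
Proof.
apply: measurable_qf => i; under eq_fun do rewrite mxE.
by apply: measurable_funD => //; exact: measurable_tcol.
Qed.

Lemma gauss_lebK k (S : 'M[R]_k) (m : 'cV[R]_k) : posdef S ->
  (\int[lebK R k]_t (expR (- (qf S (tcol t - m)) / 2))%:E =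
    (Num.sqrt (2 * pi) ^+ k / Num.sqrt (\det S))%:E)%E.
Proof.
elim: k S m => [|k IH] S m pS.
  have -> : (fun t => (expR (- qf S (tcol t - m) / 2))%:E) = cst 1%E.
    by apply/funext => t; rewrite qfE big_ord0 oppr0 mul0r expR0.
  by rewrite integral_cst//= det_mx00 sqrtr1 divr1 expr0 mul1e diracT.
have pS' := posdef_dr pS; have d0 := posdef_det pS'; have dS := posdef_det pS.
have uS : drsubmx (S : 'M[R]_(1 + k)) \in unitmx by rewrite unitmxE unitfE gt_eqF.
have [/= qE dE] := @schur k S pS.1 uS.
set g := (ulsubmx _ - _) 0 0 in qE dE.
set h := invmx _ *m _ in qE.
have g0 : 0 < g by move: dS; rewrite dE pmulr_lgt0.
pose m0 : R := (usubmx (m : 'cV[R]_(1 + k))) 0 0.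
pose m1 : 'cV[R]_k := dsubmx (m : 'cV[R]_(1 + k)).
have E x (t : k.-tuple R) : expR (- qf S (tcol (cons_tuple x t) - m) / 2) =
   expR (- (g * (x - m0) ^+ 2) / 2) *
   expR (- qf (drsubmx (S : 'M[R]_(1 + k))) (tcol t - (m1 - (x - m0) *: h)) / 2).
  rewrite -expRD -mulrDl -opprD; congr (expR (- _ / 2)).
  have TE : tcol (cons_tuple x t) - m = col_mx (x - m0)%:M (tcol t - m1) :> 'cV[R]_(1 + k).
    transitivity (col_mx x%:M (tcol t) - col_mx m0%:M m1).
      rewrite tcol_cons; congr (_ - _).
      rewrite -[LHS](@vsubmxK _ 1 k 1); congr col_mx.
      by apply: mx11_00; rewrite [RHS]mxE eqxx mulr1n.
    rewrite opp_col_mx add_col_mx; congr col_mx.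
    by apply: mx11_00; rewrite !mxE eqxx !mulr1n.
  rewrite (_ : tcol (cons_tuple x t) - m = col_mx (x - m0)%:M (tcol t - m1))// qE.
  by congr (_ + qf _ _); rewrite opprB addrA addrAC.
rewrite integral_consm; last 2 first.
- by have := measurable_qf_tcol S m; meas.
- by move=> t; rewrite lee_fin expR_ge0.
under eq_integral => x _.
  under eq_integral => t _ do rewrite E EFinM.
  rewrite intZl ?lee_fin ?expR_ge0//; last by move: (measurable_qf_tcol (drsubmx (S : 'M[R]_(1 + k))) (m1 - (x - m0) *: h)) => ?; meas.
  rewrite IH//.
  over.
rewrite /= intZr ?lee_fin ?divr_ge0 ?exprn_ge0 ?sqrtr_ge0// gauss1// -EFinM; congr _%:E.
have -> : Num.sqrt (\det S) = Num.sqrt g * Num.sqrt (\det (drsubmx (S : 'M[R]_(1 + k)))).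
  by rewrite dE [LHS]sqrtrM// ltW.
rewrite exprS.
have ng : Num.sqrt g != 0 by rewrite gt_eqF// sqrtr_gt0.
have nd : Num.sqrt (\det (drsubmx (S : 'M[R]_(1 + k)))) != 0 by rewrite gt_eqF// sqrtr_gt0.
by field; rewrite nd ng.
Qed.

Lemma det_delta k (S : 'M[R]_k) (i : 'I_k) t : S \in unitmx ->
  \det (S + t *: delta_mx i i) = \det S * (1 + t * invmx S i i).
Proof.
move=> uS; rewrite (expand_det_row _ i).
have cE j : cofactor (S + t *: delta_mx i i) i j = cofactor S i j.
  rewrite /cofactor; congr (_ * \det _); apply/matrixP => a b; rewrite !mxE.
  by rewrite (_ : (lift i a == i) = false) ?mulr0 ?addr0//; apply/negbTE/eqP => /esym/eqP; rewrite (negbTE (neq_lift _ _)).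
under eq_bigr => j _ do rewrite cE !mxE mulrDl.
rewrite big_split/= -expand_det_row mulrDr mulr1; congr (_ + _).
rewrite (bigD1 i)//= !eqxx mulr1 big1 ?addr0; last first.
  by move=> j ji; rewrite (negbTE ji) mulr0 mul0r.
have d0 : \det S != 0 by rewrite -unitfE -unitmxE.
have -> : invmx S i i = (\det S)^-1 * cofactor S i i by rewrite /invmx uS !mxE.
by field.
Qed.

Lemma posdef_diag k (S : 'M[R]_k) (i : 'I_k) : posdef S -> 0 < S i i.
Proof.
move=> [_ S0]; have := S0 (delta_mx i 0); rewrite qfE.
rewrite (bigD1 i)//= (bigD1 i)//= !big1 ?addr0; last 2 first.
- by move=> j ji; rewrite big1// => l _; rewrite !mxE (negbTE ji)/= !mul0r.
- by move=> j ji; rewrite [X in _ * _ * X]mxE (negbTE ji)/= mulr0.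
rewrite !mxE !eqxx mul1r mulr1; apply.
by apply/eqP => /matrixP/(_ i 0); rewrite !mxE !eqxx => /eqP; rewrite oner_eq0.
Qed.

Lemma posdef_inv_diag k (S : 'M[R]_k) (i : 'I_k) : posdef S -> (S i i)^-1 <= invmx S i i.
Proof.
move=> pS; have s0 := posdef_diag i pS; have uS := posdef_unit pS.
set l := (S i i)^-1.
pose e : 'cV[R]_k := delta_mx i 0.
have ee (A : 'M[R]_k) : (e^T *m A *m e) 0 0 = A i i.
  by rewrite /e trmx_delta -rowE -colE !mxE.
pose w := invmx S *m e.
have wS : w^T *m S = e^T by rewrite /w trmx_mul trmx_inv pS.1 -mulmxA mulVmx// mulmx1.
have := posdef_ge0 (w + (- l) *: e) pS; rewrite qfD ?pS.1// qfZ.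
have -> : qf S w = invmx S i i by rewrite /qf wS /w mulmxA ee.
have -> : qf S e = S i i by rewrite /qf ee.
have -> : (w^T *m S *m ((- l) *: e)) 0 0 = - l.
  rewrite wS -scalemxAr mxE -[e^T]mulmx1 ee mxE eqxx mulr1//.
have -> : invmx S i i + (- l) ^+ 2 * S i i + 2 * (- l) = invmx S i i - l.
  by rewrite /l; field; rewrite gt_eqF.
by rewrite subr_ge0.
Qed.

Lemma posdefD k (S E : 'M[R]_k) : posdef S -> E^T = E -> (forall x, 0 <= qf E x) -> posdef (S + E).
Proof.
move=> [sS S0] sE E0; split; first by rewrite trmxD sS sE.
move=> x /S0 h; rewrite /qf mulmxDr mulmxDl mxE.
by rewrite ltr_wpDr//; exact: E0.
Qed.

Lemma qf_delta k (i : 'I_k) (x : 'cV[R]_k) : qf (delta_mx i i) x = x i 0 ^+ 2.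
Proof.
rewrite qfE (bigD1 i)//= (bigD1 i)//= !big1 ?addr0; last 2 first.
- by move=> j ji; rewrite big1// => l _; rewrite !mxE (negbTE ji)/= mulr0 mul0r.
- by move=> j ji; rewrite !mxE eqxx (negbTE ji)/= mulr0 mul0r.
by rewrite !mxE !eqxx mulr1 expr2.
Qed.

Definition diagS k (s : seq 'I_k) : 'M[R]_k := \sum_(i <- s) delta_mx i i.

Lemma diagS_sym k (s : seq 'I_k) : (diagS s)^T = diagS s.
Proof.
rewrite /diagS; elim: s => [|i s IH]; first by rewrite big_nil trmx0.
by rewrite big_cons trmxD trmx_delta IH.
Qed.

Lemma qf_diagS k (s : seq 'I_k) x : qf (diagS s) x = \sum_(i <- s) x i 0 ^+ 2.
Proof.
rewrite /diagS; elim: s => [|i s IH]; first by rewrite !big_nil /qf mulmx0 mul0mx mxE.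
by rewrite !big_cons -IH -qf_delta /qf mulmxDr mulmxDl mxE.
Qed.

Lemma qfZl k c (S : 'M[R]_k) x : qf (c *: S) x = c * qf S x.
Proof. by rewrite /qf -scalemxAr -scalemxAl mxE. Qed.

Lemma qf_diagS_ge0 k t (s : seq 'I_k) x : 0 <= t -> 0 <= qf (t *: diagS s) x.
Proof. by move=> t0; rewrite qfZl qf_diagS mulr_ge0// sumr_ge0// => i _; exact: sqr_ge0. Qed.

Lemma posdef_diagS k (S : 'M[R]_k) (s : seq 'I_k) t : posdef S -> 0 <= t -> posdef (S + t *: diagS s).
Proof.
move=> pS t0; apply: posdefD => //; last by move=> x; exact: qf_diagS_ge0.
by rewrite linearZ/= diagS_sym.
Qed.

Lemma det_diagS k (S : 'M[R]_k) (s : seq 'I_k) t : posdef S -> uniq s -> 0 <= t ->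
  \det S * \prod_(i <- s) (1 + t / S i i) <= \det (S + t *: diagS s).
Proof.
move=> pS us t0; elim: s us => [_|i s IH /andP[iNs us]].
  by rewrite /diagS !big_nil scaler0 addr0 mulr1.
have pS1 := posdef_diagS s pS t0; have d1 := posdef_det pS1.
rewrite big_cons /diagS big_cons scalerDr addrCA addrC -/(diagS s).
rewrite det_delta ?posdef_unit//.
have Sii : (S + t *: diagS s) i i = S i i.
  rewrite !mxE summxE big_seq big1 ?mulr0 ?addr0// => j js.
  rewrite mxE (_ : (i == j) = false)//; apply: contraNF iNs => /eqP -> //.
have := posdef_inv_diag i pS1; rewrite Sii => h.
rewrite mulrCA [leRHS]mulrC; apply: ler_pM.
- by rewrite addr_ge0// divr_ge0// ltW// posdef_diag.
- rewrite mulr_ge0 ?(ltW (posdef_det pS))// prodr_ge0// => j _.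
  by rewrite addr_ge0// divr_ge0// ltW// posdef_diag.
- by rewrite lerD2l ler_wpM2l.
- exact: IH.
Qed.

Lemma mvn_pdfE k (S : 'M[R]_k) (m x : 'cV[R]_k) :
  mvn_pdf S m x = Num.sqrt (\det S) / Num.sqrt (2 * pi) ^+ k * expR (- qf S (x - m) / 2).
Proof. by []. Qed.

Lemma mvn_ge0 k (S : 'M[R]_k) (m x : 'cV[R]_k) : 0 <= mvn_pdf S m x.
Proof. by rewrite mvn_pdfE mulr_ge0 ?expR_ge0// divr_ge0 ?exprn_ge0 ?sqrtr_ge0. Qed.

Lemma s2pi_gt0 : 0 < Num.sqrt (2 * pi) :> R.
Proof. by rewrite sqrtr_gt0 mulr_gt0 ?pi_gt0. Qed.

Lemma gauss_meas k (S : 'M[R]_k) (m : 'cV[R]_k) :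
  measurable_fun setT (fun t : k.-tuple R => (expR (- (qf S (tcol t - m)) / 2))%:E).
Proof. by have := measurable_qf_tcol S m; meas. Qed.

Lemma mvn_meas k (S : 'M[R]_k) (m : 'cV[R]_k) :
  measurable_fun setT (fun t : k.-tuple R => mvn_pdf S m (tcol t)).
Proof.
have H : measurable_fun setT (fun t : k.-tuple R => Num.sqrt (\det S) / Num.sqrt (2 * pi) ^+ k * expR (- qf S (tcol t - m) / 2)).
  by have := measurable_qf_tcol S m; meas.
exact: H.
Qed.

Lemma mvn_mass k (S : 'M[R]_k) (m : 'cV[R]_k) : posdef S ->
  (\int[lebK R k]_t (mvn_pdf S m (tcol t))%:E = 1)%E.
Proof.
move=> pS; under eq_integral => t _ do rewrite mvn_pdfE EFinM.
rewrite intZl ?lee_fin ?divr_ge0 ?exprn_ge0 ?sqrtr_ge0//; last exact: gauss_meas.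
rewrite gauss_lebK// -EFinM; congr _%:E.
have p0 : Num.sqrt (2 * pi) ^+ k != 0 :> R by rewrite expf_neq0// gt_eqF// s2pi_gt0.
have d0 : Num.sqrt (\det S) != 0 by rewrite gt_eqF// sqrtr_gt0 posdef_det.
by field; rewrite p0 d0.
Qed.

Lemma mvn_second k (S : 'M[R]_k) (m : 'cV[R]_k) : posdef S ->
  (\int[lebK R k]_t (qf S (tcol t - m) * mvn_pdf S m (tcol t))%:E <= (4 * 2 ^+ k)%:E)%E.
Proof.
move=> pS; have dS := posdef_det pS.
have pS2 : posdef (2^-1 *: S).
  split; first by rewrite linearZ/= pS.1.
  by move=> x x0; rewrite qfZl mulr_gt0 ?invr_gt0 ?pS.2.
have c0 : 0 <= 4 * (Num.sqrt (\det S) / Num.sqrt (2 * pi) ^+ k).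
  by rewrite mulr_ge0// divr_ge0 ?exprn_ge0 ?sqrtr_ge0.
apply: (@le_trans _ _ (\int[lebK R k]_t ((4 * (Num.sqrt (\det S) / Num.sqrt (2 * pi) ^+ k))%:E *
   (expR (- (qf (2^-1 *: S) (tcol t - m)) / 2))%:E))%E).
  apply: int_le.
  - by have := mvn_meas S m; have := measurable_qf_tcol S m; meas.
  - by have := gauss_meas (2^-1 *: S) m; meas.
  - by move=> t; rewrite lee_fin mulr_ge0 ?mvn_ge0// posdef_ge0.
  move=> t; rewrite -EFinM lee_fin mvn_pdfE qfZl; set q := qf S _.
  have -> : - q / 2 = - (2^-1 * q) / 2 - 4^-1 * q by field.
  have h : q * expR (- (4^-1 * q)) <= 4.
    have := expR_ge1Dx (4^-1 * q); rewrite expRN -ler_pdivlMr ?invr_gt0 ?expR_gt0// invrK; lra.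
  rewrite expRD; set A := Num.sqrt (\det S) / _; set B := expR (- (2^-1 * q) / 2).
  have -> : q * (A * (B * expR (- (4^-1 * q)))) = q * expR (- (4^-1 * q)) * (A * B) by ring.
  by rewrite -[leRHS]mulrA ler_wpM2r// mulr_ge0 ?expR_ge0// divr_ge0 ?exprn_ge0 ?sqrtr_ge0.
rewrite intZl ?lee_fin//; last exact: gauss_meas.
rewrite gauss_lebK// -EFinM lee_fin.
have -> : Num.sqrt (\det (2^-1 *: S)) = Num.sqrt (2^-1 ^+ k) * Num.sqrt (\det S).
  by rewrite detZ [LHS]sqrtrM// exprn_ge0// invr_ge0.
have p0 : Num.sqrt (2 * pi) ^+ k != 0 :> R by rewrite expf_neq0// gt_eqF// s2pi_gt0.
have d0 : Num.sqrt (\det S) != 0 by rewrite gt_eqF// sqrtr_gt0.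
have h0 : 0 < 2^-1 ^+ k :> R by rewrite exprn_gt0// invr_gt0.
have s0 : Num.sqrt (2^-1 ^+ k) != 0 :> R by rewrite gt_eqF// sqrtr_gt0.
rewrite [leLHS](_ : _ = 4 * (Num.sqrt (2^-1 ^+ k))^-1); last by field; rewrite p0 d0 s0.
rewrite ler_wpM2l// invf_ple ?posrE ?sqrtr_gt0// ?exprn_gt0// -exprVn.
have z1 : 2^-1 ^+ k <= 1 :> R by rewrite exprn_ile1// ?invr_ge0// invf_le1// ler1n.
have w1 : Num.sqrt (2^-1 ^+ k) <= 1 :> R by rewrite -[leRHS]sqrtr1 ler_wsqrtr.
have := sqr_sqrtr (ltW h0); have := sqrtr_ge0 (2^-1 ^+ k : R); nra.
Qed.

Lemma mvn_laplace k (S : 'M[R]_k) (m : 'cV[R]_k) (s : seq 'I_k) t : posdef S -> uniq s -> 0 <= t ->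
  (\int[lebK R k]_x (expR (- (t * \sum_(i <- s) tcol x i 0 ^+ 2) / 2) * mvn_pdf S m (tcol x))%:E
     <= (\prod_(i <- s) (Num.sqrt (1 + t / S i i))^-1)%:E)%E.
Proof.
move=> pS us t0; have dS := posdef_det pS.
have pS1 := posdef_diagS s pS t0; have dS1 := posdef_det pS1.
set S1 := S + t *: diagS s in pS1 dS1.
set m1 := invmx S1 *m (S *m m).
set c := Num.sqrt (\det S) / Num.sqrt (2 * pi) ^+ k.
have c0 : 0 <= c by rewrite divr_ge0 ?exprn_ge0 ?sqrtr_ge0.
apply: (@le_trans _ _ (\int[lebK R k]_x (c%:E * (expR (- (qf S1 (tcol x - m1)) / 2))%:E))%E).
  apply: int_le.
  - have := mvn_meas S m => mv.
    have ms : measurable_fun setT (fun x : k.-tuple R => \sum_(i <- s) tcol x i 0 ^+ 2).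
      by apply: measurable_sum => i; apply: measurable_funX; exact: measurable_tcol.
    by meas.
  - by have := gauss_meas S1 m1; meas.
  - by move=> x; rewrite lee_fin mulr_ge0 ?expR_ge0 ?mvn_ge0.
  move=> x; rewrite -EFinM lee_fin mvn_pdfE -/c mulrCA ler_wpM2l// -expRD ler_expR.
  rewrite -mulrDl ler_pM2r ?invr_gt0// -opprD lerN2 -qf_diagS -qfZl [leRHS]addrC.
  rewrite (@qf_complete _ S (t *: diagS s) m (tcol x)) ?pS.1//; last 2 first.
  - by rewrite linearZ/= diagS_sym.
  - exact: posdef_unit.
  by rewrite lerDl addr_ge0 ?qf_diagS_ge0// posdef_ge0.
rewrite intZl ?lee_fin//; last exact: gauss_meas.
rewrite gauss_lebK// -EFinM lee_fin /c.
have p0 : Num.sqrt (2 * pi) ^+ k != 0 :> R by rewrite expf_neq0// gt_eqF// s2pi_gt0.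
have d0 : 0 < Num.sqrt (\det S) by rewrite sqrtr_gt0.
have d1 : 0 < Num.sqrt (\det S1) by rewrite sqrtr_gt0.
rewrite [leLHS](_ : _ = Num.sqrt (\det S) / Num.sqrt (\det S1)); last by field; rewrite p0 gt_eqF.
have q0 i : 0 < 1 + t / S i i by rewrite ltr_pwDl// divr_ge0// ltW// posdef_diag.
have -> : \prod_(i <- s) (Num.sqrt (1 + t / S i i))^-1 = (Num.sqrt (\prod_(i <- s) (1 + t / S i i)))^-1.
  elim: (s) => [|i r IH]; first by rewrite !big_nil sqrtr1 invr1.
  by rewrite !big_cons IH sqrtrM ?(ltW (q0 i))// invfM.
have P0 : 0 < \prod_(i <- s) (1 + t / S i i) by apply: prodr_gt0 => i _; exact: q0.
rewrite ler_pdivrMr// mulrC ler_pdivlMr ?sqrtr_gt0// -sqrtrM ?(ltW dS)//.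
by rewrite ler_wsqrtr// det_diagS.
Qed.
End PosDef.

(** * Harris' theorem for a transition density *)

Section Harris.
Context d (T : measurableType d) (R : realType) (mu : {sigma_finite_measure set T -> \bar R}).

Lemma density_sandwich (h : T -> \bar R) (V f : T -> R) (M v c A be : R) :
  measurable_fun setT h -> (forall y, 0 <= h y)%E ->
  measurable_fun setT V -> (forall y, 0 <= V y) ->
  measurable_fun setT f -> (forall y, 0 <= f y) ->
  (\int[mu]_y h y = M%:E)%E -> (\int[mu]_y (h y * (V y)%:E) <= v%:E)%E ->
  0 <= c -> 0 <= A -> 0 <= be ->
  (forall y, f y <= c + A * (1 + be * V y)) -> (forall y, c <= f y + A * (1 + be * V y)) ->
  (\int[mu]_y (h y * (f y)%:E) <= (c * M + A * (M + be * v))%:E)%E /\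
  ((c * M)%:E <= \int[mu]_y (h y * (f y)%:E) + (A * (M + be * v))%:E)%E.
Proof.
move=> mh h0 mV V0 mf f0 hM hv c0 A0 b0 fu fl.
have Ab0 : 0 <= A * be by rewrite mulr_ge0.
have hV0 y : (0 <= h y * (V y)%:E)%E by rewrite mule_ge0// lee_fin.
have hf0 y : (0 <= h y * (f y)%:E)%E by rewrite mule_ge0// lee_fin.
have mhV : measurable_fun setT (fun y => (h y * (V y)%:E)%E) by meas.
have mhf : measurable_fun setT (fun y => (h y * (f y)%:E)%E) by meas.
have IZ (u w : R) : 0 <= u -> 0 <= w ->
   (\int[mu]_y (u%:E * h y + w%:E * (h y * (V y)%:E)) <= (u * M + w * v)%:E)%E.
  move=> u0 w0; rewrite intD//; last 2 first.
  - by move=> y; rewrite mule_ge0.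
  - by move=> y; rewrite mule_ge0.
  rewrite !intZl ?lee_fin// hM -EFinM EFinD leeD2l// EFinM.
  by apply: lee_wpmul2l.
have split3 y (u w : R) : 0 <= u -> 0 <= w -> (h y * (u + w * V y)%:E = u%:E * h y + w%:E * (h y * (V y)%:E))%E.
  move=> u0 w0; rewrite EFinD ge0_muleDr ?lee_fin//; last by rewrite mulr_ge0.
  by rewrite muleC; congr (_ + _)%E; rewrite EFinM muleCA.
split.
  have -> : c * M + A * (M + be * v) = (c + A) * M + A * be * v by ring.
  have cA0 : 0 <= c + A by rewrite addr_ge0.
  apply: le_trans (IZ _ _ cA0 Ab0).
  apply: int_le => // y; rewrite -split3 ?addr_ge0//.
  apply: lee_wpmul2l => //; rewrite lee_fin; apply: le_trans (fu y) _.
  by rewrite mulrDr mulr1 mulrA addrA.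
rewrite EFinM -hM -intZl ?lee_fin//.
apply: (@le_trans _ _ (\int[mu]_y (h y * (f y)%:E + (A%:E * h y + (A * be)%:E * (h y * (V y)%:E))))%E).
  apply: int_le => //; first by move=> y; rewrite mule_ge0.
  move=> y; rewrite -split3// -ge0_muleDr ?lee_fin//; last by rewrite addr_ge0// mulr_ge0.
  rewrite muleC; apply: lee_wpmul2l => //; rewrite -EFinD lee_fin; apply: le_trans (fl y) _.
  by rewrite mulrDr mulr1 mulrA.
rewrite intD//; last by move=> y; rewrite adde_ge0// mule_ge0.
rewrite leeD2l//; apply: (le_trans (IZ _ _ A0 Ab0)).
by rewrite lee_fin mulrDr mulrA.
Qed.

Variables (k : T -> T -> \bar R) (V : T -> R) (rho L : R) (B : set T) (pi : T -> \bar R) (PV : R).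
Hypotheses (mk : measurable_fun setT (fun z : T * T => k z.1 z.2))
  (k0 : forall x y, (0 <= k x y)%E)
  (k1 : forall x, (\int[mu]_y k x y = 1)%E)
  (mV : measurable_fun setT V) (V0 : forall x, 0 <= V x)
  (rho0 : 0 <= rho) (rho1 : rho < 1) (L0 : 0 <= L)
  (drift : forall x, (\int[mu]_y (k x y * (V y)%:E) <= (rho * V x + L)%:E)%E)
  (mB : measurable B) (B1 : mu B = 1%E)
  (minor : forall r, exists eps, 0 < eps /\ forall x y, V x <= r -> B y -> (eps%:E <= k x y)%E)
  (mpi : measurable_fun setT pi) (pi0 : forall x, (0 <= pi x)%E)
  (pi1 : (\int[mu]_x pi x = 1)%E)
  (piV : (\int[mu]_x (pi x * (V x)%:E) <= PV%:E)%E)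
  (inv : forall f : T -> R, measurable_fun setT f -> (forall x, 0 <= f x <= 1) ->
     (\int[mu]_x (pi x * \int[mu]_y (k x y * (f y)%:E)) = \int[mu]_x (pi x * (f x)%:E))%E).

Definition Pop (f : T -> R) (x : T) : R := fine (\int[mu]_y (k x y * (f y)%:E))%E.

Let mk1 x : measurable_fun setT (k x).
Proof. exact: (measurableT_comp mk (pair1_measurable x)). Qed.

Lemma Pop_E (f : T -> R) : measurable_fun setT f -> (forall x, 0 <= f x <= 1) ->
  (forall x, (\int[mu]_y (k x y * (f y)%:E) = (Pop f x)%:E)%E) /\
  (forall x, 0 <= Pop f x <= 1) /\ measurable_fun setT (Pop f).
Proof.
move=> mf f01.
have f0 x : 0 <= f x by have /andP[] := f01 x.
have f1 x : f x <= 1 by have /andP[] := f01 x.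
have I0 x : (0 <= \int[mu]_y (k x y * (f y)%:E))%E by apply: int_ge0 => y; rewrite mule_ge0// lee_fin.
have I1 x : (\int[mu]_y (k x y * (f y)%:E) <= 1)%E.
  rewrite -(k1 x); apply: int_le => //.
  - by move=> y; rewrite mule_ge0// lee_fin.
  - by move=> y; rewrite -[leRHS]mule1; apply: lee_wpmul2l => //; rewrite lee_fin.
have PE x : (\int[mu]_y (k x y * (f y)%:E) = (Pop f x)%:E)%E.
  by rewrite fineK// ge0_fin_numE// (le_lt_trans (I1 x))// ltry.
split; [exact: PE|split].
  by move=> x; rewrite -!lee_fin -PE I0 I1.
have mF : measurable_fun setT (fun z : T * T => (k z.1 z.2 * (f z.2)%:E)%E).
  have mf2 : measurable_fun setT (fun z : T * T => f z.2) by exact: measurableT_comp.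
  by meas.
have := @measurable_fun_fubini_tonelli_F _ _ T T R mu (fun z => (k z.1 z.2 * (f z.2)%:E)%E) mF.
move=> mFF; have {}mFF : measurable_fun setT (fun x => (\int[mu]_y (k x y * (f y)%:E))%E).
  by apply: mFF => z; rewrite mule_ge0// lee_fin.
by apply: (measurableT_comp _ mFF).
Qed.

Section Contraction.
Variables (be : R) (f : T -> R) (c A : R).
Hypotheses (be0 : 0 <= be) (c0 : 0 <= c) (A0 : 0 <= A)
  (mf : measurable_fun setT f) (f01 : forall x, 0 <= f x <= 1)
  (fu : forall y, f y <= c + A * (1 + be * V y)) (fl : forall y, c <= f y + A * (1 + be * V y)).

Lemma Pop_drift x y :
  Pop f x - Pop f y <= A * (2 + be * (rho * (V x + V y) + 2 * L)).
Proof.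
have f0 z : 0 <= f z by have /andP[] := f01 z.
have [PE _] := Pop_E mf f01.
have [+ _] := density_sandwich (mk1 x) (k0 x) mV V0 mf f0 (k1 x) (drift x) c0 A0 be0 fu fl.
have [_] := density_sandwich (mk1 y) (k0 y) mV V0 mf f0 (k1 y) (drift y) c0 A0 be0 fu fl.
by rewrite !PE -EFinD !lee_fin; lra.
Qed.

Lemma Pop_minor x y eps : 0 < eps ->
  (forall z, B z -> (eps%:E <= k x z)%E) -> (forall z, B z -> (eps%:E <= k y z)%E) ->
  Pop f x - Pop f y <= A * (2 * (1 - eps) + be * (rho * (V x + V y) + 2 * L)).
Proof.
move=> e0 kx ky.
have f0 z : 0 <= f z by have /andP[] := f01 z.
have [PE _] := Pop_E mf f01.
pose nu z : \bar R := (eps * \1_B z)%:E.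
have mnu : measurable_fun setT nu.
  by apply/measurable_EFinP; apply: measurable_funM => //; exact: measurable_indic.
have nu0 z : (0 <= nu z)%E by rewrite lee_fin mulr_ge0 ?(ltW e0)// indicE ler0n.
have nuM : (\int[mu]_z nu z = eps%:E)%E.
  rewrite /nu; under eq_integral => z _ do rewrite EFinM.
  rewrite intZl ?lee_fin ?(ltW e0)//.
  - by rewrite integral_indic//= setIT B1 mule1.
  - by apply/measurable_EFinP; exact: measurable_indic.
have key w : (forall z, B z -> (eps%:E <= k w z)%E) ->
  exists h : T -> \bar R, [/\ measurable_fun setT h, forall z, (0 <= h z)%E,
     (\int[mu]_z h z = (1 - eps)%:E)%E, (\int[mu]_z (h z * (V z)%:E) <= (rho * V w + L)%:E)%E &
     (Pop f w)%:E = (\int[mu]_z (nu z * (f z)%:E) + \int[mu]_z (h z * (f z)%:E))%E].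
  move=> kw; exists (fun z => k w z - nu z)%E.
  have mkw := mk1 w.
  have h0 z : (0 <= k w z - nu z)%E.
    rewrite sube_ge0 ?fin_numE// /nu indicE.
    have [zB|_] := boolP (z \in B); last by rewrite mulr0.
    by rewrite mulr1; apply/kw/set_mem.
  have mh : measurable_fun setT (fun z => k w z - nu z)%E by apply: emeasurable_funB.
  have mhV : measurable_fun setT (fun z => (k w z - nu z) * (V z)%:E)%E.
    by apply: emeasurable_funM.
  have mhf : measurable_fun setT (fun z => (k w z - nu z) * (f z)%:E)%E.
    by apply: emeasurable_funM.
  have kE z : k w z = (nu z + (k w z - nu z))%E by rewrite addeC subeK.
  have I1 : (\int[mu]_z (k w z - nu z) = (1 - eps)%:E)%E.
    have := k1 w; under eq_integral => z _ do rewrite kE.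
    rewrite intD// nuM; case: (\int[mu]_z (k w z - nu z))%E => [u| |]//=.
    move=> h; have {}h : eps + u = 1 by apply: EFin_inj; rewrite EFinD.
    by congr EFin; lra.
  split=> //.
    apply: le_trans (drift w); apply: int_le => //.
    - by move=> z; rewrite mule_ge0// lee_fin.
    - move=> z; apply: lee_wpmul2r; first by rewrite lee_fin.
      by rewrite leeBlDr// leeDl.
  rewrite -PE -intD//; last 2 first.
  - by move=> z; rewrite mule_ge0// lee_fin.
  - by move=> z; rewrite mule_ge0// lee_fin.
  by apply: eq_integral => z _; rewrite -ge0_muleDl// -kE.
have [hx [mhx hx0 Mx Vx Px]] := key x kx.
have [hy [mhy hy0 My Vy Py]] := key y ky.
have [ux _] := density_sandwich mhx hx0 mV V0 mf f0 Mx Vx c0 A0 be0 fu fl.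
have [_ ly] := density_sandwich mhy hy0 mV V0 mf f0 My Vy c0 A0 be0 fu fl.
have nuf0 : (0 <= \int[mu]_z (nu z * (f z)%:E))%E.
  by apply: int_ge0 => z; rewrite mule_ge0// lee_fin.
have hxf0 : (0 <= \int[mu]_z (hx z * (f z)%:E))%E.
  by apply: int_ge0 => z; rewrite mule_ge0// lee_fin.
have hyf0 : (0 <= \int[mu]_z (hy z * (f z)%:E))%E.
  by apply: int_ge0 => z; rewrite mule_ge0// lee_fin.
move: Px Py ux ly nuf0 hxf0 hyf0.
move: (\int[mu]_z (nu z * (f z)%:E))%E (\int[mu]_z (hx z * (f z)%:E))%E
  (\int[mu]_z (hy z * (f z)%:E))%E => [n| |] [u| |] [w| |]//=.
rewrite -!EFinD !lee_fin => -[->] -[->] h1 h2 _ _ _.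
lra.
Qed.
End Contraction.

(* [c] and [A] measure the oscillation of [f] relative to the weight [1 + be * V]; as in Hairer and Mattingly,
   small [be] makes both the drift and the minorization contract it. *)
Lemma contraction : exists al be : R, [/\ 0 < al, al < 1, 0 < be &
  forall (f : T -> R) (c A : R), 0 <= c -> 0 <= A -> measurable_fun setT f -> (forall x, 0 <= f x <= 1) ->
    (forall y, f y <= c + A * (1 + be * V y)) -> (forall y, c <= f y + A * (1 + be * V y)) ->
    forall x y, Pop f x - Pop f y <= al * A * (2 + be * (V x + V y))].
Proof.
pose rho' : R := (1 + rho) / 2.
have h1 := rho1; have h0 := rho0; have hL := L0.
have r'1 : rho' < 1 by rewrite /rho'; lra.
have rr' : 0 < rho' - rho by rewrite /rho'; lra.
pose Rb : R := 2 * L / (rho' - rho) + 1.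
have Rb0 : 0 < Rb by rewrite /Rb ltr_pwDr// divr_ge0 ?mulr_ge0// ltW.
have RbL s : Rb <= s -> 2 * L <= (rho' - rho) * s.
  by move=> h; rewrite [leRHS]mulrC -ler_pdivrMr//; apply: le_trans h; rewrite lerDl.
have [eps [e0 He]] := minor Rb.
pose be : R := eps / (2 * (L + 1)).
have L1 : 0 < 2 * (L + 1) by lra.
have be0 : 0 < be by rewrite divr_gt0.
have beL : be * (2 * L) <= eps.
  have : be * (2 * (L + 1)) = eps by rewrite divfK// gt_eqF.
  by move: be0; set b := be => b0; nra.
have D0 : 0 < 2 + be * Rb by rewrite ltr_wpDr// mulr_ge0// ltW.
pose a1 : R := (2 + be * (rho' * Rb)) / (2 + be * Rb).
have a11 : a1 < 1.
  rewrite ltr_pdivrMr// mul1r ltrD2l ltr_pM2l// -[ltRHS]mul1r ltr_pM2r//.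
pose al : R := Num.max (Num.max a1 (1 - eps / 2)) (Num.max rho 2^-1).
have ala1 : a1 <= al by rewrite /al !le_max lexx.
have ale : 1 - eps / 2 <= al by rewrite /al !le_max lexx orbT.
have alr : rho <= al by rewrite /al !le_max lexx !orbT.
have alh : 2^-1 <= al by rewrite /al !le_max lexx !orbT.
exists al, be; split=> //.
- by apply: lt_le_trans alh; rewrite invr_gt0.
- rewrite /al !gt_max a11 rho1 invf_lt1// ltr1n andbT /=; lra.
move=> f c A c0 A0 mf f01 fu fl x y.
set s : R := V x + V y.
have s0 : 0 <= s by rewrite addr_ge0.
rewrite [al * A]mulrC -mulrA.
have [hs|hs] := leP Rb s.
  apply: le_trans (@Pop_drift be f c A (ltW be0) c0 A0 mf f01 fu fl x y) _.
  apply: ler_wpM2l => //; rewrite -/s.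
  apply: (@le_trans _ _ (a1 * (2 + be * s))); last first.
    by rewrite ler_wpM2r// addr_ge0// mulr_ge0// ltW.
  apply: (@le_trans _ _ (2 + be * (rho' * s))).
    by rewrite lerD2l ler_pM2l//; have := RbL _ hs; lra.
  rewrite /a1 [leRHS]mulrAC ler_pdivlMr//.
  rewrite -subr_ge0.
  have -> : (2 + be * (rho' * Rb)) * (2 + be * s) - (2 + be * (rho' * s)) * (2 + be * Rb) =
    2 * be * ((1 - rho') * (s - Rb)) by ring.
  by apply: mulr_ge0; apply: mulr_ge0; rewrite ?subr_ge0// ltW.
have hx : V x <= Rb by have := V0 y; rewrite /s in hs; lra.
have hy : V y <= Rb by have := V0 x; rewrite /s in hs; lra.
apply: le_trans (@Pop_minor be f c A (ltW be0) c0 A0 mf f01 fu fl x y eps e0 _ _) _.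
- by move=> z; exact: He.
- by move=> z; exact: He.
apply: ler_wpM2l => //; rewrite -/s.
have g1 : rho * s <= al * s by rewrite ler_wpM2r.
have g2 : be * (rho * s) <= be * (al * s) by rewrite ler_wpM2l// ltW.
lra.
Qed.

Fixpoint Piter (f : T -> R) (m : nat) : T -> R :=
  if m is m'.+1 then Pop (Piter f m') else f.

Lemma Piter_P (f : T -> R) m : measurable_fun setT f -> (forall x, 0 <= f x <= 1) ->
  measurable_fun setT (Piter f m) /\ forall x, 0 <= Piter f m x <= 1.
Proof.
by move=> mf f01; elim: m => [//|m [mP P01]] /=; have [_ [? ?]] := Pop_E mP P01.
Qed.

Theorem harris : exists (t : R) (J : T -> R), 0 < t < 1 /\ (forall x, 0 < J x) /\
  forall (f : T -> R), measurable_fun setT f -> (forall x, 0 <= f x <= 1) ->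
  forall x m, (`| (Piter f m x)%:E - \int[mu]_y (pi y * (f y)%:E) | <= (J x * t ^+ m)%:E)%E.
Proof.
have [al [be [al0 al1 be0 Hc]]] := contraction.
exists al, (fun x => 3 + be * V x + be * `|PV|).
split; [by rewrite al0 al1|split].
  by move=> x; rewrite !ltr_wpDr// mulr_ge0// ltW.
move=> f mf f01 x m.
have [mP P01] := Piter_P m mf f01.
have D : exists c, [/\ 0 <= c, (forall y, Piter f m y <= c + al ^+ m * (1 + be * V y)) &
    (forall y, c <= Piter f m y + al ^+ m * (1 + be * V y))].
  elim: m {mP P01} => [|m IH].
    exists 0; split=> // y; rewrite expr0 mul1r /=; have /andP[h0 h1] := f01 y.
      by rewrite add0r; apply: le_trans h1 _; rewrite lerDl mulr_ge0// ltW.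
    by rewrite addr_ge0// addr_ge0// mulr_ge0// ltW.
  have PIm := Piter_P m mf f01; have [mP P01] := Piter_P m.+1 mf f01.
  have [c [c0 cu cl]] := IH.
  have A0 : 0 <= al ^+ m by rewrite exprn_ge0// ltW.
  have H := Hc _ c _ c0 A0 PIm.1 PIm.2 cu cl.
  set g := Piter f m.+1 in mP P01 *.
  set D := al ^+ m.+1.
  have D0 : 0 <= D by rewrite exprn_ge0// ltW.
  have W y : 0 <= D * (1 + be * V y).
    by apply: mulr_ge0 => //; apply: addr_ge0 => //; apply: mulr_ge0 => //; exact: ltW.
  have H' y z : g y - D * (1 + be * V y) <= g z + D * (1 + be * V z).
    by have := H y z; rewrite -exprS -/D /g /=; lra.
  pose S := [set r | exists z, r = g z - D * (1 + be * V z)].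
  have Sne : S !=set0 by exists (g x - D * (1 + be * V x)); exists x.
  have Sub z : ubound S (g z + D * (1 + be * V z)).
    by move=> r [w ->]; exact: H'.
  have Shas : has_sup S by split => //; exists (g x + D * (1 + be * V x)); exact: Sub.
  exists (Num.max 0 (sup S)); split.
  - by rewrite le_max lexx.
  - move=> y; rewrite -lerBlDr le_max; apply/orP; right.
    by apply: sup_upper_bound => //; exists y.
  - move=> y; rewrite ge_max; apply/andP; split.
      by have /andP[h _] := P01 y; apply: addr_ge0.
    by apply: ge_sup => //; exact: Sub.
have [c [c0 cu cl]] := D.
have A0 : 0 <= al ^+ m by rewrite exprn_ge0// ltW.
have P0 z : 0 <= Piter f m z by have /andP[] := P01 z.
have [hu hl] := density_sandwich mpi pi0 mV V0 mP P0 pi1 piV c0 A0 (ltW be0) cu cl.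
have E : (\int[mu]_y (pi y * (Piter f m y)%:E) = \int[mu]_y (pi y * (f y)%:E))%E.
  elim: m {mP P01 D c c0 cu cl A0 P0 hu hl} => [|m IH]//=.
  have PIm := Piter_P m mf f01.
  rewrite -IH -(inv PIm.1 PIm.2); apply: eq_integral => y _.
  by have [-> _] := Pop_E PIm.1 PIm.2.
rewrite {}E in hu hl.
have I0 : (0 <= \int[mu]_y (pi y * (f y)%:E))%E.
  by apply: int_ge0 => y; rewrite mule_ge0// lee_fin; have /andP[] := f01 y.
move: hu hl I0; case: (\int[mu]_y (pi y * (f y)%:E))%E => [u| |]//=.
rewrite -!EFinD !lee_fin => hu hl _.
have cu1 := cu x; have cl1 := cl x.
have hPV : be * PV <= be * `|PV| by rewrite ler_pM2l// ler_norm.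
have hPV2 : al ^+ m * (1 + be * PV) <= al ^+ m * (1 + be * `|PV|) by rewrite ler_wpM2l// lerD2l.
rewrite ler_norml; apply/andP; split; lra.
Qed.
End Harris.

Section MeasMatrix.
Variable R : realType.
Context d (T : measurableType d).

Lemma mfun_inv (f : T -> R) : measurable_fun setT f -> measurable_fun setT (fun t => (f t)^-1).
Proof.
move=> mf; rewrite (_ : (fun t => _) =
  fun t => if 0 <= f t then f t `^ (-1) else - ((- f t) `^ (-1))); first by meas.
apply/funext => t; case: leP => h; first by rewrite powR_inv1.
by rewrite powR_inv1 ?oppr_ge0 ?ltW// invrN opprK.
Qed.

Lemma mfun_sqrt (f : T -> R) : measurable_fun setT f -> measurable_fun setT (fun t => Num.sqrt (f t)).
Proof.
move=> mf; rewrite (_ : (fun t => _) = fun t => if 0 <= f t then f t `^ (2^-1) else 0); first by meas.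
by apply/funext => t; case: leP => h; [rewrite powR12_sqrt|rewrite ler0_sqrtr ?ltW].
Qed.

Definition mmx m k (A : T -> 'M[R]_(m, k)) := forall i j, measurable_fun setT (fun t => A t i j).

Lemma mmx_cst m k (A : 'M[R]_(m, k)) : mmx (fun=> A).
Proof. by move=> i j; exact: measurable_cst. Qed.

Lemma mfun_ext (f g : T -> R) : (forall t, f t = g t) -> measurable_fun setT g -> measurable_fun setT f.
Proof. by move=> /funext ->. Qed.

Lemma emfun_ext (f g : T -> \bar R) : (forall t, f t = g t) -> measurable_fun setT g -> measurable_fun setT f.
Proof. by move=> /funext ->. Qed.

Lemma mmxD m k (A B : T -> 'M[R]_(m, k)) : mmx A -> mmx B -> mmx (fun t => A t + B t).
Proof.
move=> mA mB i j; apply: (@mfun_ext _ (fun t => A t i j + B t i j)) => [t|]; first by rewrite mxE.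
by move: (mA i j) (mB i j) => ? ?; meas.
Qed.

Lemma mmxB m k (A B : T -> 'M[R]_(m, k)) : mmx A -> mmx B -> mmx (fun t => A t - B t).
Proof.
move=> mA mB i j; apply: (@mfun_ext _ (fun t => A t i j - B t i j)) => [t|]; first by rewrite !mxE.
by move: (mA i j) (mB i j) => ? ?; meas.
Qed.

Lemma mmxM m k l (A : T -> 'M[R]_(m, k)) (B : T -> 'M[R]_(k, l)) :
  mmx A -> mmx B -> mmx (fun t => A t *m B t).
Proof.
move=> mA mB i j; apply: (@mfun_ext _ (fun t => \sum_u A t i u * B t u j)) => [t|]; first by rewrite mxE.
by apply: measurable_sum => u; apply: measurable_funM; [exact: mA|exact: mB].
Qed.

Lemma mfun_det k (A : T -> 'M[R]_k) : mmx A -> measurable_fun setT (fun t => \det (A t)).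
Proof.
move=> mA; rewrite /determinant; apply: measurable_sum => s.
by apply: measurable_funM => //; apply: measurable_prod => i _; exact: mA.
Qed.

Lemma mmx_invmx k (A : T -> 'M[R]_k) : mmx A -> mmx (fun t => invmx (A t)).
Proof.
move=> mA i j; have md := mfun_det mA.
apply: (@mfun_ext _ (fun t => if \det (A t) < 0 then (\det (A t))^-1 * cofactor (A t) j i else
   if 0 < \det (A t) then (\det (A t))^-1 * cofactor (A t) j i else A t i j)) => [t|].
  rewrite /invmx unitmxE unitfE.
  case: (ltgtP (\det (A t)) 0) => h; rewrite ?h ?eqxx//= !mxE//.
have mV := mfun_inv md.
have mc : measurable_fun setT (fun t => cofactor (A t) j i).
  rewrite /cofactor; apply: measurable_funM => //; apply: mfun_det => a b.
  by apply: (mfun_ext _ (mA (lift j a) (lift i b))) => t; rewrite !mxE.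
by move: (mA i j) => ?; meas.
Qed.

Lemma mfun_mvn k (S : T -> 'M[R]_k) (m x : T -> 'cV[R]_k) : mmx S -> mmx m -> mmx x ->
  measurable_fun setT (fun t => mvn_pdf (S t) (m t) (x t)).
Proof.
move=> mS mm mx; rewrite /mvn_pdf.
have h1 := mfun_sqrt (mfun_det mS).
have mxm := mmxB mx mm.
have h2 : measurable_fun setT (fun t => ((x t - m t)^T *m S t *m (x t - m t)) 0 0).
  apply: mmxM => //; apply: mmxM => // i j.
  by apply: (mfun_ext _ (mxm j i)) => t; rewrite mxE.
by meas.
Qed.

Lemma mmx_tcol k (f : T -> k.-tuple R) : measurable_fun setT f -> mmx (fun t => tcol (f t)).
Proof.
move=> mf i j; apply: (mfun_ext _ (measurableT_comp (measurable_tnth i) mf)) => t.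
by rewrite mxE.
Qed.

End MeasMatrix.

Section Fubini3.
Context d1 d2 d3 (T1 : measurableType d1) (T2 : measurableType d2) (T3 : measurableType d3)
  (R : realType).
Variables (m1 : {sigma_finite_measure set T1 -> \bar R}) (m2 : {sigma_finite_measure set T2 -> \bar R})
  (m3 : {sigma_finite_measure set T3 -> \bar R}).
Local Open Scope ereal_scope.

Lemma measurable_int2 d (T : measurableType d) (m : {sigma_finite_measure set T -> \bar R})
   (f : T1 -> T -> \bar R) : measurable_fun setT (fun z : T1 * T => f z.1 z.2) ->
  (forall x y, 0 <= f x y) -> measurable_fun setT (fun x => \int[m]_y f x y).
Proof.
move=> mf f0.
exact: (@measurable_fun_fubini_tonelli_F _ _ T1 T R m (fun z => f z.1 z.2)).
Qed.

Lemma fubini3 (F : T1 -> T2 -> T3 -> \bar R) :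
  measurable_fun setT (fun z : (T1 * T2) * T3 => F z.1.1 z.1.2 z.2) ->
  (forall x y z, 0 <= F x y z) ->
  \int[m1]_x \int[m2]_y \int[m3]_z F x y z = \int[m2]_y \int[m3]_z \int[m1]_x F x y z.
Proof.
move=> mF F0.
have mG : measurable_fun setT (fun z : T1 * T2 => \int[m3]_w F z.1 z.2 w).
  apply: (@measurable_fun_fubini_tonelli_F _ _ (T1 * T2)%type T3 R m3 (fun z => F z.1.1 z.1.2 z.2)) => //.
rewrite (@fubini_tonelli _ _ T1 T2 R m1 m2 (fun z => \int[m3]_w F z.1 z.2 w))//; last first.
  by move=> z; apply: integral_ge0.
apply: eq_integral => y _.
rewrite (@fubini_tonelli _ _ T1 T3 R m1 m3 (fun z => F z.1 y z.2))//.
apply: (measurableT_comp mF (_ : measurable_fun setT (fun z : T1 * T3 => ((z.1, y), z.2)))).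
apply: measurable_fun_pair => //; exact: measurable_fun_pair.
Qed.

End Fubini3.

Section Prod1.
Variable R : realType.
Notation leb := (@lebesgue_measure R).

Lemma lebK_prod_one k (f : 'I_k -> R -> R) :
  (forall i, measurable_fun setT (f i)) -> (forall i x, 0 <= f i x) ->
  (forall i, (\int[leb]_x (f i x)%:E = 1)%E) ->
  (\int[lebK R k]_t (\prod_(i < k) f i (tnth t i))%:E = 1)%E.
Proof.
move=> mf f0 f1.
under eq_integral do rewrite -prodEFin.
rewrite (@lebK_prod R k (fun i x => (f i x)%:E)).
- by rewrite big1.
- by move=> i; apply/measurable_EFinP.
- by move=> i x; rewrite lee_fin.
Qed.

Lemma lebK_prod_marg k (f : 'I_k -> R -> R) (g : R -> R) (j : 'I_k) :
  (forall i, measurable_fun setT (f i)) -> (forall i x, 0 <= f i x) ->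
  (forall i, (\int[leb]_x (f i x)%:E = 1)%E) ->
  measurable_fun setT g -> (forall x, 0 <= g x) ->
  (\int[lebK R k]_t (g (tnth t j) * \prod_(i < k) f i (tnth t i))%:E = \int[leb]_x (g x * f j x)%:E)%E.
Proof.
move=> mf f0 f1 mg g0.
pose h i x := ((if i == j then g x * f i x else f i x)%:E)%E.
transitivity (\int[lebK R k]_t (\prod_(i < k) h i (tnth t i)))%E.
  apply: eq_integral => t _; rewrite /h prodEFin; congr _%:E.
  rewrite [RHS](bigD1 j)//= eqxx [X in _ * X = _](bigD1 j)//= mulrA; congr (_ * _).
  by apply: eq_bigr => i ij; rewrite (negbTE ij).
rewrite lebK_prod.
- rewrite (bigD1 j)//= /h eqxx big1 ?mule1// => i ij; rewrite (negbTE ij); exact: f1.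
- by move=> i; rewrite /h; have := mf i; case: eqP => _ ?; meas.
- by move=> i x; rewrite lee_fin; case: eqP => _ //; rewrite mulr_ge0.
Qed.
End Prod1.

(** * The Gibbs kernel *)

Section Model.
Variables (R : realType) (n p r : nat) (qj : 'I_r -> nat).
Local Notation q := (qsum qj).
Local Notation d := (p + q)%N.
Variables (X : 'M[R]_(n, p)) (Z : 'M[R]_(n, q)) (y : 'I_n -> bool) (a b : 'I_r -> R).
Notation leb := (@lebesgue_measure R).
Notation W := (W X Z).
Notation Sigma := (Sigma X Z).
Notation lin := (lin X Z).

Definition tau_rate (eta : d.-tuple R) (j : 'I_r) : R := b j + usq eta j / 2.
Definition tau_shape (j : 'I_r) : R := a j + (qj j)%:R / 2.
Definition tau_pdf (eta : d.-tuple R) (j : 'I_r) (t : R) : R :=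
  if 0 < tau_rate eta j then gamma_un (tau_shape j) (tau_rate eta j) t / (Gam (tau_shape j) * (tau_rate eta j) `^ (- tau_shape j))
  else gamma_un 1 1 t / Gam 1.

Hypothesis shp0 : forall j, 0 < tau_shape j.

Lemma tau_condE eta tau : tau_cond a b eta tau = \prod_(j < r) tau_pdf eta j (tnth tau j).
Proof.
apply: eq_bigr => j _; rewrite /tau_pdf -/(tau_rate eta j) -/(tau_shape j) /gamma_pdf.
case: ifP => h; first by rewrite gamma_int.
by rewrite gamma_int// powR1 mulr1.
Qed.

Lemma tc_ge0 eta j t : 0 <= tau_pdf eta j t.
Proof.
rewrite /tau_pdf; case: ifP => h; rewrite divr_ge0 ?gamma_un_ge0//; last exact/ltW/Gam_gt0.
by rewrite mulr_ge0 ?powR_ge0// ltW// Gam_gt0.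
Qed.

Lemma tc_neg eta j t : t <= 0 -> tau_pdf eta j t = 0.
Proof.
move=> t0; rewrite /tau_pdf /gamma_un; have -> : (0 < t) = false by rewrite ltNge t0.
by rewrite !mul0r if_same.
Qed.

Lemma usq_ge0 (eta : d.-tuple R) (j : 'I_r) : 0 <= usq eta j.
Proof. by apply: sumr_ge0 => k _; exact: sqr_ge0. Qed.

Lemma measurable_usq d' (T : measurableType d') (f : T -> d.-tuple R) j :
  measurable_fun setT f -> measurable_fun setT (fun t => usq (f t) j).
Proof.
move=> mf; rewrite /usq; under eq_fun do rewrite -big_filter.
apply: measurable_sum => k; apply: measurable_funX.
exact: (measurableT_comp (measurable_tnth _) mf).
Qed.

Lemma measurable_rate d' (T : measurableType d') (f : T -> d.-tuple R) j :
  measurable_fun setT f -> measurable_fun setT (fun t => tau_rate (f t) j).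
Proof. by move=> mf; move: (measurable_usq j mf) => ?; rewrite /tau_rate; meas. Qed.

Lemma measurable_tc2 d' (T : measurableType d') (f : T -> d.-tuple R) (g : T -> R) j :
  measurable_fun setT f -> measurable_fun setT g ->
  measurable_fun setT (fun t => tau_pdf (f t) j (g t)).
Proof.
move=> mf mg; move: (measurable_rate j mf) => mr.
have mi := mfun_inv (mfun_powR (- tau_shape j) mr).
rewrite (_ : (fun t => _) = fun t => if 0 < tau_rate (f t) j then
    gamma_un (tau_shape j) (tau_rate (f t) j) (g t) * ((Gam (tau_shape j))^-1 * (tau_rate (f t) j `^ (- tau_shape j))^-1)
    else gamma_un 1 1 (g t) / Gam 1); first by rewrite /gamma_un; meas.
by apply/funext => t; rewrite /tau_pdf invfM.
Qed.

Lemma tc_mass eta j : (\int[leb]_t (tau_pdf eta j t)%:E = 1)%E.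
Proof.
have [h|h] := boolP (0 < tau_rate eta j).
  under eq_integral => t _ do rewrite /tau_pdf h EFinM.
  have G0 : 0 < Gam (tau_shape j) * tau_rate eta j `^ (- tau_shape j) by rewrite mulr_gt0 ?powR_gt0// Gam_gt0.
  rewrite intZr ?lee_fin ?invr_ge0 ?(ltW G0)//.
  - by rewrite gamma_int// -EFinM mulfV// gt_eqF.
  - by apply/measurable_EFinP; exact: measurable_gamma_un.
  - by move=> x; rewrite lee_fin gamma_un_ge0.
under eq_integral => t _ do rewrite /tau_pdf (negbTE h) EFinM.
have G0 : 0 < Gam 1 :> R by rewrite Gam_gt0.
rewrite intZr ?lee_fin ?invr_ge0 ?(ltW G0)//.
- by rewrite gamma_intE// -EFinM mulfV// gt_eqF.
- by apply/measurable_EFinP; exact: measurable_gamma_un.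
- by move=> x; rewrite lee_fin gamma_un_ge0.
Qed.

Lemma v_condE eta v : v_cond X Z y eta v =
  \prod_(i < n) (tnI (y i) (tnth v i) * phi (tnth v i - lin eta i) / ZT (y i) (lin eta i)).
Proof. by []. Qed.

Lemma measurable_ZT yy : measurable_fun setT (@ZT R yy).
Proof.
have mf : measurable_fun setT (fun z : R * R => (tnI yy z.2 * phi (z.2 - z.1))%:E).
  have m1 : measurable_fun setT (fun z : R * R => tnI yy z.2).
    by apply: (measurableT_comp (measurable_tnI yy)).
  have m2 : measurable_fun setT (fun z : R * R => phi (z.2 - z.1)).
    by apply: mphi; apply: measurable_funB.
  by meas.
have H := @measurable_int2 _ R R _ (measurableTypeR R) leb (fun x t => (tnI yy t * phi (t - x))%:E) mf.
have {}H := H (fun x t => _).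
apply: (measurableT_comp _ (H _)) => // x t.
by rewrite lee_fin tphi_ge0.
Qed.

Lemma measurable_lin d' (T : measurableType d') (f : T -> d.-tuple R) i :
  measurable_fun setT f -> measurable_fun setT (fun t => lin (f t) i).
Proof.
move=> mf; have := mmxM (mmx_cst (T := T) W) (mmx_tcol mf).
by move=> /(_ i 0).
Qed.

Lemma measurable_tn2 d' (T : measurableType d') (f g : T -> R) yy :
  measurable_fun setT f -> measurable_fun setT g ->
  measurable_fun setT (fun t => tn_pdf (f t) yy (g t)).
Proof.
move=> mf mg.
have m1 : measurable_fun setT (fun t => tnI yy (g t)) by apply: (measurableT_comp (measurable_tnI yy)).
have m2 : measurable_fun setT (fun t => phi (g t - f t)) by apply: mphi; meas.
have m3 : measurable_fun setT (fun t => (ZT yy (f t))^-1).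
  by apply: mfun_inv; apply: (measurableT_comp (measurable_ZT yy)).
have m : measurable_fun setT (fun t => tnI yy (g t) * phi (g t - f t) * (ZT yy (f t))^-1) by meas.
exact: m.
Qed.

Lemma measurable_v_cond d' (T : measurableType d') (f : T -> d.-tuple R) (g : T -> n.-tuple R) :
  measurable_fun setT f -> measurable_fun setT g ->
  measurable_fun setT (fun t => v_cond X Z y (f t) (g t)).
Proof.
move=> mf mg; rewrite /v_cond; apply: measurable_prod => i _.
apply: measurable_tn2; first exact: measurable_lin.
exact: (measurableT_comp (measurable_tnth i) mg).
Qed.

Lemma measurable_tau_cond d' (T : measurableType d') (f : T -> d.-tuple R) (g : T -> r.-tuple R) :
  measurable_fun setT f -> measurable_fun setT g ->
  measurable_fun setT (fun t => tau_cond a b (f t) (g t)).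
Proof.
move=> mf mg; rewrite (_ : (fun t => _) = fun t => \prod_(j < r) tau_pdf (f t) j (tnth (g t) j)).
  apply: measurable_prod => j _; apply: measurable_tc2 => //.
  exact: (measurableT_comp (measurable_tnth j) mg).
by apply/funext => t; exact: tau_condE.
Qed.

Lemma mmx_Sigma d' (T : measurableType d') (g : T -> r.-tuple R) :
  measurable_fun setT g -> mmx (fun t => Sigma (g t)).
Proof.
move=> mg; apply: mmxD; first exact: mmx_cst.
move=> i j.
have mD u v : measurable_fun setT (fun t => Dmx qj (g t) u v).
  apply: (@mfun_ext _ _ _ _ (fun t => (u == v)%:R * \sum_(l <- index_enum 'I_r | inblk l u) tnth (g t) l)) => [t|].
    by rewrite mxE.
  apply: measurable_funM => //; under eq_fun do rewrite -big_filter.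
  by apply: measurable_sum => l; exact: (measurableT_comp (measurable_tnth l) mg).
rewrite -(splitK i) -(splitK j); case: (fintype.split i) => i'; case: (fintype.split j) => j' /=.
- by apply: (@mfun_ext _ _ _ _ (cst 0)) => [t|//]; rewrite block_mxEul mxE.
- by apply: (@mfun_ext _ _ _ _ (cst 0)) => [t|//]; rewrite block_mxEur mxE.
- by apply: (@mfun_ext _ _ _ _ (cst 0)) => [t|//]; rewrite block_mxEdl mxE.
- by apply: (mfun_ext _ (mD i' j')) => t; rewrite block_mxEdr.
Qed.

Definition mvn (tau : r.-tuple R) (v : n.-tuple R) (eta' : d.-tuple R) : R :=
  mvn_pdf (Sigma tau) (invmx (Sigma tau) *m (W^T *m tcol v)) (tcol eta').

Lemma measurable_mvn d' (T : measurableType d') (f : T -> r.-tuple R) (g : T -> n.-tuple R)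
   (h : T -> d.-tuple R) :
  measurable_fun setT f -> measurable_fun setT g -> measurable_fun setT h ->
  measurable_fun setT (fun t => mvn (f t) (g t) (h t)).
Proof.
move=> mf mg mh; have mS := mmx_Sigma mf.
apply: mfun_mvn => //; last exact: mmx_tcol.
apply: mmxM; first exact: mmx_invmx.
by apply: mmxM; [exact: mmx_cst|exact: mmx_tcol].
Qed.

Lemma tau_cond_ge0 (eta : d.-tuple R) tau : 0 <= tau_cond a b eta tau.
Proof. by rewrite tau_condE prodr_ge0// => j _; exact: tc_ge0. Qed.

Lemma v_cond_ge0 eta v : 0 <= v_cond X Z y eta v.
Proof. by apply: prodr_ge0 => i _; exact: tn_pdf_ge0. Qed.

Lemma mvn_upd_ge0 tau v eta' : 0 <= mvn tau v eta'.
Proof. exact: mvn_ge0. Qed.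

Definition kint (eta eta' : d.-tuple R) tau v : R :=
  tau_cond a b eta tau * v_cond X Z y eta v * mvn tau v eta'.

Lemma kint_ge0 eta eta' tau v : 0 <= kint eta eta' tau v.
Proof. by rewrite !mulr_ge0 ?mvn_upd_ge0 ?v_cond_ge0 ?tau_cond_ge0. Qed.

Lemma measurable_kint d' (T : measurableType d') (f g : T -> d.-tuple R) (h : T -> r.-tuple R)
   (l : T -> n.-tuple R) :
  measurable_fun setT f -> measurable_fun setT g -> measurable_fun setT h -> measurable_fun setT l ->
  measurable_fun setT (fun t => kint (f t) (g t) (h t) (l t)).
Proof.
move=> mf mg mh ml; apply: measurable_funM; last exact: measurable_mvn.
by apply: measurable_funM; [exact: measurable_tau_cond|exact: measurable_v_cond].
Qed.

Local Open Scope ereal_scope.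

Lemma kdenE eta eta' : kden X Z y a b eta eta' =
  \int[lebK R r]_tau \int[lebK R n]_v (kint eta eta' tau v)%:E.
Proof.
rewrite /kden.
have mk tau : measurable_fun setT (fun v : n.-tuple R => (kint eta eta' tau v)%:E).
  by apply/measurable_EFinP; apply: measurable_kint.
have E tau : lebint (fun v : n.-tuple R => (kint eta eta' tau v)%:E) =
    \int[lebK R n]_v (kint eta eta' tau v)%:E.
  by apply: lebintE => // v; rewrite lee_fin kint_ge0.
transitivity (lebint (fun tau => \int[lebK R n]_v (kint eta eta' tau v)%:E)).
  by congr lebint; apply/funext => tau; exact: E.
rewrite lebintE//; last first.
  by move=> tau; apply: int_ge0 => v; rewrite lee_fin kint_ge0.
apply: measurable_int2 => //; last by move=> tau v; rewrite lee_fin kint_ge0.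
by apply/measurable_EFinP; apply: measurable_kint.
Qed.

Lemma measurable_kden : measurable_fun setT
  (fun z : d.-tuple R * d.-tuple R => kden X Z y a b z.1 z.2).
Proof.
apply: (@emfun_ext _ _ _ _ (fun z => \int[lebK R r]_tau \int[lebK R n]_v (kint z.1 z.2 tau v)%:E)) => [z|].
  exact: kdenE.
apply: measurable_int2; last first.
  by move=> z tau; apply: int_ge0 => v; rewrite lee_fin kint_ge0.
apply: (@measurable_int2 _ _ _ _ _ _ (fun (z : (d.-tuple R * d.-tuple R) * r.-tuple R) v => (kint z.1.1 z.1.2 z.2 v)%:E)).
  apply/measurable_EFinP; apply: measurable_kint => //.
  - by do 2 apply: measurableT_comp => //.
  - by do 2 apply: measurableT_comp => //.
  - by apply: measurableT_comp => //.
by move=> z v; rewrite lee_fin kint_ge0.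
Qed.

Lemma kden_ge0 (eta eta' : d.-tuple R) : 0 <= kden X Z y a b eta eta'.
Proof.
by rewrite kdenE; apply: int_ge0 => tau; apply: int_ge0 => v; rewrite lee_fin kint_ge0.
Qed.

Lemma kden_int eta (g : d.-tuple R -> R) : measurable_fun setT g -> (forall x, 0 <= g x)%R ->
  \int[lebK R d]_x (kden X Z y a b eta x * (g x)%:E) =
  \int[lebK R r]_tau ((tau_cond a b eta tau)%:E *
     \int[lebK R n]_v ((v_cond X Z y eta v)%:E * \int[lebK R d]_x (g x * mvn tau v x)%:E)).
Proof.
move=> mg g0.
have k0 x tau v : 0 <= (kint eta x tau v)%:E by rewrite lee_fin kint_ge0.
have mk2 x : measurable_fun setT (fun tau => \int[lebK R n]_v (kint eta x tau v)%:E).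
  apply: measurable_int2 => //.
  by apply/measurable_EFinP; apply: measurable_kint.
transitivity (\int[lebK R d]_x \int[lebK R r]_tau \int[lebK R n]_v (g x * kint eta x tau v)%:E).
  apply: eq_integral => x _; rewrite kdenE -intZr ?lee_fin//; last first.
    by move=> tau; apply: int_ge0.
  apply: eq_integral => tau _; rewrite -intZr ?lee_fin//; last first.
    by apply/measurable_EFinP; apply: measurable_kint.
  by apply: eq_integral => v _; rewrite EFinM muleC.
rewrite (@fubini3 _ _ _ (d.-tuple R) (r.-tuple R) (n.-tuple R) R _ _ _ (fun x tau v => (g x * kint eta x tau v)%:E)).
- apply: eq_integral => tau _.
  rewrite -intZl ?lee_fin ?tau_cond_ge0//; last 2 first.
  + apply: emeasurable_funM; first by apply/measurable_EFinP; exact: measurable_v_cond.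
    apply: (@measurable_int2 _ (n.-tuple R) R _ (d.-tuple R) (lebK R d) (fun v x => (g x * mvn tau v x)%:E)).
      apply/measurable_EFinP; apply: measurable_funM; first by apply: measurableT_comp => //.
      by apply: measurable_mvn.
    by move=> v x; rewrite lee_fin mulr_ge0 ?mvn_upd_ge0.
  + move=> v; rewrite mule_ge0 ?lee_fin ?v_cond_ge0// int_ge0// => x.
    by rewrite lee_fin mulr_ge0 ?mvn_upd_ge0.
  apply: eq_integral => v _; rewrite muleA -EFinM -intZl.
  + by apply: eq_integral => x _; rewrite -EFinM /kint; congr _%:E; ring.
  + by rewrite lee_fin mulr_ge0 ?v_cond_ge0 ?tau_cond_ge0.
  + apply/measurable_EFinP; apply: measurable_funM => //.
    by apply: measurable_mvn.
  + by move=> x; rewrite lee_fin mulr_ge0 ?mvn_upd_ge0.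
- apply/measurable_EFinP; apply: measurable_funM.
    by apply: (measurableT_comp mg); apply: measurableT_comp.
  apply: measurable_kint => //.
  + by do 1 apply: measurableT_comp.
  + by do 1 apply: measurableT_comp.
- by move=> x tau v; rewrite lee_fin mulr_ge0 ?kint_ge0.
Qed.

End Model.

Section Model3.
Variables (R : realType) (n p r : nat) (qj : 'I_r -> nat).
Local Notation q := (qsum qj).
Local Notation d := (p + q)%N.
Variables (X : 'M[R]_(n, p)) (Z : 'M[R]_(n, q)) (y : 'I_n -> bool) (a b : 'I_r -> R).
Notation W := (W X Z).
Notation Sigma := (Sigma X Z).
Notation lin := (lin X Z).
Hypothesis shp0 : forall j, 0 < tau_shape qj a j.
Hypothesis rkW : \rank W = d.
Notation rate := (tau_rate (p := p) (qj := qj) b).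
Notation shp := (tau_shape qj a).

Definition blk (j : 'I_r) : seq 'I_d := [seq rshift p k | k <- enum (inblk j)].

Lemma blk_uniq j : uniq (blk j).
Proof. by rewrite map_inj_uniq ?enum_uniq//; exact: rshift_inj. Qed.

Lemma usq_blk (eta : d.-tuple R) j : usq eta j = \sum_(i <- blk j) tcol eta i 0 ^+ 2.
Proof.
rewrite big_map /usq big_enum_cond/=; apply: eq_big => [k|k _]; first by rewrite andbT.
by rewrite mxE.
Qed.

Definition off (j : 'I_r) : nat := (\sum_(l < r | (l < j)%N) qj l)%N.
Lemma offS (j : 'I_r) : (\sum_(l < r | (l <= j)%N) qj l = off j + qj j)%N.
Proof.
rewrite (bigD1 j)//= addnC; congr (_ + _)%N; apply: eq_bigl => l.
by rewrite ltn_neqAle andbC.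
Qed.

Lemma off_le (j l : 'I_r) : (j < l)%N -> (off j + qj j <= off l)%N.
Proof.
clear rkW; move=> jl; rewrite -offS /off [leqRHS](bigID (fun i : 'I_r => (i <= j)%N))/=.
apply: leq_trans (leq_addr _ _); rewrite leq_eqVlt; apply/orP; left; apply/eqP.
by apply: eq_bigl => i; case: (leqP i j) => // h; rewrite ?andbF ?andbT ?(leq_ltn_trans h jl).
Qed.

Lemma off_q (j : 'I_r) : (off j + qj j <= q)%N.
Proof. by rewrite -offS /qsum [leqRHS](bigID (fun i : 'I_r => (i <= j)%N))/= leq_addr. Qed.

Lemma inblkE (j : 'I_r) (k : 'I_q) : inblk j k = (off j <= k < off j + qj j)%N.
Proof. by rewrite /inblk offS. Qed.

Lemma inblk_disj (j l : 'I_r) (k : 'I_q) : inblk j k -> inblk l k -> j = l.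
Proof.
clear rkW; rewrite !inblkE => /andP[j1 j2] /andP[l1 l2]; apply/val_inj => /=.
case: (ltngtP j l) => // h; have := off_le h; move: j1 j2 l1 l2; lia.
Qed.

Lemma size_blk j : size (blk j) = qj j.
Proof.
clear rkW; rewrite size_map -cardE.
rewrite -sum1_card.
rewrite (eq_bigl (fun k : 'I_q => (off j <= k < off j + qj j)%N)); last first.
  by move=> k; rewrite -inblkE.
have h1 : (off j <= off j + qj j)%N by exact: leq_addr.
have h2 := off_q j.
rewrite -(big_mkord (fun k => (off j <= k < off j + qj j)%N) (fun=> 1%N)).
rewrite (@big_cat_nat _ _ _ (off j)) ?(leq_trans h1 h2)//= (@big_cat_nat _ _ _ (off j + qj j) (off j))//=.
rewrite [X in (X + _)%N]big_nat_cond big1 ?add0n; last by move=> k; lia.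
have -> : (\sum_(off j + qj j <= i < q | (off j <= i < off j + qj j)%N) 1 = 0)%N.
  by rewrite big_nat_cond big1// => k; lia.
rewrite addn0.
rewrite big_nat_cond (eq_bigl (fun k => (off j <= k < off j + qj j)%N)); last by move=> k; rewrite andbb.
by rewrite -big_nat sum_nat_const_nat muln1 addKn.
Qed.

Lemma sum_inblk (j : 'I_r) (k : 'I_q) (f : 'I_r -> R) : inblk j k ->
  \sum_(l < r | inblk l k) f l = f j.
Proof.
move=> jk; rewrite (bigD1 j)//= big1 ?addr0// => l /andP[lk lj].
by rewrite (inblk_disj jk lk) eqxx in lj.
Qed.

Definition nsq k (v : 'cV[R]_k) : R := \sum_i v i 0 ^+ 2.

Lemma nsqE k (v : 'cV[R]_k) : nsq v = (v^T *m v) 0 0.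
Proof. by rewrite mxE; apply: eq_bigr => i _; rewrite mxE expr2. Qed.

Lemma nsq_ge0 k (v : 'cV[R]_k) : 0 <= nsq v.
Proof. by apply: sumr_ge0 => i _; exact: sqr_ge0. Qed.

Lemma measurable_nsq k : measurable_fun setT (fun v : k.-tuple R => nsq (tcol v)).
Proof.
by apply: measurable_sum => i; apply: measurable_funX; exact: measurable_tcol.
Qed.

Lemma nsq_eq0 k (v : 'cV[R]_k) : nsq v = 0 -> v = 0.
Proof.
move=> /eqP; rewrite psumr_eq0; last by move=> i _; exact: sqr_ge0.
move=> /allP h; apply/matrixP => i j; rewrite ord1 mxE.
by have := h i (mem_index_enum _); rewrite sqrf_eq0 => /eqP.
Qed.

Lemma WV : pinvmx W *m W = 1%:M.
Proof. by apply: mulVpmx; rewrite /row_full rkW. Qed.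

Lemma Wx0 (x : 'cV[R]_d) : W *m x = 0 -> x = 0.
Proof. by move=> h; rewrite -[x]mul1mx -WV -mulmxA h mulmx0. Qed.

Lemma qf_Sigma (tau : r.-tuple R) (x : 'cV[R]_d) :
  qf (Sigma tau) x = nsq (W *m x) + \sum_j tnth tau j * \sum_(i <- blk j) x i 0 ^+ 2.
Proof.
rewrite /Sigma /qf mulmxDr mulmxDl mxE; congr (_ + _).
  by rewrite nsqE trmx_mul !mulmxA.
rewrite -[x]vsubmxK; set x1 := usubmx x; set x2 := dsubmx x.
rewrite tr_col_mx mul_row_block mul_row_col !mulmx0 !addr0 !add0r mul0mx add0r.
transitivity (\sum_k \sum_(j < r | inblk j k) tnth tau j * x2 k 0 ^+ 2).
  rewrite -/(qf (Dmx qj tau) x2) qfE; apply: eq_bigr => k _.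
  rewrite (bigD1 k)//= big1 ?addr0 => [|l lk].
    by rewrite [Dmx _ _ _ _]mxE eqxx mul1r mulrAC -expr2 mulrC mulr_suml.
  by rewrite [Dmx _ _ _ _]mxE eq_sym (negbTE lk) mul0r mulr0 mul0r.
rewrite (exchange_big_dep xpredT)//=; apply: eq_bigr => j _.
rewrite big_map big_enum_cond/= mulr_sumr; apply: eq_big => [k|k _]; first by rewrite andbT.
by rewrite col_mxEd.
Qed.

Lemma Sigma_sym tau : (Sigma tau)^T = Sigma tau.
Proof.
rewrite /Sigma trmxD trmx_mul trmxK tr_block_mx !trmx0; congr (_ + block_mx _ _ _ _).
by apply/matrixP => i j; rewrite !mxE eq_sym; have [->|] := eqVneq i j; rewrite ?mul0r.
Qed.

Definition tpos (tau : r.-tuple R) : bool := [forall j, 0 < tnth tau j].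

Lemma Sigma_posdef tau : tpos tau -> posdef (Sigma tau).
Proof.
move=> /forallP t0; split; first exact: Sigma_sym.
move=> x x0; rewrite qf_Sigma; apply: ltr_pwDl.
  rewrite lt_neqAle nsq_ge0 andbT eq_sym; apply: contra x0 => /eqP /nsq_eq0 /Wx0 ->//.
apply: sumr_ge0 => j _; apply: mulr_ge0; first exact/ltW/t0.
by apply: sumr_ge0 => i _; exact: sqr_ge0.
Qed.

Lemma usq_qf (eta : d.-tuple R) tau :
  qf (Sigma tau) (tcol eta) = nsq (W *m tcol eta) + \sum_j tnth tau j * usq eta j.
Proof. by rewrite qf_Sigma; congr (_ + _); apply: eq_bigr => j _; rewrite usq_blk. Qed.

Lemma tau_cond_npos (eta : d.-tuple R) tau : ~~ tpos tau -> tau_cond a b eta tau = 0.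
Proof.
rewrite negb_forall => /existsP[j]; rewrite -leNgt => h.
by rewrite tau_condE// (bigD1 j)//= tc_neg ?mul0r.
Qed.

Lemma likE eta : lik X Z y eta = \prod_(i < n) ZT (y i) (lin eta i).
Proof.
apply: eq_bigr => i _; case: (y i); first exact: Phi_ZT.
by rewrite Phi_ZT -(ZT_sum (lin eta i)) addrC addKr.
Qed.

Definition cpi (j : 'I_r) : R := (2 * pi) `^ (- ((qj j)%:R / 2)).

Lemma prior_utE (eta : d.-tuple R) tau :
  prior_u_tau a b eta tau = \prod_(j < r) (cpi j * gamma_un (shp j) (rate eta j) (tnth tau j)).
Proof.
apply: eq_bigr => j _; rewrite /gamma_un; case: ifP => t0; last by rewrite mulr0.
have p0 : 0 < 2 * pi :> R by rewrite mulr_gt0 ?pi_gt0.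
set t := tnth tau j in t0 *; have tn : t != 0 by rewrite gt_eqF.
rewrite powRM ?(ltW t0) ?invr_ge0 ?(ltW p0)//.
rewrite -[(2 * pi)^-1]powR_inv1 ?(ltW p0)// -powRrM mulN1r -/(cpi j).
have -> : shp j - 1 = (a j - 1) + (qj j)%:R / 2 by rewrite /tau_shape; ring.
rewrite [t `^ (a j - 1 + _)]powRD ?tn ?implybT//.
rewrite /tau_rate (_ : - ((b j + usq eta j / 2) * t) = - (b j * t) + - (t * usq eta j) / 2); last by field.
by rewrite expRD; ring.
Qed.

Definition good (eta : d.-tuple R) : bool := [forall j, 0 < rate eta j].

(* Unnormalized posterior density of [eta], from integrating out [tau]. Where a rate is [0] this integral is
   infinite, but [0 `^ (- s) = 0] makes [marg] vanish; these points are null. *)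
Definition marg (eta : d.-tuple R) : R :=
  lik X Z y eta * \prod_(j < r) (cpi j * (Gam (shp j) * rate eta j `^ (- shp j))).

Lemma marg_cond eta tau : good eta ->
  marg eta * tau_cond a b eta tau = post_un X Z y a b eta tau.
Proof.
move=> /forallP g; rewrite /marg /post_un tau_condE// prior_utE -mulrA; congr (_ * _).
rewrite -big_split/=; apply: eq_bigr => j _; rewrite /tau_pdf g.
have G0 := Gam_gt0 (shp0 j); have r0 := powR_gt0 (- shp j) (g j).
move: (Gam _) (rate eta j `^ _) G0 r0 => A B A0 B0.
by field; rewrite !gt_eqF.
Qed.

Lemma marg_int eta : good eta ->
  (\int[lebK R r]_tau (post_un X Z y a b eta tau)%:E = (marg eta)%:E)%E.
Proof.
move=> g; have l0 : 0 <= marg eta.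
  rewrite /marg likE mulr_ge0// prodr_ge0// => i _; first exact: ZT_ge0.
  by rewrite mulr_ge0 ?powR_ge0// mulr_ge0 ?powR_ge0// ltW// Gam_gt0.
under eq_integral => tau _ do rewrite -marg_cond// EFinM.
rewrite intZl ?lee_fin//; last 2 first.
- by apply/measurable_EFinP; apply: measurable_tau_cond.
- by move=> tau; rewrite lee_fin tau_cond_ge0.
under eq_integral => tau _ do rewrite tau_condE//.
rewrite lebK_prod_one ?mule1//.
- by move=> j; apply: measurable_tc2.
- by move=> j t; exact: tc_ge0.
- by move=> j; exact: tc_mass.
Qed.

(* What remains of the joint density of [(eta, tau, v)] once the normal density of [eta] is factored out. *)
Definition joint_rest (tau : r.-tuple R) (v : n.-tuple R) : R :=
  \prod_(i < n) tnI (y i) (tnth v i) *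
  (\prod_(j < r) (cpi j * ((tnth tau j) `^ (shp j - 1) * expR (- (b j * tnth tau j))))) *
  expR (- (nsq (tcol v) - qf (Sigma tau) (invmx (Sigma tau) *m (W^T *m tcol v))) / 2)
  / Num.sqrt (2 * pi) ^+ n * (Num.sqrt (2 * pi) ^+ d / Num.sqrt (\det (Sigma tau))).

Lemma joint_factor eta tau v : tpos tau ->
  post_un X Z y a b eta tau * v_cond X Z y eta v = joint_rest tau v * mvn X Z tau v eta.
Proof.
move=> tp; have pS := Sigma_posdef tp; have dS := posdef_det pS.
have uS := posdef_unit pS.
have -> : post_un X Z y a b eta tau * v_cond X Z y eta v =
  \prod_(i < n) (tnI (y i) (tnth v i) * phi (tnth v i - lin eta i)) * prior_u_tau a b eta tau.
  rewrite /post_un likE v_condE mulrAC -big_split/=; congr (_ * _); apply: eq_bigr => i _.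
  by have Z0 := ZT_gt0 (y i) (lin eta i); field; rewrite gt_eqF.
set m := invmx (Sigma tau) *m (W^T *m tcol v).
have Sm : Sigma tau *m m = W^T *m tcol v by rewrite /m mulKVmx.
have key : \sum_(i < n) (tnth v i - lin eta i) ^+ 2 + \sum_j tnth tau j * usq eta j =
    qf (Sigma tau) (tcol eta - m) + (nsq (tcol v) - qf (Sigma tau) m).
  rewrite qfD ?Sigma_sym// -scaleN1r qfZ expr2 mulrNN !mulr1 mul1r usq_qf.
  have -> : ((tcol eta)^T *m Sigma tau *m (-1 *: m)) 0 0 = - \sum_i tnth v i * lin eta i.
    rewrite -scalemxAr mxE mulN1r -mulmxA Sm mulmxA -trmx_mul mxE; congr (- _).
    by apply: eq_bigr => i _; rewrite [(W *m tcol eta)^T _ _]mxE [tcol v _ _]mxE mulrC.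
  rewrite (_ : nsq (W *m tcol eta) = \sum_i lin eta i ^+ 2)//.
  have -> : nsq (tcol v) = \sum_i tnth v i ^+ 2 by apply: eq_bigr => i _; rewrite mxE.
  have -> : \sum_(i < n) (tnth v i - lin eta i) ^+ 2 =
    \sum_i tnth v i ^+ 2 + \sum_i lin eta i ^+ 2 - 2 * \sum_i tnth v i * lin eta i.
    rewrite mulr_sumr -big_split/= -sumrB; apply: eq_bigr => i _.
    by ring.
  ring.
rewrite big_split/= /phi big_split/= -expR_sum prior_utE prodr_const card_ord.
have -> : \prod_(j < r) (cpi j * gamma_un (shp j) (rate eta j) (tnth tau j)) =
  (\prod_(j < r) (cpi j * ((tnth tau j) `^ (shp j - 1) * expR (- (b j * tnth tau j))))) *
  expR (- (\sum_j tnth tau j * usq eta j) / 2).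
  rewrite mulNr mulr_suml -sumrN expR_sum -big_split/=; apply: eq_bigr => j _.
  move/forallP: tp => /(_ j) tj; rewrite /gamma_un tj.
  rewrite (_ : - (rate eta j * tnth tau j) = - (b j * tnth tau j) + - (tnth tau j * usq eta j / 2)).
    by rewrite expRD; ring.
  by rewrite /tau_rate; field.
have -> : \sum_(i < n) - (tnth v i - lin eta i) ^+ 2 / 2 = - (\sum_(i < n) (tnth v i - lin eta i) ^+ 2) / 2.
  by rewrite mulNr mulr_suml -sumrN; apply: eq_bigr => i _; rewrite mulNr.
rewrite /mvn mvn_pdfE -/m /joint_rest -/m.
set I := \prod_(i < n) tnI _ _; set P := \prod_(j < r) _.
have E : expR (- (\sum_(i < n) (tnth v i - lin eta i) ^+ 2) / 2) * expR (- (\sum_j tnth tau j * usq eta j) / 2)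
   = expR (- (nsq (tcol v) - qf (Sigma tau) m) / 2) * expR (- qf (Sigma tau) (tcol eta - m) / 2).
  by rewrite -!expRD; congr expR; lra.
have p0 := s2pi_gt0 R; have D0 : 0 < Num.sqrt (\det (Sigma tau)) by rewrite sqrtr_gt0.
rewrite exprVn.
have pd : Num.sqrt (2 * pi) ^+ d != 0 :> R by rewrite expf_neq0// gt_eqF.
have pn : Num.sqrt (2 * pi) ^+ n != 0 :> R by rewrite expf_neq0// gt_eqF.
move: (Num.sqrt (2 * pi) ^+ d) (Num.sqrt (2 * pi) ^+ n) pd pn (Num.sqrt (\det _)) D0 => sd sn sd0 sn0 D D0.
transitivity (I * P * sn^-1 * (expR (- (\sum_(i < n) (tnth v i - lin eta i) ^+ 2) / 2) * expR (- (\sum_j tnth tau j * usq eta j) / 2))).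
  by ring.
rewrite E; field; rewrite sd0 sn0 gt_eqF//.
Qed.

Lemma marg_ge0 eta : 0 <= marg eta.
Proof.
rewrite /marg likE mulr_ge0// prodr_ge0// => i _; first exact: ZT_ge0.
by rewrite mulr_ge0 ?powR_ge0// mulr_ge0 ?powR_ge0// ltW// Gam_gt0.
Qed.

Lemma marg_gt0 eta : good eta -> 0 < marg eta.
Proof.
move=> /forallP g; rewrite /marg likE mulr_gt0// prodr_gt0// => i _; first exact: ZT_gt0.
by rewrite mulr_gt0 ?powR_gt0 ?mulr_gt0 ?pi_gt0 ?Gam_gt0 ?powR_gt0.
Qed.

(* Given [(tau, v)], the old and the new [eta] are independent with the same normal density. *)
Lemma reversible eta eta' : good eta -> good eta' ->
  ((marg eta)%:E * kden X Z y a b eta eta' = (marg eta')%:E * kden X Z y a b eta' eta)%E.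
Proof.
have H x x' : good x -> ((marg x)%:E * kden X Z y a b x x' =
   \int[lebK R r]_tau \int[lebK R n]_v (if tpos tau then joint_rest tau v * mvn X Z tau v x * mvn X Z tau v x' else 0)%:E)%E.
  move=> g; rewrite kdenE//.
  have m0 := marg_ge0 x.
  have k0 tau v : (0 <= (kint X Z y a b x x' tau v)%:E)%E by rewrite lee_fin kint_ge0.
  rewrite -intZl ?lee_fin//; last 2 first.
  - by apply: measurable_int2 => //; apply/measurable_EFinP; apply: measurable_kint.
  - by move=> tau; apply: int_ge0.
  apply: eq_integral => tau _; rewrite -intZl ?lee_fin//; last first.
    by apply/measurable_EFinP; apply: measurable_kint.
  apply: eq_integral => v _; rewrite -EFinM; congr _%:E; rewrite /kint.
  case: ifPn => tp; last by rewrite tau_cond_npos// !mul0r mulr0.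
  rewrite mulrA [X in X * _ = _]mulrA marg_cond// joint_factor//.
move=> g g'; rewrite (H _ _ g) (H _ _ g').
apply: eq_integral => tau _; apply: eq_integral => v _.
move: (mvn X Z tau v eta) (mvn X Z tau v eta') (joint_rest tau v) => A B C.
by rewrite mulrAC.
Qed.

Lemma v_mass eta : (\int[lebK R n]_v (v_cond X Z y eta v)%:E = 1)%E.
Proof.
rewrite /v_cond (lebK_prod_one (f := fun i => tn_pdf (lin eta i) (y i)))//.
- by move=> i; exact: measurable_tn_pdf.
- by move=> i x; exact: tn_pdf_ge0.
- by move=> i; exact: tn_mass.
Qed.

Lemma tau_mass (eta : d.-tuple R) : (\int[lebK R r]_tau (tau_cond a b eta tau)%:E = 1)%E.
Proof.
under eq_integral => tau _ do rewrite tau_condE//.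
rewrite lebK_prod_one//.
- by move=> j; apply: measurable_tc2.
- by move=> j t; exact: tc_ge0.
- by move=> j; exact: tc_mass.
Qed.

Lemma kden_mass eta : (\int[lebK R d]_x kden X Z y a b eta x = 1)%E.
Proof.
transitivity (\int[lebK R d]_x (kden X Z y a b eta x * (cst 1 x : R)%:E))%E.
  by apply: eq_integral => x _; rewrite mule1.
rewrite kden_int// -(tau_mass eta); apply: eq_integral => tau _.
have [tp|tp] := boolP (tpos tau); last by rewrite tau_cond_npos// mul0e.
rewrite -[RHS]mule1 -(v_mass eta); congr (_ * _)%E; apply: eq_integral => v _.
rewrite -[RHS]mule1; congr (_ * _)%E.
under eq_integral do rewrite mul1r.
exact: (mvn_mass _ (Sigma_posdef tp)).
Qed.

End Model3.

(** * Drift *)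

Section NegMoment.
Variable R : realType.
Notation leb := (@lebesgue_measure R).

Lemma powR_neg_le_gamma (c w : R) : 0 < c -> 0 <= w ->
  ((w `^ (- c))%:E <= (2 `^ (- c) / Gam c)%:E * \int[leb]_t (gamma_un c (w / 2) t)%:E)%E.
Proof.
move=> c0 w0; have G0 := Gam_gt0 c0.
have C0 : 0 <= 2 `^ (- c) / Gam c :> R by rewrite divr_ge0 ?powR_ge0// ltW.
move: w0; rewrite le0r => /orP[/eqP->|w0].
  rewrite powR0; last by rewrite oppr_eq0 gt_eqF.
  rewrite mule_ge0 ?lee_fin//; apply: int_ge0 => t; rewrite lee_fin gamma_un_ge0//.
rewrite gamma_int ?divr_gt0// -EFinM lee_fin.
rewrite [X in _ * (_ * X)]powRM ?invr_ge0 ?(ltW w0)//.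
rewrite -[2^-1]powR_inv1// -powRrM mulN1r opprK !powRN.
have p0 : 0 < 2 `^ c :> R by rewrite powR_gt0.
have wc0 := powR_gt0 c w0.
rewrite le_eqVlt; apply/orP; left; apply/eqP; field; rewrite !gt_eqF//.
Qed.

Lemma prod_sqrt_powR (s : nat) (z : R) : 0 < z -> (Num.sqrt z)^-1 ^+ s = z `^ (- (s%:R / 2)).
Proof.
move=> z0; rewrite -powR12_sqrt ?(ltW z0)// -powRN -powR_mulrn ?powR_ge0// -powRrM.
by congr (_ `^ _); field.
Qed.

(* [w ^ -c] is a Gamma mixture of the exponentials [e^(-t w / 2)], to which [mvn_laplace] applies. *)
Lemma mvn_negmom k (S : 'M[R]_k) (m : 'cV[R]_k) (s : seq 'I_k) (c Lm : R) :
  posdef S -> uniq s -> 0 < c -> c < (size s)%:R / 2 -> 0 < Lm ->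
  (forall i, i \in s -> S i i <= Lm) ->
  (\int[lebK R k]_x ((\sum_(i <- s) tcol x i 0 ^+ 2) `^ (- c) * mvn_pdf S m (tcol x))%:E <=
   (Lm `^ c * (2 `^ (- c) * Gam ((size s)%:R / 2 - c) / Gam ((size s)%:R / 2)))%:E)%E.
Proof.
move=> pS us c0 ch L0 SL; set h := (size s)%:R / 2; pose w (x : k.-tuple R) := \sum_(i <- s) tcol x i 0 ^+ 2.
have w0 x : 0 <= w x by apply: sumr_ge0 => i _; exact: sqr_ge0.
have mw : measurable_fun setT w.
  by apply: measurable_sum => i; apply: measurable_funX; exact: measurable_tcol.
have G0 := Gam_gt0 c0.
have C0 : 0 <= 2 `^ (- c) / Gam c :> R by rewrite divr_ge0 ?powR_ge0// ltW.
have mM := mvn_meas S m.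
have M0 x : 0 <= mvn_pdf S m (tcol x) by exact: mvn_ge0.
have mwt : measurable_fun setT (fun z : k.-tuple R * R => w z.1).
  exact: (measurableT_comp mw).
have mMt : measurable_fun setT (fun z : k.-tuple R * R => mvn_pdf S m (tcol z.1)).
  exact: (measurableT_comp mM).
have mg : measurable_fun setT (fun z : k.-tuple R * R => gamma_un c (w z.1 / 2) z.2).
  by rewrite /gamma_un; meas; exact: measurable_snd.
have mF : measurable_fun setT (fun z : k.-tuple R * R => (gamma_un c (w z.1 / 2) z.2 * mvn_pdf S m (tcol z.1))%:E).
  by meas.
have F0 x t : (0 <= (gamma_un c (w x / 2) t * mvn_pdf S m (tcol x))%:E)%E.
  by rewrite lee_fin mulr_ge0// gamma_un_ge0.
have mI := @measurable_int2 _ _ _ _ _ leb (fun x t => (gamma_un c (w x / 2) t * mvn_pdf S m (tcol x))%:E) mF F0.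
apply: (@le_trans _ _ ((2 `^ (- c) / Gam c)%:E * \int[lebK R k]_x \int[leb]_t (gamma_un c (w x / 2) t * mvn_pdf S m (tcol x))%:E)%E).
  rewrite -intZl ?lee_fin//; last by move=> x; apply: int_ge0.
  apply: int_le => //.
    by move=> x; rewrite lee_fin mulr_ge0// powR_ge0.
  move=> x; rewrite EFinM.
  under [X in (_ <= _ * X)%E]eq_integral do rewrite EFinM.
  rewrite intZr ?lee_fin//; last 2 first.
  - by apply/measurable_EFinP; exact: measurable_gamma_un.
  - by move=> t; rewrite lee_fin gamma_un_ge0.
  rewrite muleA; apply: lee_wpmul2r; first by rewrite lee_fin.
  exact: (powR_neg_le_gamma c0 (w0 x)).
rewrite (@fubini_tonelli _ _ (k.-tuple R) (measurableTypeR R) R (lebK R k) leb (fun z => (gamma_un c (w z.1 / 2) z.2 * mvn_pdf S m (tcol z.1))%:E))//=.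
have mb : measurable_fun setT (fun t : R => if 0 < t then t `^ (c - 1) * (1 + t / Lm) `^ (- h) else 0) by meas.
apply: (@le_trans _ _ ((2 `^ (- c) / Gam c)%:E * \int[leb]_t (if 0 < t then t `^ (c - 1) * (1 + t / Lm) `^ (- h) else 0)%:E)%E).
  apply: lee_wpmul2l; first by rewrite lee_fin.
  apply: int_le => //.
  - apply: (@measurable_int2 _ _ _ _ _ (lebK R k) (fun (t : R) x => (gamma_un c (w x / 2) t * mvn_pdf S m (tcol x))%:E)) => //.
    apply: (measurableT_comp mF (_ : measurable_fun setT (fun z : measurableTypeR R * k.-tuple R => (z.2, z.1)))).
    exact: measurable_fun_pair.
  - by move=> t; apply: int_ge0.
  move=> t; rewrite /gamma_un; case: ifPn => t0; last first.
    by under eq_integral do rewrite mul0r; rewrite integral0.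
  have mE : measurable_fun setT (fun x : k.-tuple R => expR (- (t * w x) / 2) * mvn_pdf S m (tcol x)) by meas.
  have E0 x : 0 <= expR (- (t * w x) / 2) * mvn_pdf S m (tcol x) by rewrite mulr_ge0 ?expR_ge0.
  apply: (@le_trans _ _ ((t `^ (c - 1))%:E * \int[lebK R k]_x (expR (- (t * w x) / 2) * mvn_pdf S m (tcol x))%:E)%E).
    rewrite le_eqVlt; apply/orP; left; apply/eqP; rewrite -intZl ?lee_fin ?powR_ge0//.
    apply: eq_integral => x _; rewrite (_ : - (w x / 2 * t) = - (t * w x) / 2); last by field.
    by rewrite -EFinM; congr EFin; exact: (esym (mulrA _ _ _)).
  rewrite EFinM; apply: lee_wpmul2l; first by rewrite lee_fin powR_ge0.
  apply: (le_trans (mvn_laplace m pS us (ltW t0))); rewrite lee_fin.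
  rewrite /h -prod_sqrt_powR; last by rewrite addr_gt0// divr_gt0.
  rewrite -/h [leRHS](_ : _ = \prod_(i <- s) (Num.sqrt (1 + t / Lm))^-1); last first.
    by rewrite big_const_seq count_predT -Monoid.iteropE.
  rewrite !big_seq; apply: ler_prod => i si; rewrite invr_ge0 sqrtr_ge0/=.
  have Si := posdef_diag i pS.
  rewrite lef_pV2 ?posrE ?sqrtr_gt0 ?addr_gt0 ?divr_gt0// ler_sqrt ?addr_ge0// ?divr_ge0// ?(ltW t0) ?(ltW Si)//.
  by rewrite lerD2l ler_pM2l// lef_pV2 ?posrE// SL.
rewrite beta_int//.
have Gh0 := Gam_gt0 (lt_trans c0 ch).
rewrite -EFinM lee_fin -/h; move: (Gam c) (Gam h) (Gam (h - c)) (Lm `^ c) (2 `^ (- c)) G0 Gh0 => g1 g2 g3 l w2 g10 g20.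
by rewrite le_eqVlt; apply/orP; left; apply/eqP; field; rewrite !gt_eqF.
Qed.

End NegMoment.

Section Drift.
Variables (R : realType) (n p r : nat) (qj : 'I_r -> nat).
Local Notation q := (qsum qj).
Local Notation d := (p + q)%N.
Variables (X : 'M[R]_(n, p)) (Z : 'M[R]_(n, q)) (y : 'I_n -> bool) (a b : 'I_r -> R).
Notation leb := (@lebesgue_measure R).
Notation W := (W X Z).
Notation lin := (lin X Z).
Hypothesis shp0 : forall j, 0 < tau_shape qj a j.
Hypothesis rkW : \rank W = d.
Notation tc := (tau_pdf (p := p) (qj := qj) a b).

Lemma measurable_mvn_int (g : d.-tuple R -> R) : measurable_fun setT g -> (forall x, 0 <= g x) ->
  measurable_fun setT (fun z : r.-tuple R * n.-tuple R => (\int[lebK R d]_x (g x * mvn X Z z.1 z.2 x)%:E)%E).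
Proof.
move=> mg g0.
apply: (@measurable_int2 _ _ _ _ _ (lebK R d) (fun (z : r.-tuple R * n.-tuple R) x => (g x * mvn X Z z.1 z.2 x)%:E)).
  apply/measurable_EFinP; apply: measurable_funM; first exact: (measurableT_comp mg).
  by apply: measurable_mvn => //; apply: measurableT_comp.
by move=> z x; rewrite lee_fin mulr_ge0// mvn_upd_ge0.
Qed.

Lemma kden_le eta (g : d.-tuple R -> R) (h : r.-tuple R -> n.-tuple R -> R) :
  measurable_fun setT g -> (forall x, 0 <= g x) ->
  measurable_fun setT (fun z : r.-tuple R * n.-tuple R => h z.1 z.2) -> (forall tau v, 0 <= h tau v) ->
  (forall tau v, tpos tau -> (\int[lebK R d]_x (g x * mvn X Z tau v x)%:E <= (h tau v)%:E)%E) ->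
  (\int[lebK R d]_x (kden X Z y a b eta x * (g x)%:E) <= \int[lebK R r]_tau
    ((tau_cond a b eta tau)%:E * \int[lebK R n]_v ((v_cond X Z y eta v)%:E * (h tau v)%:E)))%E.
Proof.
move=> mg g0 mh h0 H; rewrite kden_int//.
have mI := measurable_mvn_int mg g0.
have I0 tau v : (0 <= \int[lebK R d]_x (g x * mvn X Z tau v x)%:E)%E.
  by apply: int_ge0 => x; rewrite lee_fin mulr_ge0// mvn_upd_ge0.
have v0 v : (0 <= (v_cond X Z y eta v)%:E)%E by rewrite lee_fin v_cond_ge0.
have t0 tau : (0 <= (tau_cond a b eta tau)%:E)%E by rewrite lee_fin tau_cond_ge0.
have mv : measurable_fun setT (fun v => (v_cond X Z y eta v)%:E).
  by apply/measurable_EFinP; exact: measurable_v_cond.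
have mt : measurable_fun setT (fun tau => (tau_cond a b eta tau)%:E).
  by apply/measurable_EFinP; exact: measurable_tau_cond.
have mhE : measurable_fun setT (fun z : r.-tuple R * n.-tuple R => (h z.1 z.2)%:E).
  exact/measurable_EFinP.
have mint (F : r.-tuple R -> n.-tuple R -> \bar R) :
    measurable_fun setT (fun z : r.-tuple R * n.-tuple R => F z.1 z.2) -> (forall tau v, 0 <= F tau v)%E ->
    measurable_fun setT (fun tau => (\int[lebK R n]_v ((v_cond X Z y eta v)%:E * F tau v))%E).
  move=> mF F0; apply: (@measurable_int2 _ _ _ _ _ (lebK R n) (fun tau v => ((v_cond X Z y eta v)%:E * F tau v)%E)) => [|tau v].
    by apply: emeasurable_funM => //; exact: (measurableT_comp mv).
  by rewrite mule_ge0.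
have mI2 := mint _ mI I0; have hE0 tau v : (0 <= (h tau v)%:E)%E by rewrite lee_fin.
have mh2 := mint (fun tau v => (h tau v)%:E) mhE hE0.
apply: int_le => //.
  by move=> tau; rewrite mule_ge0// int_ge0// => v; rewrite mule_ge0.
move=> tau; have [tp|tp] := boolP (tpos tau); last by rewrite tau_cond_npos// !mul0e.
have mI1 := measurableT_comp mI (measurable_pair1 tau).
have mh1 := measurableT_comp mhE (measurable_pair1 tau).
apply: lee_wpmul2l => //; apply: int_le => //.
  by move=> v; rewrite mule_ge0.
by move=> v; apply: lee_wpmul2l => //; exact: H.
Qed.

Lemma kden_le_tau eta (g : d.-tuple R -> R) (f : R -> R) (j : 'I_r) :
  measurable_fun setT g -> (forall x, 0 <= g x) ->
  measurable_fun setT f -> (forall x, 0 <= f x) ->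
  (forall tau v, tpos tau -> (\int[lebK R d]_x (g x * mvn X Z tau v x)%:E <= (f (tnth tau j))%:E)%E) ->
  (\int[lebK R d]_x (kden X Z y a b eta x * (g x)%:E) <= \int[leb]_t (f t * tc eta j t)%:E)%E.
Proof.
move=> mg g0 mf f0 H.
have mf' : measurable_fun setT (fun z : r.-tuple R * n.-tuple R => f (tnth z.1 j)).
  by apply: (measurableT_comp mf); exact: (measurableT_comp (measurable_tnth j)).
apply: (le_trans (kden_le eta mg g0 mf' (fun tau v => f0 _) H)).
rewrite -(lebK_prod_marg (f := tc eta)) => //; last 3 first.
- by move=> i; apply: measurable_tc2.
- by move=> i x; exact: tc_ge0.
- by move=> i; exact: tc_mass.
rewrite le_eqVlt; apply/orP; left; apply/eqP; apply: eq_integral => tau _.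
rewrite -tau_condE// mulrC EFinM intZr ?v_mass ?mul1e ?lee_fin//.
  by apply/measurable_EFinP; exact: measurable_v_cond.
by move=> v; rewrite lee_fin v_cond_ge0.
Qed.

Lemma kden_le_v eta (g : d.-tuple R -> R) (A C : R) :
  measurable_fun setT g -> (forall x, 0 <= g x) -> 0 <= A -> 0 <= C ->
  (forall tau v, tpos tau -> (\int[lebK R d]_x (g x * mvn X Z tau v x)%:E <= (A * nsq (tcol v) + C)%:E)%E) ->
  (\int[lebK R d]_x (kden X Z y a b eta x * (g x)%:E) <=
    A%:E * (\sum_(i < n) \int[leb]_x (x ^+ 2 * tn_pdf (lin eta i) (y i) x)%:E) + C%:E)%E.
Proof.
move=> mg g0 A0 C0 H.
pose h (v : n.-tuple R) : R := A * nsq (tcol v) + C.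
have mh2 : measurable_fun setT (fun v : n.-tuple R => nsq (tcol v)) by exact: measurable_nsq.
have mh : measurable_fun setT h by rewrite /h; meas.
have h0 v : 0 <= h v by rewrite addr_ge0// mulr_ge0// nsq_ge0.
have v0 v : (0 <= (v_cond X Z y eta v)%:E)%E by rewrite lee_fin v_cond_ge0.
have mv : measurable_fun setT (fun v => (v_cond X Z y eta v)%:E).
  by apply/measurable_EFinP; exact: measurable_v_cond.
have mh' : measurable_fun setT (fun z : r.-tuple R * n.-tuple R => h z.2).
  exact: (measurableT_comp mh).
apply: (le_trans (kden_le eta mg g0 mh' (fun tau v => h0 _) H)).
set RHS := (X in (_ <= X)%E).
have E : (\int[lebK R n]_v ((v_cond X Z y eta v)%:E * (h v)%:E) = RHS)%E.
  have mterm i : measurable_fun setT (fun v : n.-tuple R => (tnth v i ^+ 2 * v_cond X Z y eta v)%:E).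
    apply/measurable_EFinP; apply: measurable_funM; last exact: measurable_v_cond.
    by apply: measurable_funX; exact: measurable_tnth.
  have term0 i v : (0 <= (tnth v i ^+ 2 * v_cond X Z y eta v)%:E)%E.
    by rewrite lee_fin mulr_ge0 ?sqr_ge0// v_cond_ge0.
  transitivity (\int[lebK R n]_v (A%:E * (\sum_(i < n) (tnth v i ^+ 2 * v_cond X Z y eta v)%:E) + C%:E * (v_cond X Z y eta v)%:E))%E.
    apply: eq_integral => v _; rewrite sumEFin -!EFinM -EFinD; congr EFin.
    rewrite -mulr_suml /h /nsq; under [X in A * X + C]eq_bigr do rewrite mxE.
    by move: (v_cond _ _ _ _ _) => z; ring.
  have ms : measurable_fun setT (fun v : n.-tuple R => \sum_(i < n) (tnth v i ^+ 2 * v_cond X Z y eta v)%:E)%E.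
    exact: emeasurable_sum.
  have s0 v : (0 <= \sum_(i < n) (tnth v i ^+ 2 * v_cond X Z y eta v)%:E)%E by apply: sume_ge0.
  rewrite intD//; last 2 first.
  - by move=> v; rewrite mule_ge0.
  - by move=> v; rewrite mule_ge0.
  rewrite !intZl ?lee_fin// v_mass mule1; congr (_ * _ + _)%E.
  rewrite ge0_integral_sum//; apply: eq_bigr => i _.
  rewrite (lebK_prod_marg (f := fun i => tn_pdf (lin eta i) (y i)) (g := fun x => x ^+ 2))//.
  - by move=> j; exact: measurable_tn_pdf.
  - by move=> j x; exact: tn_pdf_ge0.
  - by move=> j; exact: tn_mass.
  - by move=> x; exact: sqr_ge0.
have RHS0 : (0 <= RHS)%E by rewrite -E; apply: int_ge0 => v; rewrite mule_ge0// lee_fin.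
rewrite le_eqVlt; apply/orP; left; apply/eqP.
under eq_integral do rewrite E.
rewrite intZr ?tau_mass ?mul1e//.
  by apply/measurable_EFinP; exact: measurable_tau_cond.
by move=> tau; rewrite lee_fin tau_cond_ge0.
Qed.

End Drift.

Lemma powR_split (R : realType) (c g lam : R) : 0 < c -> 0 < g -> g < 1 -> 0 <= lam ->
  exists A C : R, [/\ 0 <= A, 0 <= C, A * g < 1 &
    forall t, 0 <= t -> (lam + t) `^ c <= A * t `^ c + C].
Proof.
move=> c0 g0 g1 l0.
have gx (x : R) : g `^ x = expR (x * ln g) by rewrite /powR gt_eqF.
have lg : ln g < 0 by rewrite ln_lt0// g0.
pose D : R := g `^ (- (2 * c)^-1).
have D1 : 1 < D.
  rewrite /D gx -expR0 ltr_expR mulNr oppr_gt0 pmulr_rlt0 ?invr_gt0 ?mulr_gt0//.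
have d0 : 0 < D - 1 by rewrite subr_gt0.
exists (D `^ c), ((lam + lam / (D - 1)) `^ c); split; rewrite ?powR_ge0//.
  rewrite /D -powRrM (_ : - (2 * c)^-1 * c = - 2^-1); last by field; rewrite gt_eqF.
  rewrite -{2}(powRr1 (ltW g0)) -powRD ?(gt_eqF g0) ?implybT//.
  have h2 : 0 < - 2^-1 + 1 :> R by lra.
  by rewrite gx -[ltRHS]expR0 ltr_expR pmulr_rlt0.
move=> t t0.
have [h|h] := leP lam ((D - 1) * t).
  apply: (@le_trans _ _ ((D * t) `^ c)).
    apply: ge0_ler_powR; rewrite ?nnegrE ?(ltW c0)//; first by rewrite addr_ge0.
      by rewrite mulr_ge0// ltW// (lt_trans _ D1).
    lra.
  by rewrite powRM ?(ltW (lt_trans _ D1))// lerDl powR_ge0.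
apply: (@le_trans _ _ ((lam + lam / (D - 1)) `^ c)); last by rewrite lerDr mulr_ge0// powR_ge0.
apply: ge0_ler_powR; rewrite ?nnegrE ?(ltW c0)//; first by rewrite addr_ge0.
  by rewrite addr_ge0// divr_ge0// ltW.
by rewrite lerD2l ler_pdivlMr// mulrC ltW.
Qed.

Section Drift2.
Variables (R : realType) (n p r : nat) (qj : 'I_r -> nat).
Local Notation q := (qsum qj).
Local Notation d := (p + q)%N.
Variables (X : 'M[R]_(n, p)) (Z : 'M[R]_(n, q)) (y : 'I_n -> bool) (a b : 'I_r -> R).
Notation leb := (@lebesgue_measure R).
Notation W := (W X Z).
Notation Sigma := (Sigma X Z).
Hypothesis shp0 : forall j, 0 < tau_shape qj a j.
Hypothesis rkW : \rank W = d.
Notation rate := (tau_rate (p := p) (qj := qj) b).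
Notation shp := (tau_shape qj a).
Notation tc := (tau_pdf (p := p) (qj := qj) a b).
Notation blk := (@blk p r qj).

Local Opaque Gam.

Definition lam : R := 1 + \sum_i `|(W^T *m W) i i|.

Lemma lam_gt0 : 0 < lam.
Proof. by rewrite ltr_pwDl// sumr_ge0. Qed.

Lemma Sigma_diag tau j i : i \in blk j -> Sigma tau i i <= lam + tnth tau j.
Proof.
move=> /mapP[k]; rewrite mem_enum => kj ->.
rewrite /Sigma mxE; apply: lerD.
  rewrite /lam (bigD1 (rshift p k))//= addrCA; apply: (le_trans (ler_norm _)).
  by rewrite lerDl addr_ge0// sumr_ge0.
by rewrite block_mxEdr mxE eqxx mul1r (sum_inblk (fun j => tnth tau j) kj).
Qed.

Lemma tc_powR (eta : d.-tuple R) j (c : R) : 0 < c ->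
  (\int[leb]_t (t `^ c * tc eta j t)%:E =
   (if 0 < rate eta j then Gam (shp j + c) / Gam (shp j) * rate eta j `^ (- c)
    else Gam (1 + c) / Gam 1)%:E)%E.
Proof.
move=> c0.
have pw (s be t : R) : t `^ c * gamma_un s be t = gamma_un (s + c) be t.
  rewrite /gamma_un; case: ifP => t0; last by rewrite mulr0.
  rewrite mulrA -powRD ?(gt_eqF t0) ?implybT//; congr (_ `^ _ * _); ring.
have Gs := Gam_gt0 (shp0 j); have G1 : 0 < Gam 1 :> R by rewrite Gam_gt0.
have G0 s be t : (0 <= (gamma_un s be t : R)%:E)%E by rewrite lee_fin gamma_un_ge0.
have mG s be := measurable_gamma_un (R := R) s be.
have sc : 0 < shp j + c by rewrite addr_gt0.
have oc : 0 < 1 + c by rewrite addr_gt0.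
case: ifPn => h.
  have rp x := powR_gt0 x h.
  under eq_integral => t _ do rewrite /tau_pdf h mulrA pw EFinM.
  rewrite intZr//; last by rewrite lee_fin invr_ge0 mulr_ge0 ?ltW.
  rewrite gamma_int// -EFinM; congr EFin.
  rewrite opprD powRD ?(gt_eqF h) ?implybT//.
  move: (Gam (shp j + c)) (Gam (shp j)) (rate eta j `^ (- shp j)) (rate eta j `^ (- c)) Gs (rp (- shp j)) => g1 g2 r1 r2 g20 r10.
  by field; rewrite !gt_eqF.
under eq_integral => t _ do rewrite /tau_pdf (negbTE h) mulrA pw EFinM.
rewrite intZr//; last by rewrite lee_fin invr_ge0 ltW.
by rewrite gamma_intE// -EFinM.
Qed.

Lemma drift_neg j : (0 < qj j)%N -> a j < 0 -> b j = 0 ->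
  exists rho L : R, [/\ 0 <= rho, rho < 1, 0 <= L &
  forall eta, (\int[lebK R d]_x (kden X Z y a b eta x * (usq x j `^ (a j / 2))%:E) <=
     (rho * usq eta j `^ (a j / 2) + L)%:E)%E].
Proof.
move=> q0 a0 b0; pose c : R := - a j / 2; have c0 : 0 < c by rewrite /c; lra.
have -> : a j / 2 = - c by rewrite /c; field.
pose h : R := (qj j)%:R / 2.
have sE : shp j = h - 2 * c by rewrite /tau_shape /h /c; field.
have s0 := shp0 j.
have ch : c < h by move: s0; rewrite sE; lra.
have h0 : 0 < h by lra.
have ex_Gam x : 0 < x -> exists G : R, Gam x = G /\ 0 < G by move=> x0; exists (Gam x); split=> //; exact: Gam_gt0.
have hc0 : 0 < h - c by lra.
have [gh [ghE G1]] := ex_Gam _ h0.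
have [gs [gsE G2]] := ex_Gam _ s0.
have [gm [gmE G3]] := ex_Gam _ hc0.
have [go [goE G5]] := ex_Gam _ (@ltr01 R).
have [g4 [g4E G4]] := ex_Gam _ (addr_gt0 ltr01 c0).
have gmid : gm ^+ 2 < gs * gh.
  have sh : shp j < h by rewrite sE ltrBlDr ltrDl mulr_gt0.
  have := Gam_mid s0 sh; rewrite (_ : (shp j + h) / 2 = h - c); last by rewrite sE; field.
  by rewrite gmE gsE ghE.
pose g : R := gm ^+ 2 / (gs * gh).
have GG : 0 < gs * gh by exact: mulr_gt0.
have g0 : 0 < g by apply: divr_gt0 => //; exact: exprn_gt0.
have g1 : g < 1 by rewrite /g ltr_pdivrMr// mul1r.
have [A [C [A0 C0 Ag AC]]] := powR_split c0 g0 g1 (ltW lam_gt0).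
pose K : R := 2 `^ (- c) * gm / gh.
have K0 : 0 <= K.
  by apply: divr_ge0; [apply: mulr_ge0; [exact: powR_ge0|exact: ltW]|exact: ltW].
exists (A * g), (K * (C + A * (g4 / go))); split => //.
- by apply: mulr_ge0 => //; exact: ltW.
- apply: mulr_ge0 => //; apply: addr_ge0 => //; apply: mulr_ge0 => //.
  by apply: divr_ge0; exact: ltW.
move=> eta.
pose f (t : R) : R := K * (A * `|t| `^ c + C).
have mf : measurable_fun setT f by rewrite /f; meas.
have f0 t : 0 <= f t by rewrite mulr_ge0// addr_ge0// mulr_ge0// powR_ge0.
have mu : measurable_fun setT (fun x : d.-tuple R => usq x j `^ (- c)).
  by move: (measurable_usq j (@measurable_id _ (d.-tuple R) setT)) => ?; meas.
apply: (le_trans (kden_le_tau y b shp0 (j := j) eta mu (fun x => powR_ge0 _ _) mf f0 _)).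
  move=> tau v tp; have tj : 0 < tnth tau j by move/forallP: tp.
  have Lm : 0 < lam + tnth tau j by rewrite addr_gt0// lam_gt0.
  have := @mvn_negmom R _ (Sigma tau) (invmx (Sigma tau) *m (W^T *m tcol v)) (blk j) c _ (Sigma_posdef rkW tp) (blk_uniq p qj j) c0 _ Lm (@Sigma_diag tau j).
  rewrite size_blk => /(_ ch); rewrite -/h gmE ghE -/K => H.
  under eq_integral do rewrite usq_blk.
  apply: (le_trans H); rewrite lee_fin /f mulrC; apply: ler_wpM2l => //.
  by rewrite gtr0_norm// AC// ltW.
have mt : measurable_fun setT (fun t => tc eta j t) by apply: measurable_tc2.
have t0 t : 0 <= tc eta j t by exact: tc_ge0.
apply: (@le_trans _ _ (\int[leb]_t ((K * A)%:E * (t `^ c * tc eta j t)%:E + (K * C)%:E * (tc eta j t)%:E))%E).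
  rewrite le_eqVlt; apply/orP; left; apply/eqP; apply: eq_integral => t _.
  rewrite -!EFinM -EFinD; congr EFin; rewrite /f.
  have [tp|tn] := ltP 0 t; last by rewrite tc_neg// !mulr0 addr0.
  by rewrite gtr0_norm//; move: (tc _ _ _) => z; ring.
have p0 t : 0 <= t `^ c * tc eta j t by rewrite mulr_ge0// powR_ge0.
have KA0 : (0 <= (K * A)%:E)%E by rewrite lee_fin mulr_ge0.
have KC0 : (0 <= (K * C)%:E)%E by rewrite lee_fin mulr_ge0.
have mpt : measurable_fun setT (fun t => t `^ c * tc eta j t) by meas.
rewrite intD//; last 2 first.
- by move=> t; rewrite mule_ge0// lee_fin.
- by move=> t; rewrite mule_ge0// lee_fin.
rewrite !intZl//.
rewrite tc_powR// tc_mass// mule1 gsE g4E goE -EFinM -EFinD lee_fin.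
have u0 := usq_ge0 eta j.
have rE : rate eta j = usq eta j / 2 by rewrite /tau_rate b0 add0r.
case: ifPn => hr.
  rewrite (_ : shp j + c = h - c) ?gmE; last by rewrite sE; ring.
  have -> : K * A * (gm / gs * rate eta j `^ (- c)) = A * g * usq eta j `^ (- c).
    rewrite rE powRM// -[2^-1]powR_inv1// -powRrM mulN1r opprK.
    rewrite /K /g powRN.
    have p2 : 0 < 2 `^ c :> R by rewrite powR_gt0.
    move: (2 `^ c) (usq eta j `^ (- c)) p2 => p2 z z1.
    by field; rewrite !gt_eqF.
  rewrite lerD2l ler_wpM2l// lerDl mulr_ge0// divr_ge0 ?ltW//.
rewrite mulrDr [X in _ <= _ + X]addrC mulrA addrA lerD2r lerDr.
by rewrite mulr_ge0 ?powR_ge0// mulr_ge0// ltW.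
Qed.

End Drift2.

Section Drift3.
Variables (R : realType) (n p r : nat) (qj : 'I_r -> nat).
Local Notation q := (qsum qj).
Local Notation d := (p + q)%N.
Variables (X : 'M[R]_(n, p)) (Z : 'M[R]_(n, q)) (y : 'I_n -> bool) (a b : 'I_r -> R).
Notation W := (W X Z).
Notation Sigma := (Sigma X Z).
Notation lin := (lin X Z).
Hypothesis shp0 : forall j, 0 < tau_shape qj a j.
Hypothesis rkW : \rank W = d.
Hypothesis A2 : exists e : 'rV[R]_n, (forall i, 0 < e 0 i) /\ e *m Wstar X Z y = 0.

Lemma right_le_wrong : exists C : R, 0 <= C /\ forall eta : d.-tuple R,
  \sum_(i | right_sign (y i) (lin eta i)) lin eta i ^+ 2 <=
  C * \sum_(i | ~~ right_sign (y i) (lin eta i)) lin eta i ^+ 2.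
Proof.
have [e [e0 eW]] := A2.
pose M : R := \sum_i \sum_k e 0 k / e 0 i.
have ek i k : 0 <= e 0 k / e 0 i by rewrite divr_ge0 ?ltW.
have M0 : 0 <= M by apply: sumr_ge0 => i _; apply: sumr_ge0.
have Mle i k : e 0 k / e 0 i <= M.
  rewrite /M (bigD1 i)//= (bigD1 k)//= -addrA lerDl addr_ge0//.
    by apply: sumr_ge0.
  by apply: sumr_ge0 => l _; apply: sumr_ge0.
exists (n%:R * (M * n%:R) ^+ 2); split; first by rewrite mulr_ge0// sqr_ge0.
move=> eta; set N := \sum_(i | ~~ _) _; pose z := Num.sqrt N.
have N0 : 0 <= N by apply: sumr_ge0 => i _; exact: sqr_ge0.
pose rs i := right_sign (y i) (lin eta i).
pose s i := cc R y i * lin eta i.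
have s2 i : s i ^+ 2 = lin eta i ^+ 2.
  by rewrite /s /cc exprMn; case: (y i) => /=; ring.
have srs i : if rs i then s i <= 0 else 0 <= s i.
  rewrite /rs /right_sign /s /cc; case: (y i) => /=.
    by case: ifPn => h; lra.
  by case: ifPn => h; lra.
have sum0 : \sum_i e 0 i * s i = 0.
  have /matrixP/(_ 0 0) : e *m Wstar X Z y *m tcol eta = 0 by rewrite eW mul0mx.
  rewrite -mulmxA [X in X = _ -> _]mxE [X in _ = X -> _]mxE => E; rewrite -[RHS]E; apply: eq_bigr => i _; congr (_ * _).
  rewrite /s /Defs.lin !mxE mulr_sumr; apply: eq_bigr => k _.
  by rewrite !mxE mulrA.
have zs k : ~~ rs k -> s k <= z.
  move=> rk; rewrite /z -[s k]ger0_norm; last by have := srs k; rewrite (negbTE rk).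
  rewrite -sqrtr_sqr ler_sqrt// s2 /N (bigD1 k)//= lerDl.
  by apply: sumr_ge0 => l _; exact: sqr_ge0.
have z0 : 0 <= z by exact: sqrtr_ge0.
have key i : rs i -> s i ^+ 2 <= (M * n%:R) ^+ 2 * N.
  move=> ri; have si : s i <= 0 by have := srs i; rewrite ri.
  have h1 : e 0 i * - s i <= \sum_(k | ~~ rs k) e 0 k * s k.
    move: sum0; rewrite (bigID rs)/= (bigD1 i)//= => h.
    have : \sum_(k | rs k && (k != i)) e 0 k * s k <= 0.
      apply: sumr_le0 => k /andP[rk _]; have := srs k; rewrite rk => sk.
      by rewrite pmulr_rle0.
    lra.
  have h2 : - s i <= M * n%:R * z.
    have : - s i <= \sum_(k | ~~ rs k) e 0 k / e 0 i * s k.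
      rewrite -(ler_pM2l (e0 i)); apply: (le_trans h1); rewrite mulr_sumr.
      apply: ler_sum => k _; rewrite le_eqVlt; apply/orP; left; apply/eqP.
      by field; rewrite gt_eqF.
    move=> h; apply: (le_trans h).
    apply: (@le_trans _ _ (\sum_(k < n) M * z)); last first.
      by rewrite sumr_const card_ord -[leLHS]mulr_natl mulrA [n%:R * M]mulrC.
    rewrite [leRHS](bigID rs)/= -[leLHS]add0r; apply: lerD.
      by apply: sumr_ge0 => k _; rewrite mulr_ge0.
    apply: ler_sum => k rk; apply: ler_pM => //; last exact: zs.
    by have := srs k; rewrite (negbTE rk).
  rewrite -(sqr_sqrtr N0) -/z -exprMn -sqrrN.
  by rewrite ler_pXn2r ?nnegrE ?mulr_ge0// oppr_ge0.
apply: (@le_trans _ _ (\sum_(i < n) (M * n%:R) ^+ 2 * N)); last first.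
  by rewrite sumr_const card_ord -[leLHS]mulr_natl mulrA.
rewrite [leRHS](bigID rs)/= -[leLHS]addr0; apply: lerD.
  by apply: ler_sum => i ri; rewrite -s2 key.
by apply: sumr_ge0 => i _; rewrite mulr_ge0 ?sqr_ge0.
Qed.

Lemma nsq_mean tau (v : 'cV[R]_n) : tpos tau ->
  nsq (W *m (invmx (Sigma tau) *m (W^T *m v))) <= nsq v.
Proof.
move=> tp; set m := invmx _ *m _; have uS := posdef_unit (Sigma_posdef rkW tp).
have Sm : Sigma tau *m m = W^T *m v by rewrite /m mulKVmx.
have h1 : qf (Sigma tau) m = ((W *m m)^T *m v) 0 0.
  by rewrite /qf -mulmxA Sm mulmxA -trmx_mul.
have h2 : nsq (W *m m) <= qf (Sigma tau) m.
  rewrite qf_Sigma// lerDl sumr_ge0// => j _; rewrite mulr_ge0//.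
    by move/forallP: tp => /(_ j)/ltW.
  by apply: sumr_ge0 => i _; exact: sqr_ge0.
have := nsq_ge0 (v - W *m m).
have -> : nsq (v - W *m m) = nsq v + nsq (W *m m) - 2 * ((W *m m)^T *m v) 0 0.
  rewrite /nsq [((W *m m)^T *m v) 0 0]mxE mulr_sumr -big_split -sumrB/=.
  by apply: eq_bigr => i _; move: (W *m m) => w; rewrite !mxE; ring.
rewrite -h1; lra.
Qed.

Lemma nsq_split k (e : R) (u w : 'cV[R]_k) : 0 < e ->
  nsq (u + w) <= (1 + e) * nsq u + (1 + e^-1) * nsq w.
Proof.
move=> e0; rewrite /nsq !mulr_sumr -big_split/=; apply: ler_sum => i _; rewrite mxE.
have h : 0 <= e^-1 * (e * u i 0 - w i 0) ^+ 2 by rewrite mulr_ge0 ?sqr_ge0// invr_ge0 ltW.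
suff -> : (1 + e) * u i 0 ^+ 2 + (1 + e^-1) * w i 0 ^+ 2 = (u i 0 + w i 0) ^+ 2 + e^-1 * (e * u i 0 - w i 0) ^+ 2.
  by rewrite lerDl.
by field; rewrite gt_eqF.
Qed.

Lemma measurable_nsqW : measurable_fun setT (fun x : d.-tuple R => nsq (W *m tcol x)).
Proof.
apply: measurable_sum => i; apply: measurable_funX.
exact: (measurable_lin X Z i (@measurable_id _ (d.-tuple R) setT)).
Qed.

Lemma mvn_quad e tau v : 0 < e -> tpos tau ->
  (\int[lebK R d]_x (nsq (W *m tcol x) * mvn X Z tau v x)%:E <=
    ((1 + e) * nsq (tcol v) + (1 + e^-1) * (4 * 2 ^+ d))%:E)%E.
Proof.
move=> e0 tp; set m := invmx (Sigma tau) *m (W^T *m tcol v).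
have pS := Sigma_posdef rkW tp.
pose f x := mvn_pdf (Sigma tau) m (tcol x).
have f0 x : 0 <= f x by exact: mvn_ge0.
have mf : measurable_fun setT f by exact: mvn_meas.
have mq := measurable_qf_tcol (Sigma tau) m.
have mW := measurable_nsqW.
have A0 : (0 <= ((1 + e) * nsq (tcol v))%:E)%E by rewrite lee_fin mulr_ge0 ?nsq_ge0// addr_ge0// ltW.
have B0 : (0 <= (1 + e^-1)%:E)%E by rewrite lee_fin addr_ge0// invr_ge0 ltW.
have q0 x : 0 <= qf (Sigma tau) (tcol x - m) by exact: posdef_ge0.
have qf0 x : 0 <= qf (Sigma tau) (tcol x - m) * f x by rewrite mulr_ge0.
apply: (@le_trans _ _ (\int[lebK R d]_x (((1 + e) * nsq (tcol v))%:E * (f x)%:E +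
   (1 + e^-1)%:E * (qf (Sigma tau) (tcol x - m) * f x)%:E))%E).
  apply: int_le => //.
  - by move=> x; rewrite lee_fin mulr_ge0 ?nsq_ge0.
  move=> x; rewrite -!EFinM -EFinD lee_fin -[mvn _ _ _ _ _]/(f x).
  move: (f x) (f0 x) => z z0; rewrite mulrA -mulrDl; apply: ler_wpM2r => //.
  rewrite -{1}[tcol x](subrK m) [_ - m + m]addrC mulmxDr; apply: (le_trans (nsq_split _ _ e0)).
  apply: lerD; first by rewrite ler_wpM2l ?nsq_mean// addr_ge0// ltW.
  rewrite ler_wpM2l ?addr_ge0 ?invr_ge0 ?(ltW e0)//.
  rewrite qf_Sigma// lerDl sumr_ge0// => j _; rewrite mulr_ge0//.
    by move/forallP: tp => /(_ j)/ltW.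
  by apply: sumr_ge0 => i _; exact: sqr_ge0.
rewrite intD//; last 2 first.
- by move=> x; rewrite mule_ge0// lee_fin.
- by move=> x; rewrite mule_ge0// lee_fin.
rewrite !intZl// /f mvn_mass// mule1 [leRHS]EFinD [X in (_ <= _ + X)%E]EFinM.
by apply: leeD => //; apply: lee_wpmul2l => //; exact: mvn_second.
Qed.

Lemma drift_quad : exists rho L : R, [/\ 0 <= rho, rho < 1, 0 <= L &
  forall eta, (\int[lebK R d]_x (kden X Z y a b eta x * (nsq (W *m tcol x))%:E) <=
     (rho * nsq (W *m tcol eta) + L)%:E)%E].
Proof.
have [C [C0 HC]] := right_le_wrong.
pose rh := C / (1 + C).
have C1 : 0 < 1 + C by rewrite ltr_pwDl.
have rh0 : 0 <= rh by rewrite divr_ge0// ltW.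
have rh1 : rh < 1 by rewrite /rh ltr_pdivrMr// mul1r; lra.
pose e := (1 - rh) / 6.
have e0 : 0 < e by rewrite /e; lra.
have rho1 : (1 + e) ^+ 2 * rh < 1 by rewrite /e; nra.
have [C' [C'0 HC']] := tn_second e0.
pose L1 : R := (1 + e^-1) * (4 * 2 ^+ d).
have L10 : 0 <= L1 by rewrite mulr_ge0 ?mulr_ge0 ?exprn_ge0// addr_ge0// invr_ge0 ltW.
have e1 : 0 <= 1 + e by lra.
exists ((1 + e) ^+ 2 * rh), ((1 + e) * (n%:R * C') + L1); split => //.
- by rewrite mulr_ge0 ?sqr_ge0.
- by rewrite addr_ge0// mulr_ge0// mulr_ge0.
move=> eta.
have mW := measurable_nsqW.
apply: (le_trans (kden_le_v y b shp0 eta mW (fun x => nsq_ge0 _) e1 L10 (fun tau v tp => mvn_quad v e0 tp))).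
apply: (@le_trans _ _ ((1 + e)%:E * (\sum_(i < n) ((1 + e) * (if right_sign (y i) (lin eta i) then lin eta i ^+ 2 else 0) + C')%:E) + L1%:E)%E).
  apply: leeD => //; apply: lee_wpmul2l; first by rewrite lee_fin.
  by apply: lee_sum => i _; exact: HC'.
rewrite sumEFin -EFinM -EFinD lee_fin big_split/= -mulr_sumr -big_mkcond/= sumr_const card_ord -[C' *+ n]mulr_natl.
rewrite mulrDr addrA lerD2r lerD2r mulrA -expr2.
rewrite -[leRHS]mulrA; apply: ler_wpM2l; first exact: sqr_ge0.
rewrite /nsq [\sum_(i < n) _](bigID (fun i => right_sign (y i) (lin eta i)))/=.
have := HC eta; rewrite -/(lin eta).
set P := (X in X <= _); set N := (X in _ * X) => h.
have -> : \sum_(i < n | right_sign (y i) (lin eta i)) (W *m tcol eta) i 0 ^+ 2 = P by [].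
have -> : \sum_(i < n | ~~ right_sign (y i) (lin eta i)) (W *m tcol eta) i 0 ^+ 2 = N by [].
rewrite /rh mulrAC ler_pdivlMr// mulrDr mulr1; lra.
Qed.

(* [0 `^ (a j / 2) = 0], so the second term is finite but useless at [usq eta j = 0]; there [tau_cond] falls back
   on Gamma(1,1), which needs no control. *)
Definition lyapunov (eta : d.-tuple R) : R :=
  nsq (W *m tcol eta) + \sum_(j | b j == 0) usq eta j `^ (a j / 2).

Notation V := lyapunov.

Lemma V_ge0 eta : 0 <= V eta.
Proof. by rewrite addr_ge0 ?nsq_ge0// sumr_ge0// => j _; exact: powR_ge0. Qed.

Lemma measurable_uneg j : measurable_fun setT (fun x : d.-tuple R => usq x j `^ (a j / 2)).
Proof. by move: (measurable_usq j (@measurable_id _ (d.-tuple R) setT)) => ?; meas. Qed.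

Lemma measurable_V : measurable_fun setT V.
Proof.
rewrite /lyapunov; apply: measurable_funD; first exact: measurable_nsqW.
under eq_fun do rewrite -big_filter.
by apply: measurable_sum => j; exact: measurable_uneg.
Qed.

Hypothesis qj0 : forall j, (0 < qj j)%N.
Hypothesis hab : forall j, (a j < 0 /\ b j = 0) \/ 0 < b j.

Lemma drift : exists rho L : R, [/\ 0 <= rho, rho < 1, 0 <= L &
  forall eta, (\int[lebK R d]_x (kden X Z y a b eta x * (V x)%:E) <=
     (rho * V eta + L)%:E)%E].
Proof.
have mk eta : measurable_fun setT (fun x => kden X Z y a b eta x).
  exact: (measurableT_comp (measurable_kden X Z y b shp0) (measurable_pair1 eta)).
have k0 eta x : (0 <= kden X Z y a b eta x)%E by exact: kden_ge0.
pose P (f : d.-tuple R -> R) := measurable_fun setT f /\ (forall x, 0 <= f x) /\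
  exists rho L : R, [/\ 0 <= rho, rho < 1, 0 <= L &
  forall eta, (\int[lebK R d]_x (kden X Z y a b eta x * (f x)%:E) <= (rho * f eta + L)%:E)%E].
have PD f g : P f -> P g -> P (fun x => f x + g x).
  move=> [mf [f0 [r1 [L1 [r10 r11 L10 H1]]]]] [mg [g0 [r2 [L2 [r20 r21 L20 H2]]]]].
  split; first by meas.
  split; first by move=> x; rewrite addr_ge0.
  exists (Num.max r1 r2), (L1 + L2); split.
  - by rewrite le_max r10.
  - by rewrite gt_max r11.
  - by rewrite addr_ge0.
  move=> eta; under eq_integral do rewrite EFinD ge0_muleDr ?lee_fin//.
  rewrite intD//; last 2 first.
  - by move=> x; rewrite mule_ge0// lee_fin.
  - by move=> x; rewrite mule_ge0// lee_fin.
  apply: (le_trans (leeD (H1 eta) (H2 eta))); rewrite -EFinD lee_fin.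
  have h1 : r1 * f eta <= Num.max r1 r2 * f eta by rewrite ler_wpM2r// le_max lexx.
  have h2 : r2 * g eta <= Num.max r1 r2 * g eta by rewrite ler_wpM2r// le_max lexx orbT.
  rewrite mulrDr; lra.
suff [_ [_ H]] : P V by [].
apply: (PD).
  split; first exact: measurable_nsqW.
  by split; [move=> x; exact: nsq_ge0|exact: drift_quad].
have Pj j : b j = 0 -> P (fun x => usq x j `^ (a j / 2)).
  move=> bj; have aj : a j < 0 by have [[]//|] := hab j; rewrite bj ltxx.
  split; first exact: measurable_uneg.
  by split; [move=> x; exact: powR_ge0|exact: (drift_neg y shp0 rkW (qj0 j) aj bj)].
have P0 : P (fun=> 0).
  split; first exact: measurable_cst.
  split => //; exists 0, 0; split => // eta.
  by under eq_integral do rewrite mule0; rewrite integral0 mul0r addr0.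
have : forall s : seq 'I_r, all (fun j => b j == 0) s -> P (fun x => \sum_(j <- s) usq x j `^ (a j / 2)).
  elim => [_|j s IH /= /andP[/eqP bj bs]]; first by under eq_fun do rewrite big_nil.
  rewrite (_ : (fun x => _) = fun x => usq x j `^ (a j / 2) + \sum_(j0 <- s) usq x j0 `^ (a j0 / 2)).
    by apply: (PD); [exact: Pj|exact: IH].
  by apply/funext => x; rewrite big_cons.
move=> /(_ (seq.filter (fun j => b j == 0) (index_enum 'I_r))).
rewrite filter_all => /(_ isT) H.
rewrite (_ : (fun x => _) = fun x => \sum_(j <- [seq j <- index_enum 'I_r | b j == 0]) usq x j `^ (a j / 2))//.
by apply/funext => x; rewrite big_filter.
Qed.

End Drift3.

(** * Minorization *)

Section Minor.
Variables (R : realType) (n p r : nat) (qj : 'I_r -> nat).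
Local Notation q := (qsum qj).
Local Notation d := (p + q)%N.
Variables (X : 'M[R]_(n, p)) (Z : 'M[R]_(n, q)) (y : 'I_n -> bool) (a b : 'I_r -> R).
Notation leb := (@lebesgue_measure R).
Notation W := (W X Z).
Notation Sigma := (Sigma X Z).
Notation lin := (lin X Z).
Hypothesis shp0 : forall j, 0 < tau_shape qj a j.
Hypothesis rkW : \rank W = d.
Notation rate := (tau_rate (p := p) (qj := qj) b).
Notation shp := (tau_shape qj a).
Notation tc := (tau_pdf (p := p) (qj := qj) a b).
Notation blk := (@blk p r qj).
Notation V := (lyapunov X Z a b).
Hypothesis hab : forall j, (a j < 0 /\ b j = 0) \/ 0 < b j.

(* Both determinants are Gaussian integrals, which compare pointwise. *)
Lemma det_mono k (S T : 'M[R]_k) : posdef S -> posdef T -> (forall x, qf S x <= qf T x) ->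
  \det S <= \det T.
Proof.
move=> pS pT ST; have dS := posdef_det pS; have dT := posdef_det pT.
have : (\int[lebK R k]_t (expR (- (qf T (tcol t - 0)) / 2))%:E <=
        \int[lebK R k]_t (expR (- (qf S (tcol t - 0)) / 2))%:E)%E.
  have ? := gauss_meas S 0; have ? := gauss_meas T 0.
  apply: int_le => // x.
  by rewrite lee_fin ler_expR ler_pM2r ?invr_gt0// lerN2.
rewrite !gauss_lebK// lee_fin ler_pM2l ?exprn_gt0 ?s2pi_gt0//.
by rewrite lef_pV2 ?posrE ?sqrtr_gt0// ler_sqrt// ltW.
Qed.

Lemma WW_posdef : posdef (W^T *m W).
Proof.
split=> [|x x0]; first by rewrite trmx_mul trmxK.
have -> : qf (W^T *m W) x = nsq (W *m x) by rewrite /qf nsqE trmx_mul !mulmxA.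
rewrite lt_neqAle nsq_ge0 andbT eq_sym; apply: contra x0 => /eqP /nsq_eq0 /(Wx0 rkW) ->//.
Qed.

Lemma nsqW_V eta : nsq (W *m tcol eta) <= V eta.
Proof. by rewrite /lyapunov lerDl sumr_ge0// => j _; exact: powR_ge0. Qed.

Lemma lin_V eta rr i : 0 <= rr -> V eta <= rr -> `|lin eta i| <= Num.sqrt rr.
Proof.
move=> r0 Vr; rewrite -sqrtr_sqr ler_sqrt//; apply: le_trans Vr; apply: le_trans (nsqW_V eta).
by rewrite /nsq (bigD1 i)//= lerDl sumr_ge0// => k _; exact: sqr_ge0.
Qed.

Lemma nsqW_lower : exists ka : R, 0 < ka /\ forall eta : d.-tuple R,
  ka * nsq (tcol eta) <= nsq (W *m tcol eta).
Proof.
pose P := pinvmx W; pose C := \sum_i \sum_k `|P i k|.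
have C0 : 0 <= C by apply: sumr_ge0 => i _; apply: sumr_ge0.
have D0 : 0 < d%:R * C ^+ 2 + 1 by rewrite ltr_wpDl// mulr_ge0// sqr_ge0.
exists (d%:R * C ^+ 2 + 1)^-1; split; first by rewrite invr_gt0.
move=> eta; rewrite mulrC ler_pdivrMr//.
set N := nsq (W *m tcol eta); have N0 : 0 <= N by exact: nsq_ge0.
apply: (@le_trans _ _ (N * (d%:R * C ^+ 2))); last by rewrite ler_wpM2l// lerDl.
apply: (@le_trans _ _ (\sum_(i < d) N * C ^+ 2)); last first.
  by rewrite sumr_const card_ord -[leLHS]mulr_natl mulrCA.
apply: ler_sum => i _.
have s0 : 0 <= Num.sqrt N by exact: sqrtr_ge0.
rewrite -[N]sqr_sqrtr// -exprMn -[leLHS]real_normK ?num_real// ler_pXn2r ?nnegrE ?mulr_ge0//.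
rewrite -[tcol eta]mul1mx -(WV rkW) -mulmxA -/P [(P *m _) _ _]mxE.
apply: (le_trans (ler_norm_sum _ _ _)).
apply: (@le_trans _ _ (\sum_l `|P i l| * Num.sqrt N)).
  apply: ler_sum => l _; rewrite normrM ler_wpM2l// -sqrtr_sqr ler_sqrt//.
  by rewrite /N /nsq (bigD1 l)//= lerDl sumr_ge0// => ? _; exact: sqr_ge0.
rewrite -mulr_suml mulrC ler_wpM2l// /C [leRHS](bigD1 i)//= lerDl.
by apply: sumr_ge0 => l _; apply: sumr_ge0.
Qed.

Lemma usq_le_nsq (eta : d.-tuple R) j : usq eta j <= nsq (tcol eta).
Proof.
rewrite usq_blk big_uniq ?blk_uniq//= /nsq [leRHS](bigID (mem (blk j)))/= lerDl.
by apply: sumr_ge0 => i _; exact: sqr_ge0.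
Qed.

Lemma usq_le_V rr : exists M, forall eta j, V eta <= rr -> usq eta j <= M.
Proof.
have [ka [ka0 H]] := nsqW_lower; exists (rr / ka) => eta j Vr.
rewrite ler_pdivlMr// mulrC; apply: le_trans Vr; apply: le_trans (nsqW_V eta).
by apply: le_trans (H eta); rewrite ler_pM2l// usq_le_nsq.
Qed.

Lemma tc_lower rr (j : 'I_r) : 0 < rr -> exists c, 0 < c /\ forall eta t,
  V eta <= rr -> 1 < t < 2 -> c <= tc eta j t.
Proof.
move=> r0; have [M HM] := usq_le_V rr.
have ex_Gam x : 0 < x -> exists G : R, Gam x = G /\ 0 < G by move=> x0; exists (Gam x); split=> //; exact: Gam_gt0.
have [gs [gsE gs0]] := ex_Gam _ (shp0 j).
have [go [goE go0]] := ex_Gam _ (@ltr01 R).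
have [lo [lo0 Hlo]] : exists lo, 0 < lo /\ forall eta, V eta <= rr -> 0 < rate eta j -> lo <= rate eta j.
  have [[a0 b0]|b0] := hab j; last first.
    by exists (b j); split => // eta _ _; rewrite /tau_rate lerDl divr_ge0// usq_ge0.
  exists (rr `^ (2 / a j) / 2); split; first by rewrite divr_gt0// powR_gt0.
  move=> eta Vr; rewrite /tau_rate b0 add0r => u0; rewrite ler_pM2r ?invr_gt0//.
  have {}u0 : 0 < usq eta j by move: u0; rewrite pmulr_lgt0 ?invr_gt0.
  have h : usq eta j `^ (a j / 2) <= rr.
    apply: le_trans Vr; rewrite /lyapunov (bigD1 j) ?b0//= addrCA lerDl addr_ge0 ?nsq_ge0//.
    by apply: sumr_ge0 => k _; exact: powR_ge0.
  have z0 : 0 < usq eta j `^ (a j / 2) by rewrite powR_gt0.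
  have an : a j != 0 by rewrite lt_eqF.
  have E : usq eta j = (usq eta j `^ (a j / 2)) `^ (2 / a j).
    rewrite -powRrM (_ : a j / 2 * (2 / a j) = 1) ?powRr1 ?(ltW u0)//.
    by field.
  rewrite E /powR (gt_eqF r0) (gt_eqF z0) ler_expR.
  rewrite ler_wnM2l//; last by rewrite ler_ln.
  by rewrite pmulr_rle0// invr_le0 ltW.
pose hi := b j + M / 2.
pose c1 := expR (- `|shp j - 1| * ln 2) * expR (- (hi * 2)) * lo `^ (shp j) / gs.
pose c2 := expR (- 2) / go.
have lp0 : 0 < lo `^ (shp j) by rewrite powR_gt0.
have c10 : 0 < c1 by rewrite /c1 divr_gt0// mulr_gt0// mulr_gt0// expR_gt0.
have c20 : 0 < c2 by rewrite /c2 divr_gt0// expR_gt0.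
exists (Num.min c1 c2); split; first by rewrite lt_min c10.
move=> eta t Vr /andP[t1 t2]; have t0 : 0 < t by lra.
rewrite /tau_pdf gsE goE /gamma_un t0; case: ifPn => hr.
  rewrite ge_min; apply/orP; left.
  have h1 : expR (- `|shp j - 1| * ln 2) <= t `^ (shp j - 1).
    rewrite /powR (gt_eqF t0) ler_expR.
    have l0 : 0 <= ln t by rewrite ln_ge0// ltW.
    have l2 : ln t <= ln 2 by rewrite ler_ln ?posrE// ltW.
    apply: (@le_trans _ _ (- `|shp j - 1| * ln t)).
      by rewrite !mulNr lerN2 ler_wpM2l.
    by rewrite ler_wpM2r// lerNl -normrN ler_norm.
  have h2 : expR (- (hi * 2)) <= expR (- (rate eta j * t)).
    rewrite ler_expR lerN2; apply: ler_pM; rewrite ?(ltW hr) ?(ltW t0) ?(ltW t2)//.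
    by rewrite /hi /tau_rate lerD2l ler_wpM2r ?invr_ge0// HM.
  have h3 : lo `^ (shp j) <= rate eta j `^ (shp j).
    by apply: ge0_ler_powR; rewrite ?nnegrE ?(ltW lo0) ?(ltW hr) ?(ltW (shp0 j))// Hlo.
  rewrite invfM powRN invrK [gs^-1 * _]mulrC mulrA; apply: ler_pM => //.
  - by rewrite !mulr_ge0 ?expR_ge0// ltW.
  - by rewrite invr_ge0 ltW.
  apply: ler_pM; [|exact: ltW| |exact: h3].
    by apply: mulr_ge0; exact: expR_ge0.
  by apply: ler_pM; rewrite ?expR_ge0.
rewrite ge_min; apply/orP; right.
rewrite /c2 ler_pM2r ?invr_gt0// subrr powRr0 !mul1r ler_expR; lra.
Qed.

Lemma tn_lower rr : 0 <= rr -> exists c, 0 < c /\ forall eta i t,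
  V eta <= rr -> tn_set (y i) t -> `|t| <= 1 -> c <= tn_pdf (lin eta i) (y i) t.
Proof.
move=> r0; pose c := expR (- ((1 + Num.sqrt rr) ^+ 2) / 2) / Num.sqrt (2 * pi).
have c0 : 0 < c by rewrite divr_gt0 ?expR_gt0 ?s2pi_gt0.
exists c; split => // eta i t Vr ts t1.
rewrite tn_pdfE /tnI ts mul1r.
apply: (@le_trans _ _ (phi (t - lin eta i))); last first.
  by rewrite ler_pdivlMr ?ZT_gt0// ler_piMr ?phi_ge0// ZT_le1.
rewrite /phi /c ler_pM2r ?invr_gt0 ?s2pi_gt0// ler_expR ler_pM2r ?invr_gt0// lerN2.
rewrite -[leLHS]real_normK ?num_real// ler_pXn2r ?nnegrE ?addr_ge0//.
by apply: (le_trans (ler_normB _ _)); apply: lerD => //; exact: lin_V.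
Qed.

Definition ubox : set (d.-tuple R) := [set t | forall i, 0 <= tnth t i <= 1].

Lemma mvn_lower : exists c, 0 < c /\ forall tau v x,
  (forall j, 1 < tnth tau j < 2) -> (forall i, `|tnth v i| <= 1) -> ubox x ->
  c <= mvn X Z tau v x.
Proof.
pose K : R := \sum_i (\sum_k `|W i k|) ^+ 2 + \sum_j 2 * (qj j)%:R.
have K0 : 0 <= K.
  apply: addr_ge0; first by apply: sumr_ge0 => i _; exact: sqr_ge0.
  by apply: sumr_ge0.
pose c := Num.sqrt (\det (W^T *m W)) / Num.sqrt (2 * pi) ^+ d * expR (- (2 * K + 2 * n%:R) / 2).
have dW := posdef_det WW_posdef.
exists c; split.
  by rewrite /c mulr_gt0 ?expR_gt0// divr_gt0 ?sqrtr_gt0// exprn_gt0// s2pi_gt0.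
move=> tau v x ht hv hx.
have tp : tpos tau by apply/forallP => j; have := ht j; lra.
have pS := Sigma_posdef rkW tp.
rewrite /mvn mvn_pdfE; set m := invmx _ *m _.
apply: ler_pM; rewrite ?expR_ge0//.
  rewrite ler_pM2r ?invr_gt0 ?exprn_gt0 ?s2pi_gt0// ler_sqrt; last exact/ltW/posdef_det.
  apply: det_mono => //; first exact: WW_posdef.
  move=> z; rewrite qf_Sigma// (_ : qf _ z = nsq (W *m z)); last by rewrite /qf nsqE trmx_mul !mulmxA.
  rewrite lerDl sumr_ge0// => j _; rewrite mulr_ge0//; first by have := ht j; lra.
  by apply: sumr_ge0 => i _; exact: sqr_ge0.
rewrite ler_expR ler_pM2r ?invr_gt0// lerN2.
have Sm : Sigma tau *m m = W^T *m tcol v by rewrite /m mulKVmx// posdef_unit.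
have h1 : qf (Sigma tau) m = ((W *m m)^T *m tcol v) 0 0.
  by rewrite /qf -mulmxA Sm mulmxA -trmx_mul.
have hm := nsq_mean rkW (tcol v) tp; rewrite -/m in hm.
have hv2 : nsq (tcol v) <= n%:R.
  rewrite (_ : n%:R = \sum_(i < n) 1 :> R); last by rewrite sumr_const card_ord.
  apply: ler_sum => i _; rewrite mxE.
  by rewrite -[leLHS]real_normK ?num_real// expr_le1.
have qm : qf (Sigma tau) m <= n%:R.
  apply: le_trans hv2; rewrite h1.
  have : 2 * ((W *m m)^T *m tcol v) 0 0 <= nsq (W *m m) + nsq (tcol v).
    rewrite /nsq [((W *m m)^T *m tcol v) 0 0]mxE mulr_sumr -big_split/=; apply: ler_sum => i _.
    rewrite [(_^T) _ _]mxE -subr_ge0.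
    move: ((W *m m) i 0) (tcol v i 0) => s t.
    by rewrite (_ : s ^+ 2 + t ^+ 2 - 2 * (s * t) = (s - t) ^+ 2) ?sqr_ge0//; ring.
  lra.
have qx : qf (Sigma tau) (tcol x) <= K.
  rewrite usq_qf// /K; apply: lerD.
    apply: ler_sum => i _; rewrite -[leLHS]real_normK ?num_real// ler_pXn2r ?nnegrE ?sumr_ge0//.
    rewrite mxE; apply: (le_trans (ler_norm_sum _ _ _)); apply: ler_sum => k _.
    rewrite normrM ler_piMr// mxE; have /andP[x0 x1] := hx k; by rewrite ger0_norm.
  apply: ler_sum => j _; have /andP[t1 t2] := ht j.
  apply: ler_pM; rewrite ?usq_ge0 ?(ltW t2)//; first lra.
  rewrite usq_blk -(size_blk p qj j) -sum1_size natr_sum; apply: ler_sum => k _.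
  by rewrite mxE; have /andP[x0 x1] := hx k; rewrite expr_le1.
have := posdef_ge0 (tcol x + m) pS.
have := qfD (tcol x) m (Sigma_sym X Z tau).
have := qfD (tcol x) (- m) (Sigma_sym X Z tau).
rewrite -[- m]scaleN1r qfZ -scalemxAr mxE mulN1r expr2 mulrNN !mulr1 mul1r.
lra.
Qed.

Lemma ubox_measurable : measurable ubox.
Proof.
rewrite (_ : ubox = \bigcap_(i in [set: 'I_d]) [set t | tnth t i \in `[0, 1]%R]).
  apply: fin_bigcap_measurable => // i _.
  have := @measurable_tnth _ (measurableTypeR R) d i measurableT [set` `[0, 1]%R] (measurable_itv _).
  by rewrite setTI.
apply/seteqP; split=> [t h i _|t h i]; first by rewrite /= in_itv/=; exact: h.
by have := h i I; rewrite /= in_itv.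
Qed.

Lemma ubox1 : lebK R d ubox = 1%E.
Proof.
transitivity (\int[lebK R d]_t (\1_ubox t)%:E)%E.
  by rewrite integral_indic ?setIT//; exact: ubox_measurable.
transitivity (\int[lebK R d]_t (\prod_(i < d) (\1_(`[0, 1]%classic : set R) (tnth t i) : R))%:E)%E.
  apply: eq_integral => t _; congr EFin; rewrite !indicE.
  have [h|h] := boolP (t \in ubox).
    rewrite big1// => i _; rewrite indicE mem_set//= in_itv/=.
    by move: h; rewrite inE => /(_ i).
  apply/esym/eqP; rewrite prodf_seq_eq0/=; apply/hasP.
  have : ~ ubox t by move=> h'; rewrite mem_set in h.
  move=> /existsNP[i hi]; exists i; rewrite ?mem_index_enum//= indicE.
  by rewrite memNset//= in_itv/=.
rewrite (lebK_prod_one (f := fun=> \1_(`[0, 1]%classic : set R)))//.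
move=> i; rewrite integral_indic//= setIT.
have := @lebesgue_measure_itv R `[0, 1]%R; rewrite /= lte_fin ltr01 => ->.
by rewrite sube0.
Qed.

Lemma minor rr : exists eps : R, 0 < eps /\ forall x x', V x <= rr -> ubox x' ->
  (eps%:E <= kden X Z y a b x x')%E.
Proof.
pose r0 := Num.max rr 1.
have r00 : 0 < r0 by rewrite lt_max ltr01 orbT.
have rr0 x : V x <= rr -> V x <= r0 by move=> h; rewrite le_max h.
have [ct Hct] := choice (fun j => tc_lower j r00).
have [cv [cv0 Hcv]] := tn_lower (ltW r00).
have [cm [cm0 Hcm]] := mvn_lower.
pose eps := \prod_j ct j * cv ^+ n * cm.
have e0 : 0 < eps.
  rewrite /eps mulr_gt0// mulr_gt0 ?exprn_gt0// prodr_gt0// => j _.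
  by have [] := Hct j.
exists eps; split => // x x' /rr0 Vx bx; rewrite kdenE//.
pose IT (t : R) : R := (1 < t < 2)%R%:R.
pose IV (i : 'I_n) (t : R) : R := if y i then (0 < t < 1)%R%:R else (-1 < t <= 0)%R%:R.
have mI (b1 b2 : bool) (u v : R) : measurable_fun setT
   (fun t : R => (t \in Interval (BSide b1 u) (BSide b2 v))%:R : R).
  rewrite (_ : (fun t => _) = \1_[set` Interval (BSide b1 u) (BSide b2 v)])//.
  by apply/funext => t; rewrite indicE mem_setE.
have iI (b1 b2 : bool) (u v : R) : u < v -> v - u = 1 ->
   (\int[leb]_t ((t \in Interval (BSide b1 u) (BSide b2 v))%:R : R)%:E = 1)%E.
  move=> uv e; rewrite -(_ : \int[leb]_t (\1_[set` Interval (BSide b1 u) (BSide b2 v)] t)%:E = 1)%E.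
    by apply: eq_integral => t _; rewrite indicE mem_setE.
  by rewrite integral_indic//= setIT lebesgue_measure_itv/= lte_fin uv -EFinD e.
have ITE t : IT t = (t \in `]1, 2[%R)%:R by rewrite in_itv.
have IVE i t : IV i t = if y i then (t \in `]0, 1[%R)%:R else (t \in `]-1, 0]%R)%:R.
  by rewrite /IV; case: (y i); rewrite in_itv.
have mIT : measurable_fun setT IT by apply: (mfun_ext ITE); exact: mI.
have mIV i : measurable_fun setT (IV i).
  by apply: (mfun_ext (IVE i)); case: (y i); exact: mI.
have IT0 t : 0 <= IT t by exact: ler0n.
have IV0 i t : 0 <= IV i t by rewrite /IV; case: ifP.
have IT1 : (\int[leb]_t (IT t)%:E = 1)%E.
  by under eq_integral do rewrite ITE; apply: iI; lra.
have IV1 i : (\int[leb]_t (IV i t)%:E = 1)%E.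
  by under eq_integral do rewrite IVE; case: (y i); apply: iI; lra.
have EV : (\int[lebK R n]_v (\prod_i IV i (tnth v i))%:E = 1)%E by exact: lebK_prod_one.
have ET : (\int[lebK R r]_v (\prod_i IT (tnth v i))%:E = 1)%E by exact: (lebK_prod_one (f := fun=> IT)).
have mV : measurable_fun setT (fun v : n.-tuple R => \prod_i IV i (tnth v i)).
  by apply: measurable_prod => i _; exact: (measurableT_comp (mIV i) (measurable_tnth i)).
have mT : measurable_fun setT (fun v : r.-tuple R => \prod_i IT (tnth v i)).
  by apply: measurable_prod => i _; exact: (measurableT_comp mIT (measurable_tnth i)).
have PV0 v : 0 <= \prod_i IV i (tnth v i) by exact: prodr_ge0.
have PT0 (v : r.-tuple R) : 0 <= \prod_i IT (tnth v i) by exact: prodr_ge0.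
have mk tau : measurable_fun setT (fun v => (kint X Z y a b x x' tau v)%:E).
  by apply/measurable_EFinP; apply: measurable_kint.
have k0 tau v : (0 <= (kint X Z y a b x x' tau v)%:E)%E by rewrite lee_fin kint_ge0.
have mkk : measurable_fun setT (fun tau => \int[lebK R n]_v (kint X Z y a b x x' tau v)%:E)%E.
  by apply: measurable_int2 => //; apply/measurable_EFinP; apply: measurable_kint.
rewrite -[leLHS]mule1 -[X in (_ * X <= _)%E]ET -intZl ?lee_fin ?(ltW e0)//.
apply: int_le => //.
  by move=> tau; rewrite mule_ge0 ?lee_fin ?(ltW e0).
move=> tau; rewrite -EFinM -[leLHS]mule1 -[X in (_ * X <= _)%E]EV -intZl//; last first.
  by rewrite lee_fin mulr_ge0// ltW.
apply: int_le => //.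
  by move=> v; rewrite mule_ge0 ?lee_fin// mulr_ge0// ltW.
move=> v; rewrite -EFinM lee_fin.
have [ht|] := boolP [forall j, 1 < tnth tau j < 2]; last first.
  rewrite negb_forall => /existsP[j hj]; rewrite (bigD1 j)//= /IT (negbTE hj) mul0r mulr0 mul0r.
  exact: kint_ge0.
have [hv|] := boolP [forall i, IV i (tnth v i) != 0]; last first.
  rewrite negb_forall => /existsP[j]; rewrite negbK => /eqP hj.
  rewrite [X in _ * X](bigD1 j)//= hj mul0r mulr0.
  exact: kint_ge0.
move/forallP: ht => ht; move/forallP: hv => hv.
have tv i : tn_set (y i) (tnth v i) /\ `|tnth v i| <= 1.
  have := hv i; rewrite /IV /tn_set; case: (y i) => /=.
    by rewrite pnatr_eq0 eqb0 negbK => /andP[v0 v1]; rewrite gtr0_norm// ltW.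
  rewrite pnatr_eq0 eqb0 negbK => /andP[v0 v1].
  by rewrite ler0_norm//; split => //; lra.
have IT11 : \prod_j IT (tnth tau j) = 1 by rewrite big1// => j _; rewrite /IT ht.
have IV11 : \prod_i IV i (tnth v i) <= 1.
  rewrite [leRHS](_ : 1 = \prod_(i < n) 1); last by rewrite big1.
  by apply: ler_prod => i _; rewrite IV0/= /IV; case: ifP => _; rewrite lern1 leq_b1.
rewrite IT11 mulr1; apply: (@le_trans _ _ eps).
  by rewrite ler_piMr// ltW.
rewrite /eps /kint; apply: ler_pM.
- rewrite mulr_ge0 ?exprn_ge0 ?(ltW cv0)// prodr_ge0// => j _; by have [/ltW] := Hct j.
- exact: ltW.
- apply: ler_pM.
  + by rewrite prodr_ge0// => j _; have [/ltW] := Hct j.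
  + by rewrite exprn_ge0// ltW.
  + rewrite tau_condE//; apply: ler_prod => j _; have [/ltW c0 H] := Hct j.
    by rewrite c0/= H.
  rewrite -[n in cv ^+ n]card_ord -prodr_const; apply: ler_prod => i _.
  by rewrite (ltW cv0)/=; have [? ?] := tv i; exact: Hcv.
by apply: Hcm => // i; have [] := tv i.
Qed.

End Minor.

(** * The posterior *)

Section Nonzero.
Variables (R : realType) (k : nat).
Notation leb := (@lebesgue_measure R).

Definition nz (t : k.-tuple R) : Prop := forall i, tnth t i != 0.

Lemma ae_nz : {ae lebK R k, forall t, nz t}.
Proof.
rewrite /nz; apply: filter_forall => i.
have mS : measurable [set t : k.-tuple R | tnth t i = 0].
  have := @measurable_tnth _ (measurableTypeR R) k i measurableT [set 0] (measurable_set1 _).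
  by rewrite setTI.
exists [set t : k.-tuple R | tnth t i = 0]; split => //; last by move=> t /= /negP; rewrite negbK => /eqP.
transitivity (\int[lebK R k]_t (\1_[set t : k.-tuple R | tnth t i = 0] t)%:E)%E.
  by rewrite integral_indic ?setIT.
pose f (j : 'I_k) (x : R) : \bar R := (if j == i then \1_[set 0] x else 1)%:E.
transitivity (\int[lebK R k]_t (\prod_(j < k) f j (tnth t j)))%E.
  apply: eq_integral => t _; rewrite (bigD1 i)//= big1 ?mule1.
    by rewrite /f eqxx !indicE; congr (_%:R)%:E; apply/idP/idP; rewrite !inE.
  by move=> j ji; rewrite /f (negbTE ji).
rewrite lebK_prod.
- rewrite (bigD1 i)//= /f eqxx.
  rewrite [X in (X * _)%E](_ : _ = 0%E) ?mul0e//.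
  by rewrite integral_indic//= setIT; exact: lebesgue_measure_set1.
- by move=> j; rewrite /f; case: eqP => _; apply/measurable_EFinP.
- by move=> j x; rewrite /f; case: eqP => _; rewrite lee_fin.
Qed.

Lemma eq_int_nz (f g : k.-tuple R -> \bar R) : measurable_fun setT f -> measurable_fun setT g ->
  (forall x, 0 <= f x)%E -> (forall x, 0 <= g x)%E -> (forall x, nz x -> f x = g x) ->
  (\int[lebK R k]_x f x = \int[lebK R k]_x g x)%E.
Proof.
move=> mf mg f0 g0 fg; apply: ge0_ae_eq_integral => //.
by apply: filterS ae_nz => x h _; exact: fg.
Qed.

Lemma le_int_nz (f g : k.-tuple R -> \bar R) : measurable_fun setT f -> measurable_fun setT g ->
  (forall x, 0 <= f x)%E -> (forall x, 0 <= g x)%E -> (forall x, nz x -> (f x <= g x)%E) ->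
  (\int[lebK R k]_x f x <= \int[lebK R k]_x g x)%E.
Proof.
move=> mf mg f0 g0 fg; apply: ae_ge0_le_integral => //.
by apply: filterS ae_nz => x h _; exact: fg.
Qed.

Lemma lebK_prod_fin (f : 'I_k -> R -> R) :
  (forall i, measurable_fun setT (f i)) -> (forall i x, 0 <= f i x) ->
  (forall i, (\int[leb]_x (f i x)%:E < +oo)%E) ->
  (\int[lebK R k]_t (\prod_(i < k) f i (tnth t i))%:E < +oo)%E.
Proof.
move=> mf f0 f1; under eq_integral do rewrite -prodEFin.
have I0 i : (0 <= \int[leb]_x (f i x)%:E)%E by apply: int_ge0 => x; rewrite lee_fin.
rewrite (@lebK_prod R k (fun i x => (f i x)%:E)).
- apply: (@proj2 (0 <= \prod_(i < k) \int[leb]_x (f i x)%:E)%E).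
  apply: (big_ind (fun z : \bar R => 0 <= z /\ z < +oo)%E) => //.
  + by split => //; rewrite ltry.
  + move=> z1 z2 [h1 h2] [h3 h4]; split; first exact: mule_ge0.
    by rewrite lte_mul_pinfty// ge0_fin_numE.
- by move=> i; apply/measurable_EFinP.
- by move=> i x; rewrite lee_fin.
Qed.

End Nonzero.

Section Moments.
Variables (R : realType) (n p r : nat) (qj : 'I_r -> nat).
Local Notation q := (qsum qj).
Local Notation d := (p + q)%N.
Variables (X : 'M[R]_(n, p)) (Z : 'M[R]_(n, q)) (y : 'I_n -> bool) (a b : 'I_r -> R).
Notation W := (W X Z).
Notation lin := (lin X Z).
Hypothesis shp0 : forall j, 0 < tau_shape qj a j.
Hypothesis rkW : \rank W = d.
Notation rate := (tau_rate (p := p) (qj := qj) b).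
Notation shp := (tau_shape qj a).
Notation blk := (@blk p r qj).
Notation V := (lyapunov X Z a b).
Hypothesis hab : forall j, (a j < 0 /\ b j = 0) \/ 0 < b j.
Hypothesis qj0 : forall j, (0 < qj j)%N.
Hypothesis A2 : exists e : 'rV[R]_n, (forall i, 0 < e 0 i) /\ e *m Wstar X Z y = 0.

Lemma blk_disj (j l : 'I_r) i : i \in blk j -> i \in blk l -> j = l.
Proof.
move=> /mapP[k1]; rewrite mem_enum => h1 -> /mapP[k2]; rewrite mem_enum => h2 /rshift_inj e.
by apply: (inblk_disj h1); rewrite e.
Qed.

Lemma nz_usq (x : d.-tuple R) j : nz x -> 0 < usq x j.
Proof.
move=> hx; have : (0 < size (blk j))%N by rewrite size_blk qj0.
rewrite usq_blk; case: (blk j) => //= i s _; rewrite big_cons ltr_pwDl//.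
  by rewrite mxE lt_neqAle sqr_ge0 andbT eq_sym sqrf_eq0 hx.
by apply: sumr_ge0 => k _; exact: sqr_ge0.
Qed.

Lemma nz_good (x : d.-tuple R) : nz x -> good (qj := qj) b x.
Proof.
move=> hx; apply/forallP => j; have u0 := nz_usq j hx.
by rewrite /tau_rate; have [[_ ->]|b0] := hab j; [rewrite add0r divr_gt0|rewrite addr_gt0// divr_gt0].
Qed.

Lemma usq_powR_le (x : d.-tuple R) j (s : R) : nz x -> 0 <= s ->
  usq x j `^ (- s) <= \prod_(i <- blk j) `|tnth x i| `^ (- (2 * s / (qj j)%:R)).
Proof.
move=> hx s0; have u0 := nz_usq j hx.
have q0 : (qj j)%:R != 0 :> R by rewrite pnatr_eq0 -lt0n.
pose th := s / (qj j)%:R; have th0 : 0 <= th by rewrite divr_ge0.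
have -> : usq x j `^ (- s) = \prod_(i <- blk j) usq x j `^ (- th).
  rewrite big_const_seq count_predT size_blk -Monoid.iteropE -[LHS]/(usq x j `^ (- s)).
  rewrite -/(_ ^+ _) -powR_mulrn ?powR_ge0// -powRrM; congr (_ `^ _).
  by rewrite /th; field.
rewrite big_seq [leRHS]big_seq; apply: ler_prod => i ib; rewrite powR_ge0/=.
have x0 : 0 < `|tnth x i| by rewrite normr_gt0 hx.
rewrite (_ : - (2 * s / (qj j)%:R) = 2 * - th); last by rewrite /th; field.
rewrite powRrM powR_mulrn ?(ltW x0)//.
have h : `|tnth x i| ^+ 2 <= usq x j.
  rewrite real_normK ?num_real// usq_blk (big_rem i)//= mxE lerDl.
  by apply: sumr_ge0 => l _; exact: sqr_ge0.
have x20 : 0 < `|tnth x i| ^+ 2 by rewrite exprn_gt0.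
by rewrite !powRN lef_pV2 ?posrE ?powR_gt0// ge0_ler_powR// nnegrE ltW.
Qed.

(* Bounding [usq x j] below by the geometric mean of the squared coordinates of block [j] turns the integrand into a product
   of one-dimensional functions [|z|^-t e^(-de z^2)] with [t < 1]. *)
Lemma moment_fin (de : R) (s : 'I_r -> R) : 0 < de ->
  (forall j, 0 <= s j /\ s j < (qj j)%:R / 2) ->
  (\int[lebK R d]_x (expR (- (de * nsq (tcol x))) * \prod_j usq x j `^ (- s j))%:E < +oo)%E.
Proof.
move=> de0 hs; pose th j := 2 * s j / (qj j)%:R.
have th0 j : 0 <= th j by have [? ?] := hs j; rewrite divr_ge0 ?mulr_ge0.
have th1 j : th j < 1.
  have [_ h] := hs j; rewrite /th ltr_pdivrMr ?ltr0n// mul1r mulrC.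
  by rewrite -ltr_pdivlMr.
pose g (i : 'I_d) (z : R) : R := expR (- (de * z ^+ 2)) * \prod_(j | i \in blk j) `|z| `^ (- th j).
have gE i : exists t : R, [/\ 0 <= t, t < 1 & forall z, g i z = `|z| `^ (- t) * expR (- (de * z ^+ 2))].
  have [j ij|none] := pickP (fun j => i \in blk j).
    exists (th j); split => // z; rewrite /g (bigD1 j)//= big1 ?mulr1 1?mulrC// => l /andP[il].
    by rewrite (blk_disj ij il) eqxx.
  exists 0; split => // z; rewrite /g big_pred0 // mulrC oppr0 powRr0//.
have g0 i z : 0 <= g i z.
  by have [t [_ _ ->]] := gE i; rewrite mulr_ge0 ?powR_ge0 ?expR_ge0.
have mg i : measurable_fun setT (g i).
  have [t [_ _ H]] := gE i; apply: (mfun_ext H).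
  by meas.
apply: (@le_lt_trans _ _ (\int[lebK R d]_x (\prod_(i < d) g i (tnth x i))%:E)%E); last first.
  apply: lebK_prod_fin => // i; have [t [t0 t1 H]] := gE i.
  under eq_integral do rewrite H.
  exact: abs_gauss_int.
have mN := @measurable_nsq R d.
have mU : measurable_fun setT (fun x : d.-tuple R => \prod_j usq x j `^ (- s j)).
  apply: measurable_prod => j _.
  by move: (measurable_usq j (@measurable_id _ (d.-tuple R) setT)) => ?; meas.
have mG : measurable_fun setT (fun x : d.-tuple R => \prod_(i < d) g i (tnth x i)).
  by apply: measurable_prod => i _; exact: (measurableT_comp (mg i) (measurable_tnth i)).
have U0 (x : d.-tuple R) : 0 <= \prod_j usq x j `^ (- s j) by apply: prodr_ge0 => j _; exact: powR_ge0.
apply: le_int_nz.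
- by meas.
- by meas.
- by move=> x; rewrite lee_fin mulr_ge0 ?expR_ge0.
- by move=> x; rewrite lee_fin prodr_ge0.
move=> x hx; rewrite lee_fin /g big_split/=; apply: ler_pM => //.
  rewrite -expR_sum ler_expR le_eqVlt; apply/orP; left; apply/eqP.
  by rewrite /nsq mulr_sumr -sumrN; apply: eq_bigr => i _; rewrite mxE.
rewrite (exchange_big_dep xpredT)//=; apply: ler_prod => j _; rewrite powR_ge0/=.
apply: (le_trans (usq_powR_le j hx (proj1 (hs j)))).
by rewrite big_uniq ?blk_uniq.
Qed.

Lemma ZT_prod_le : exists de : R, 0 < de /\ forall eta : d.-tuple R,
  lik X Z y eta <= expR (- (de * nsq (W *m tcol eta))).
Proof.
have [C [C0 HC]] := right_le_wrong A2.
have C1 : 0 < 1 + C by rewrite ltr_pwDl.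
exists ((2 * (1 + C))^-1); split; first by rewrite invr_gt0 mulr_gt0.
move=> eta; rewrite likE.
pose rs i := right_sign (y i) (lin eta i).
apply: (@le_trans _ _ (\prod_i (if rs i then 1 else expR (- (lin eta i ^+ 2 / 2))))).
  apply: ler_prod => i _; rewrite ZT_ge0/=; case: ifPn => h; first exact: ZT_le1.
  apply: ZT_wrong; move: h; rewrite /rs /right_sign; case: (y i); rewrite -ltNge; exact: ltW.
have -> : \prod_i (if rs i then 1 else expR (- (lin eta i ^+ 2 / 2))) =
   expR (- (\sum_(i | ~~ rs i) lin eta i ^+ 2) / 2).
  rewrite mulNr mulr_suml -sumrN expR_sum [RHS]big_mkcond/=; apply: eq_bigr => i _.
  by case: (rs i).
rewrite ler_expR mulNr lerN2 /nsq [\sum_(i < n) _](bigID rs)/=; have := HC eta.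
set P := (X in X <= _); set N := (X in _ * X) => h.
have -> : \sum_(i < n | rs i) (W *m tcol eta) i 0 ^+ 2 = P by [].
have -> : \sum_(i < n | ~~ rs i) (W *m tcol eta) i 0 ^+ 2 = N by [].
rewrite mulrC ler_pdivrMr ?mulr_gt0// ; lra.
Qed.

Lemma lik_le : exists de K : R, [/\ 0 < de, 0 <= K & forall eta : d.-tuple R,
  lik X Z y eta * (1 + nsq (W *m tcol eta)) <= K * expR (- (de * nsq (tcol eta)))].
Proof.
have [d1 [d10 H1]] := ZT_prod_le; have [ka [ka0 H2]] := nsqW_lower rkW.
exists (d1 / 2 * ka), (1 + 2 / d1); split.
- by rewrite mulr_gt0// divr_gt0.
- by rewrite addr_ge0// divr_ge0// ltW.
move=> eta; have := H1 eta; have := H2 eta; have := nsq_ge0 (W *m tcol eta).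
set N := nsq (W *m tcol eta) => N0 h2 h1.
apply: (@le_trans _ _ (expR (- (d1 * N)) * (1 + N))); first by rewrite ler_wpM2r// addr_ge0.
have -> : - (d1 * N) = - (d1 / 2 * N) - (d1 / 2 * N) by field.
rewrite expRD -mulrA [leRHS]mulrC; apply: ler_pM; rewrite ?expR_ge0//.
- by rewrite mulr_ge0 ?expR_ge0// addr_ge0.
- by rewrite ler_expR lerN2 -mulrA; apply: ler_wpM2l => //; apply: divr_ge0 => //; exact: ltW.
rewrite mulrDr mulr1; apply: lerD.
  by rewrite -expR0 ler_expR oppr_le0 mulr_ge0// divr_ge0// ltW.
rewrite expRN mulrC ler_pdivrMr ?expR_gt0// mulrAC ler_pdivlMr//.
have := expR_ge1Dx (d1 / 2 * N); lra.
Qed.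

Definition sig (j : 'I_r) : R := if b j == 0 then shp j else 0.

Lemma sig_bound j : 0 <= sig j /\ sig j < (qj j)%:R / 2.
Proof.
rewrite /sig; case: eqP => h; last by split => //; rewrite divr_gt0// ltr0n.
split; first exact/ltW/shp0.
have [[a0 _]|] := hab j; last by rewrite h ltxx.
by rewrite /tau_shape gtrDr.
Qed.

Lemma rates_le : exists K : R, 0 <= K /\ forall eta : d.-tuple R,
  \prod_j (cpi R qj j * (Gam (shp j) * rate eta j `^ (- shp j))) <= K * \prod_j usq eta j `^ (- sig j).
Proof.
pose k j := cpi R qj j * (Gam (shp j) * (if b j == 0 then 2^-1 `^ (- shp j) else b j `^ (- shp j))).
have c0 j : 0 <= cpi R qj j by exact: powR_ge0.
have G0 j : 0 <= Gam (shp j) by exact/ltW/Gam_gt0.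
exists (\prod_j k j); split.
  by apply: prodr_ge0 => j _; rewrite mulr_ge0// mulr_ge0//; case: ifP => _; exact: powR_ge0.
move=> eta; rewrite -big_split/=; apply: ler_prod => j _.
rewrite mulr_ge0 ?mulr_ge0 ?powR_ge0//= /k -!mulrA ler_wpM2l// ler_wpM2l//.
have u0 := usq_ge0 eta j.
rewrite /sig /tau_rate; case: eqP => bj.
  by rewrite bj add0r powRM// mulrC.
have b0 : 0 < b j by have [[_ //]|] := hab j.
rewrite oppr0 powRr0 mulr1 !powRN lef_pV2 ?posrE ?powR_gt0//; last by rewrite ltr_wpDr// divr_ge0.
apply: ge0_ler_powR; rewrite ?nnegrE ?(ltW b0) ?(ltW (shp0 j))//; first by rewrite addr_ge0 ?divr_ge0// ltW.
by rewrite lerDl divr_ge0.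
Qed.

Lemma measurable_lik : measurable_fun setT (fun x : d.-tuple R => lik X Z y x).
Proof.
apply: (mfun_ext (likE X Z y)); apply: measurable_prod => i _.
exact: (measurableT_comp (measurable_ZT _) (measurable_lin X Z i (@measurable_id _ (d.-tuple R) setT))).
Qed.

Lemma measurable_marg : measurable_fun setT (marg X Z y a b).
Proof.
apply: measurable_funM; first exact: measurable_lik.
apply: measurable_prod => j _; apply: measurable_funM => //; apply: measurable_funM => //.
by move: (measurable_rate b j (@measurable_id _ (d.-tuple R) setT)) => ?; meas.
Qed.

Lemma marg_moment : (\int[lebK R d]_x (marg X Z y a b x * (1 + V x))%:E < +oo)%E.
Proof.
have [de [K [de0 K0 HK]]] := lik_le; have [K' [K'0 HK']] := rates_le.
pose G (s : 'I_r -> R) (x : d.-tuple R) : R := expR (- (de * nsq (tcol x))) * \prod_j usq x j `^ (- s j).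
pose sg (l j : 'I_r) : R := if j == l then sig l - a l / 2 else sig j.
have G0 s x : 0 <= G s x.
  by rewrite mulr_ge0 ?expR_ge0// prodr_ge0// => j _; exact: powR_ge0.
have mG s : measurable_fun setT (G s).
  have mN := @measurable_nsq R d.
  have mU : measurable_fun setT (fun x : d.-tuple R => \prod_j usq x j `^ (- s j)).
    apply: measurable_prod => j _.
    by move: (measurable_usq j (@measurable_id _ (d.-tuple R) setT)) => ?; meas.
  by rewrite /G; meas.
have sgb l : b l = 0 -> forall j, 0 <= sg l j /\ sg l j < (qj j)%:R / 2.
  move=> bl j; rewrite /sg; case: eqP => [->|_]; last exact: sig_bound.
  have [[a0 _]|] := hab l; last by rewrite bl ltxx.
  have s0 := shp0 l; rewrite /sig bl eqxx; move: s0; rewrite /tau_shape; lra.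
have l0 x : 0 <= lik X Z y x by rewrite likE prodr_ge0// => i _; exact: ZT_ge0.
have key x : marg X Z y a b x * (1 + V x) <= K * K' * (G sig x + \sum_(l | b l == 0) G (sg l) x).
  have nW := nsq_ge0 (W *m tcol x).
  have e0 := expR_ge0 (- (de * nsq (tcol x))).
  have U0 : 0 <= \prod_j usq x j `^ (- sig j) by rewrite prodr_ge0// => j _; exact: powR_ge0.
  rewrite /marg /lyapunov addrA mulrDr.
  rewrite [K * K' * _]mulrDr; apply: lerD.
    rewrite mulrAC /G (_ : K * K' * _ = K * expR (- (de * nsq (tcol x))) * (K' * \prod_j usq x j `^ (- sig j))); last first.
      by move: (\prod_j _) (expR _) => z1 z2; ring.
    apply: ler_pM; [by rewrite mulr_ge0// addr_ge0| |exact: HK|exact: HK'].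
    rewrite prodr_ge0// => j _; rewrite mulr_ge0 ?powR_ge0// mulr_ge0 ?powR_ge0//.
    by rewrite ltW ?Gam_gt0.
  rewrite !mulr_sumr; apply: ler_sum => l /eqP bl.
  have [[al _]|] := hab l; last by rewrite bl ltxx.
  have lk : lik X Z y x <= K * expR (- (de * nsq (tcol x))).
    by apply: le_trans (HK x); rewrite ler_peMr// lerDl.
  apply: (@le_trans _ _ (K * expR (- (de * nsq (tcol x))) * (K' * \prod_j usq x j `^ (- sig j)) * usq x l `^ (a l / 2))).
    rewrite ler_wpM2r ?powR_ge0//; apply: ler_pM => //.
    rewrite prodr_ge0// => j _; rewrite mulr_ge0 ?powR_ge0// mulr_ge0 ?powR_ge0//.
    by rewrite ltW ?Gam_gt0.
  rewrite /G (_ : K * _ * _ * _ = K * K' * (expR (- (de * nsq (tcol x))) * (\prod_j usq x j `^ (- sig j) * usq x l `^ (a l / 2)))); last first.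
    by move: (\prod_j _) (expR _) => z1 z2; ring.
  apply: ler_wpM2l; first exact: mulr_ge0.
  apply: ler_wpM2l => //.
  rewrite (bigD1 l)//= [leRHS](bigD1 l)//= mulrAC; apply: ler_pM.
  - by rewrite mulr_ge0 ?powR_ge0.
  - by rewrite prodr_ge0// => j _; exact: powR_ge0.
  - rewrite /sg eqxx opprB; have := usq_ge0 x l; rewrite le0r => /orP[/eqP->|u0].
      rewrite [X in X * _]powR0 ?mul0r ?powR_ge0//.
      by rewrite /sig bl eqxx oppr_eq0 gt_eqF.
    by rewrite -powRD ?(gt_eqF u0) ?implybT// addrC.
  rewrite le_eqVlt; apply/orP; left; apply/eqP; apply: eq_bigr => j jl.
  by rewrite /sg (negbTE jl).
have Gfin s : (forall j, 0 <= s j /\ s j < (qj j)%:R / 2) -> (\int[lebK R d]_x (G s x)%:E < +oo)%E.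
  exact: moment_fin.
have mV := measurable_V X Z a b (qj := qj).
have mm := measurable_marg.
have V0 := V_ge0 X Z a b (qj := qj).
have mf0 x : 0 <= marg X Z y a b x by exact: marg_ge0.
have mS : measurable_fun setT (fun x => \sum_(l | (b l == 0)%R) (G (sg l) x)%:E)%E.
  under eq_fun do rewrite big_mkcond.
  apply: emeasurable_sum => l; case: (b l == 0); last exact: measurable_cst.
  by apply/measurable_EFinP.
have S0 x : (0 <= \sum_(l | (b l == 0)%R) (G (sg l) x)%:E)%E.
  by apply: sume_ge0 => l _; rewrite lee_fin.
apply: (@le_lt_trans _ _ (\int[lebK R d]_x ((K * K')%:E * ((G sig x)%:E + \sum_(l | (b l == 0)%R) (G (sg l) x)%:E)))%E).
  apply: int_le => //.
    by move=> x; rewrite lee_fin mulr_ge0// addr_ge0.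
  by move=> x; rewrite sumEFin -EFinD -EFinM lee_fin.
rewrite intZl ?lee_fin ?mulr_ge0//; last first.
  by move=> x; rewrite adde_ge0// lee_fin.
rewrite lte_mul_pinfty ?lee_fin ?mulr_ge0//.
rewrite intD//; last by move=> x; rewrite lee_fin.
apply: lte_add_pinfty; first exact/Gfin/sig_bound.
under eq_integral do rewrite big_mkcond.
rewrite ge0_integral_sum//; last first.
  by move=> l x _; case: ifP => _ //; rewrite lee_fin.
apply: lte_sum_pinfty => l _; have [bl|bl] := eqVneq (b l) 0%R; first exact/Gfin/sgb.
by rewrite integral0 ltry.
Qed.

End Moments.

Section Posterior.
Variables (R : realType) (n p r : nat) (qj : 'I_r -> nat).
Local Notation q := (qsum qj).
Local Notation d := (p + q)%N.
Variables (X : 'M[R]_(n, p)) (Z : 'M[R]_(n, q)) (y : 'I_n -> bool) (a b : 'I_r -> R).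
Notation W := (W X Z).
Hypothesis shp0 : forall j, 0 < tau_shape qj a j.
Hypothesis rkW : \rank W = d.
Notation V := (lyapunov X Z a b).
Notation marg := (marg X Z y a b).
Notation kden := (kden X Z y a b).
Notation post_un := (post_un X Z y a b).
Hypothesis hab : forall j, (a j < 0 /\ b j = 0) \/ 0 < b j.
Hypothesis qj0 : forall j, (0 < qj j)%N.
Hypothesis A2 : exists e : 'rV[R]_n, (forall i, 0 < e 0 i) /\ e *m Wstar X Z y = 0.

Lemma measurable_post_un :
  measurable_fun setT (fun z : d.-tuple R * r.-tuple R => post_un z.1 z.2).
Proof.
apply: measurable_funM; first exact: (measurableT_comp (measurable_lik X Z y)).
apply: (mfun_ext (fun z => prior_utE a b z.1 z.2)).
apply: measurable_prod => j _; apply: measurable_funM => //.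
have m1 := measurable_rate b j (@measurable_fst _ _ (d.-tuple R) (r.-tuple R)).
have m2 : measurable_fun setT (fun z : d.-tuple R * r.-tuple R => tnth z.2 j).
  exact: (measurableT_comp (measurable_tnth j)).
by rewrite /gamma_un; meas.
Qed.

Lemma post_un_ge0 (eta : d.-tuple R) tau : 0 <= post_un eta tau.
Proof.
rewrite /Defs.post_un likE prior_utE; apply: mulr_ge0; apply: prodr_ge0 => i _.
  exact: ZT_ge0.
by rewrite mulr_ge0 ?powR_ge0 ?gamma_un_ge0.
Qed.

Lemma post_unE (f : d.-tuple R -> R) : measurable_fun setT f -> (forall x, 0 <= f x) ->
  (lebint (fun eta : d.-tuple R => ((f eta)%:E * lebint (fun tau : r.-tuple R => (post_un eta tau)%:E)))
   = \int[lebK R d]_x (marg x * f x)%:E)%E.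
Proof.
move=> mf f0.
have p0 eta tau : (0 <= (post_un eta tau)%:E)%E by rewrite lee_fin post_un_ge0.
have mp : measurable_fun setT (fun z : d.-tuple R * r.-tuple R => (post_un z.1 z.2)%:E).
  by apply/measurable_EFinP; exact: measurable_post_un.
have mI : measurable_fun setT (fun eta => \int[lebK R r]_tau (post_un eta tau)%:E)%E.
  exact: (@measurable_int2 _ _ _ _ _ (lebK R r) (fun eta tau => (post_un eta tau)%:E)).
have I0 eta : (0 <= \int[lebK R r]_tau (post_un eta tau)%:E)%E by exact: int_ge0.
have mf0 x : 0 <= marg x by exact: marg_ge0.
have mm : measurable_fun setT marg by exact: measurable_marg.
rewrite (_ : (fun eta => _) = fun eta => ((f eta)%:E * \int[lebK R r]_tau (post_un eta tau)%:E)%E); last first.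
  apply/funext => eta; congr (_ * _)%E; apply: lebintE => //.
  exact: (measurableT_comp mp (measurable_pair1 eta)).
have mf' : measurable_fun setT (fun eta => ((f eta)%:E * \int[lebK R r]_tau (post_un eta tau)%:E)%E).
  by apply: emeasurable_funM => //; apply/measurable_EFinP.
rewrite lebintE//; last by move=> eta; rewrite mule_ge0 ?lee_fin.
apply: eq_int_nz => //.
- by move=> eta; rewrite mule_ge0 ?lee_fin.
- by move=> x; rewrite lee_fin mulr_ge0.
by move=> x /(nz_good hab qj0) g; rewrite (marg_int X Z y shp0 g) -EFinM mulrC.
Qed.

Lemma post_normE : post_norm X Z y a b = (\int[lebK R d]_x (marg x)%:E)%E.
Proof.
rewrite /post_norm; have := @post_unE (cst 1) (@measurable_cst _ _ _ _ setT (1 : R)) (fun=> ler01).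
rewrite (_ : (fun eta => _) = fun eta => lebint (fun tau => (post_un eta tau)%:E)) => [->|].
  by apply: eq_integral => x _; rewrite mulr1.
by apply/funext => eta; rewrite mul1e.
Qed.

Lemma post_norm_fin : (0 < post_norm X Z y a b < +oo)%E.
Proof.
rewrite post_normE.
have mf0 x : 0 <= marg x by exact: marg_ge0.
have mm : measurable_fun setT marg by exact: measurable_marg.
have mV : measurable_fun setT V by exact: measurable_V.
have V0 x : 0 <= V x by exact: V_ge0.
have mE : measurable_fun setT (EFin \o marg) by apply/measurable_EFinP.
apply/andP; split; last first.
  apply: le_lt_trans (marg_moment shp0 rkW hab qj0 A2).
  apply: int_le => // x.
  by rewrite lee_fin ler_peMr// lerDl.
rewrite lt_neqAle int_ge0 ?andbT; last by move=> x; rewrite lee_fin.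
apply/eqP => /esym I0.
have : (\int[lebK R d]_x `|(marg x)%:E| = 0)%E.
  by under eq_integral do rewrite gee0_abs ?lee_fin//.
move=> /(ae_eq_integral_abs (lebK R d) measurableT mE) H.
have : {ae lebK R d, forall x : d.-tuple R, False}.
  apply: filterS2 H (ae_nz R d) => x /= /(_ I) [] h /(nz_good hab qj0) g.
  by have := marg_gt0 X Z y shp0 g; rewrite h ltxx.
move=> [N [mN N0 sub]].
have : (lebK R d (@ubox R p r qj) <= lebK R d N)%E.
  apply: le_measure; rewrite ?inE//; first exact: ubox_measurable.
  by move=> x _; exact: sub.
by rewrite N0 ubox1 lee_fin ler10.
Qed.

Let N : R := fine (post_norm X Z y a b).

Let NE : (post_norm X Z y a b = N%:E)%E.
Proof.
by have /andP[h1 h2] := post_norm_fin; rewrite /N fineK// ge0_fin_numE// ltW.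
Qed.

Let N0 : 0 < N.
Proof. by have /andP[] := post_norm_fin; rewrite NE lte_fin. Qed.

Definition post_dens (x : d.-tuple R) : \bar R := (marg x / N)%:E.

Lemma posteriorE O : measurable O ->
  posterior X Z y a b O = (\int[lebK R d]_x (post_dens x * (\1_O x)%:E))%E.
Proof.
move=> mO; rewrite /posterior post_unE//.
have mm : measurable_fun setT marg by exact: measurable_marg.
have mI : measurable_fun setT (\1_O : d.-tuple R -> R) by [].
have mf0 x : 0 <= marg x by exact: marg_ge0.
rewrite -intZr//.
- by apply: eq_integral => x _; rewrite -!EFinM /post_dens -/N mulrAC.
- by rewrite lee_fin invr_ge0 ltW.
- by move=> x; rewrite lee_fin mulr_ge0.
Qed.

Lemma invariant (f : d.-tuple R -> R) : measurable_fun setT f -> (forall x, 0 <= f x <= 1) ->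
  (\int[lebK R d]_x (post_dens x * \int[lebK R d]_y (kden x y * (f y)%:E)) =
   \int[lebK R d]_x (post_dens x * (f x)%:E))%E.
Proof.
move=> mf f01; have f0 x : 0 <= f x by have /andP[] := f01 x.
have mm : measurable_fun setT marg by exact: measurable_marg.
have mf0 x : 0 <= marg x by exact: marg_ge0.
have mp : measurable_fun setT post_dens.
  by apply/measurable_EFinP; apply: measurable_funM => //; exact: measurable_cst.
have p0 x : (0 <= post_dens x)%E by rewrite lee_fin divr_ge0// ltW.
have mk : measurable_fun setT (fun z : d.-tuple R * d.-tuple R => kden z.1 z.2) by exact: measurable_kden.
have k0 x z : (0 <= kden x z)%E by exact: kden_ge0.
have mk1 x : measurable_fun setT (kden x) by exact: (measurableT_comp mk (measurable_pair1 x)).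
have mk2 x : measurable_fun setT (kden^~ x) by exact: (measurableT_comp mk (measurable_pair2 x)).
have mfE : measurable_fun setT (fun x => (f x)%:E) by apply/measurable_EFinP.
have fE0 x : (0 <= (f x)%:E)%E by rewrite lee_fin.
have m1 : measurable_fun setT (fun x => \int[lebK R d]_y (kden x y * (f y)%:E))%E.
  apply: (@measurable_int2 _ _ _ _ _ (lebK R d) (fun x y => (kden x y * (f y)%:E)%E)) => [|x z].
    by apply: emeasurable_funM => //; exact: (measurableT_comp mfE).
  by rewrite mule_ge0.
have m2 : measurable_fun setT (fun z : d.-tuple R * d.-tuple R => (post_dens z.2 * kden z.2 z.1 * (f z.2)%:E)%E).
  apply: emeasurable_funM; last exact: (measurableT_comp mfE).
  apply: emeasurable_funM; first exact: (measurableT_comp mp).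
  apply: (measurableT_comp mk (_ : measurable_fun setT (fun z : d.-tuple R * d.-tuple R => (z.2, z.1)))).
  exact: measurable_fun_pair.
have s0 x z : (0 <= post_dens z * kden z x * (f z)%:E)%E by rewrite mule_ge0// mule_ge0.
transitivity (\int[lebK R d]_x \int[lebK R d]_z (post_dens z * kden z x * (f z)%:E))%E.
  apply: eq_int_nz.
  - exact: emeasurable_funM.
  - exact: (@measurable_int2 _ _ _ _ _ (lebK R d) (fun x z => (post_dens z * kden z x * (f z)%:E)%E)).
  - by move=> x; rewrite mule_ge0// int_ge0// => z; rewrite mule_ge0.
  - by move=> x; exact: int_ge0.
  move=> x /(nz_good hab qj0) gx.
  have mkf : measurable_fun setT (fun z => kden x z * (f z)%:E)%E by exact: emeasurable_funM.
  have kf0 z : (0 <= kden x z * (f z)%:E)%E by rewrite mule_ge0.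
  rewrite -(intZl _ (p0 x) mkf kf0).
  apply: eq_int_nz.
  - by apply: emeasurable_funM => //; exact: emeasurable_funM.
  - by apply: emeasurable_funM => //; exact: emeasurable_funM.
  - by move=> z; rewrite mule_ge0// mule_ge0.
  - by move=> z.
  move=> z /(nz_good hab qj0) gz; rewrite muleA.
  have := reversible y shp0 rkW gx gz; rewrite /post_dens.
  move: (marg x) (marg z) (kden x z) (kden z x) (f z)%:E => A B k1 k2 g e.
  by congr (_ * _)%E; rewrite !(mulrC _ N^-1) !EFinM -!muleA e.
rewrite (@fubini_tonelli _ _ (d.-tuple R) (d.-tuple R) R (lebK R d) (lebK R d) (fun z => (post_dens z.2 * kden z.2 z.1 * (f z.2)%:E)%E))//=.
apply: eq_integral => z _.
have fp0 : (0 <= post_dens z * (f z)%:E)%E by rewrite mule_ge0.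
transitivity (\int[lebK R d]_x (post_dens z * (f z)%:E * kden z x))%E.
  by apply: eq_integral => x _; rewrite muleAC.
by rewrite (intZl _ fp0 (mk1 z) (k0 z)) kden_mass// mule1.
Qed.

End Posterior.

Theorem theorem2 (R : realType) (n p r : nat) (qj : 'I_r -> nat)
    (X : 'M[R]_(n, p)) (Z : 'M[R]_(n, qsum qj)) (y : 'I_n -> bool) (a b : 'I_r -> R) :
  (forall j, (0 < qj j)%N) ->
  (forall j, (a j < 0 /\ b j = 0) \/ 0 < b j) ->
  (* (A1) *) \rank (W X Z) = (p + qsum qj)%N ->
  (* (A2) *) (exists e : 'rV[R]_n, (forall i, 0 < e 0 i) /\ e *m Wstar X Z y = 0) ->
  (* (A3) *) (forall j, 0 < 2 * a j + (qj j)%:R) ->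
  (* the posterior is proper *)
  ((0 < post_norm X Z y a b)%E /\ (post_norm X Z y a b < +oo)%E) /\
  (* geometric ergodicity of the eta-marginal Gibbs chain w.r.t. the posterior *)
  exists t : R, 0 < t < 1 /\
  exists J : (p + qsum qj).-tuple R -> R, (forall x, 0 < J x) /\
  forall (x : (p + qsum qj).-tuple R) (m : nat) (O : set ((p + qsum qj).-tuple R)),
    measurable O ->
    (`| Kpow X Z y a b m x O - posterior X Z y a b O | <= (J x * t ^+ m)%:E)%E.
Proof.
move=> qj0 hab rkW A2 A3.
have shp0 j : 0 < tau_shape qj a j by have := A3 j; rewrite /tau_shape; lra.
have /andP[pn0 pn1] := post_norm_fin shp0 rkW hab qj0 A2; split; first by [].
have [rho [L [rho0 rho1 L0 dr]]] := drift shp0 rkW A2 qj0 hab.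
pose d := (p + qsum qj)%N; pose k := kden X Z y a b; pose N := fine (post_norm X Z y a b).
have N0 : 0 < N by rewrite fine_gt0// pn0.
have mk : measurable_fun setT (fun z : d.-tuple R * d.-tuple R => k z.1 z.2) by exact: measurable_kden.
have k0 x z : (0 <= k x z)%E by exact: kden_ge0.
have k1 x : (\int[lebK R d]_z k x z = 1)%E by exact: kden_mass.
have mV := @measurable_V R n p r qj X Z a b; have V0 := @V_ge0 R n p r qj X Z a b.
have mm : measurable_fun setT (marg X Z y a b) by exact: measurable_marg.
have mf0 x : 0 <= marg X Z y a b x by exact: marg_ge0.
have mpi : measurable_fun setT (post_dens X Z y a b).
  by apply/measurable_EFinP; apply: measurable_funM => //; exact: measurable_cst.
have pi0 x : (0 <= post_dens X Z y a b x)%E by rewrite lee_fin divr_ge0// ltW.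
have Ni0 : (0 <= (N^-1)%:E)%E by rewrite lee_fin invr_ge0 ltW.
have mfE0 x : (0 <= (marg X Z y a b x)%:E)%E by rewrite lee_fin.
have pi1 : (\int[lebK R d]_x post_dens X Z y a b x = 1)%E.
  rewrite /post_dens; under eq_integral do rewrite EFinM.
  have mE : measurable_fun setT (fun x => (marg X Z y a b x)%:E) by apply/measurable_EFinP.
  rewrite (intZr _ Ni0 mE mfE0) -(post_normE X Z y shp0 hab qj0).
  by rewrite -[post_norm _ _ _ _ _]fineK ?ge0_fin_numE ?ltW// -EFinM mulfV// gt_eqF.
have [PV piV] : exists PV : R, (\int[lebK R d]_x (post_dens X Z y a b x * (lyapunov X Z a b x)%:E) <= PV%:E)%E.
  set I := (\int[lebK R d]_x _)%E.
  suff : (I < +oo)%E.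
    have I0 : (0 <= I)%E by apply: int_ge0 => x; rewrite mule_ge0// lee_fin.
    by move=> I1; exists (fine I); rewrite fineK// ge0_fin_numE.
  have mF : measurable_fun setT (fun x => (marg X Z y a b x * (1 + lyapunov X Z a b x))%:E) by meas.
  have F0 x : (0 <= (marg X Z y a b x * (1 + lyapunov X Z a b x))%:E)%E by rewrite lee_fin mulr_ge0// addr_ge0.
  apply: (@le_lt_trans _ _ ((N^-1)%:E * \int[lebK R d]_x (marg X Z y a b x * (1 + lyapunov X Z a b x))%:E)%E).
    rewrite -(intZl _ Ni0 mF F0); apply: int_le.
    - by apply: emeasurable_funM => //; apply/measurable_EFinP.
    - exact: emeasurable_funM.
    - by move=> x; rewrite mule_ge0// lee_fin.
    move=> x; rewrite /post_dens -!EFinM lee_fin mulrC mulrA [leRHS]mulrA [leRHS]mulrC.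
    rewrite -/N [lyapunov _ _ _ _ _ * _]mulrC mulrAC [_^-1 * _]mulrC [leRHS]mulrC.
    apply: ler_wpM2l; first by rewrite divr_ge0// ltW.
    by rewrite lerDr.
  by rewrite lte_mul_pinfty//; exact: marg_moment.
have inv := invariant (y := y) shp0 rkW hab qj0 A2.
have [t [J [t01 [J0 H]]]] := harris mk k0 k1 mV V0 rho0 rho1 L0 dr (@ubox_measurable R p r qj)
  (@ubox1 R p r qj) (minor y shp0 rkW hab) mpi pi0 pi1 piV inv.
exists t; split => //; exists J; split => // x m O mO.
have mI : measurable_fun setT (\1_O : d.-tuple R -> R) by [].
have I01 z : 0 <= (\1_O z : R) <= 1 by rewrite indicE; case: (z \in O); rewrite /= ?lexx ler01.
have KE z : Kpow X Z y a b m z O = (Piter (lebK R d) k \1_O m z)%:E.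
  elim: m z => [//|m IH] z /=.
  have [mP P01] := Piter_P mk k0 k1 m mI I01.
  have [<- _] := Pop_E mk k0 k1 mP P01.
  rewrite (_ : (fun eta' => _) = fun eta' => (k z eta' * (Piter (lebK R d) k \1_O m eta')%:E)%E); last first.
    by apply/funext => z'; rewrite IH.
  apply: lebintE.
    apply: emeasurable_funM; first exact: (measurableT_comp mk (measurable_pair1 z)).
    by apply/measurable_EFinP.
  by move=> z'; rewrite mule_ge0// lee_fin; have /andP[] := P01 z'.
by rewrite KE (posteriorE shp0 rkW hab qj0 A2 mO); exact: H.
Qed.
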